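(* Fix $u_m>0$. There exists $\varepsilon_0>0$ such that the following holds. Let $f\in C^3(\mathbb R)$ satisfy $\varepsilon_f\le\varepsilon_0$, let $u_-$, $\sigma$ and the degenerate viscous Oleinik shock profile $u^S$ be as in the context, let $u_0-u^S\in H^1(\mathbb R)$, and let $u$ be the global strong solution of $u_t+f(u)_x=u_{xx}$, $u(0,\cdot)=u_0$. Then there exists a shift $X^S:[0,\infty)\to\mathbb R$ with $X^S(0)=0$ such that $$\mathcal E^S(t)\le\mathcal E^S(0)\qquad\text{for all }t\ge0,$$ where $$\mathcal E^S(t):=\frac12\int_{\mathbb R}\bigl(5u_m-u^S(x-\sigma t+X^S(t))\bigr)\bigl(u(t,x)-u^S(x-\sigma t+X^S(t))\bigr)^2\,dx.$$
   Context: For $f\in C^3(\mathbb R)$ put $q(u):=f(u)-u^3$ and $\varepsilon_f:=\sup_{u\in\mathbb R}\frac{|q''(u)|}{u_m+|u|}+\|q'''\|_{L^\infty(\mathbb R)}$. For $\varepsilon_f$ sufficiently small (which $\varepsilon_0$ is understood to guarantee), $u_-$ denotes the unique state in $(-5u_m/2,-3u_m/2)$ with $\sigma:=\frac{f(u_m)-f(u_-)}{u_m-u_-}=f'(u_m)$, and $u^S\in C^2(\mathbb R)$ the unique solution of $-\sigma u^S_\xi+f(u^S)_\xi=u^S_{\xi\xi}$ with $u^S(-\infty)=u_-$, $u^S(+\infty)=u_m$, $u^S(0)=(u_-+u_m)/2$. Global strong solution: for every $T>0$, $u-u^S\in C([0,T];H^1(\mathbb R))\cap L^2(0,T;H^2(\mathbb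 R))$, $u_t\in L^2(0,T;L^2(\mathbb R))$, the equation holds in $L^2(\mathbb R)$ for a.e. $t\in(0,T)$, and $u(0)=u_0$. *)

(* Defs.v *)
(* Mathematical Components with MathComp-Analysis *)
From HB Require Import structures.
From mathcomp Require Import all_boot all_order all_algebra.
From mathcomp Require Import all_classical all_reals all_analysis.
Set Implicit Arguments.
Unset Strict Implicit.
Unset Printing Implicit Defensive.
Import Order.TTheory GRing.Theory Num.Theory.
Import numFieldNormedType.Exports.
Local Open Scope classical_set_scope.
Local Open Scope ring_scope.

Section function_spaces.
Context {R : realType}.
Local Notation mu := (@lebesgue_measure R).
Implicit Types (f g h phi : R -> R) (D K : set R) (v w s : R -> R -> R).

Definition Cdiff (k : nat) f : Prop :=
  (forall j : nat, (j < k)%N -> forall x : R, derivable (derive1n j f) x 1) /\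
  continuous (derive1n k f).

(* C_c^oo(D) *)
Definition test_function D phi : Prop :=
  (forall k : nat, Cdiff k phi) /\
  exists K, [/\ compact K, K `<=` D & forall x, ~ K x -> phi x = 0].

(* D is open: this is part of [locally_integrable] *)
Definition is_weak_derivative D g h : Prop :=
  [/\ locally_integrable D g, locally_integrable D h &
      forall phi, test_function D phi ->
        \int[mu]_(x in D) (g x * derive1 phi x) =
        - \int[mu]_(x in D) (h x * phi x)].

(* A version of the weak derivative on the whole line (unique up to a.e.
   equality), used only for functions that possess one. *)
Definition weak_derivative g : R -> R :=
  xget (fun=> 0) [set h | is_weak_derivative setT g h].

Definition L2 g : Prop := g \in Lfun mu 2%:E.

(* H^k(R), with H^0 = L^2; elements are functions, not classes *)
Fixpoint sobolev (k : nat) g : Prop :=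
  L2 g /\
  match k with
  | 0%N => True
  | k'.+1 => exists2 h, is_weak_derivative setT g h & sobolev k' h
  end.

Definition sobolev_norm (k : nat) g : \bar R :=
  sqrte (\sum_(j < k.+1)
    ('N[mu]_2%:E[EFin \o iter j weak_derivative g] ^+ 2))%E.

(* v \in C([0,T]; H^k(R)) *)
Definition continuous_in_sobolev (k : nat) (T : R) v : Prop :=
  (forall t, 0 <= t <= T -> sobolev k (v t)) /\
  forall t0, 0 <= t0 <= T ->
    sobolev_norm k (v t \- v t0) @[t --> within `[0, T] (nbhs t0)] --> 0%E.

Definition simple_valued (k : nat) s : Prop :=
  exists (N : nat) (A : 'I_N -> set R) (g : 'I_N -> R -> R),
    [/\ forall i, measurable (A i), forall i, sobolev k (g i) &
        forall t x, s t x = \sum_(i < N) \1_(A i) t * g i x].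

(* strong measurability of t |-> v t \in H^k(R) on (0,T) *)
Definition strongly_measurable (k : nat) (T : R) v : Prop :=
  exists s_ : nat -> R -> R -> R,
    (forall n, simple_valued k (s_ n)) /\
    {ae mu, forall t, 0 < t < T ->
       sobolev_norm k (v t \- s_ n t) @[n --> \oo] --> 0%E}.

(* v \in L^2(0,T; H^k(R)), in the sense of Bochner *)
Definition bochner_L2 (k : nat) (T : R) v : Prop :=
  [/\ {ae mu, forall t, 0 < t < T -> sobolev k (v t)},
      strongly_measurable k T v &
      (\int[mu]_(t in `]0%R, T[) (sobolev_norm k (v t) ^+ 2) < +oo)%E].

(* w = v_t in the sense of distributions on (0,T) x R, tested against the
   products psi(t) phi(x), which span a dense subspace of C_c^oo((0,T) x R) *)
Definition is_time_derivative (T : R) v w : Prop :=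
  forall phi, test_function setT phi ->
    is_weak_derivative `]0, T[
      (fun t => \int[mu]_x (v t x * phi x))
      (fun t => \int[mu]_x (w t x * phi x)).

End function_spaces.

Section degenerate_shock.
Context {R : realType}.
Local Notation mu := (@lebesgue_measure R).
Implicit Types (f uS : R -> R) (u : R -> R -> R) (um ul sigma : R).

Definition perturbation f : R -> R := fun y => f y - y ^+ 3.

Definition flux_eps um f : \bar R :=
  let q := perturbation f in
  (ereal_sup (range (fun y => (`|derive1n 2 q y| / (um + `|y|))%:E)) +
   'N[mu]_+oo[EFin \o derive1n 3 q])%E.

Definition shock_speed um f ul : R := (f um - f ul) / (um - ul).

Definition left_state um f ul : Prop :=
  [/\ - (5 * um / 2) < ul, ul < - (3 * um / 2) &
      shock_speed um f ul = derive1 f um].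

Definition viscous_profile um f ul uS : Prop :=
  let sigma := shock_speed um f ul in
  [/\ Cdiff 2 uS,
      forall x, - sigma * derive1 uS x + derive1 (f \o uS) x = derive1n 2 uS x,
      uS x @[x --> -oo] --> ul,
      uS x @[x --> +oo] --> um &
      uS 0 = (ul + um) / 2].

(* u t is the function x |-> u(t,x) *)
Definition global_strong_solution f uS (u0 : R -> R) u : Prop :=
  (forall T : R, 0 < T ->
    [/\ continuous_in_sobolev 1 T (fun t => u t \- uS),
        bochner_L2 2 T (fun t => u t \- uS) &
        exists ut : R -> R -> R,
          [/\ bochner_L2 0 T ut,
              is_time_derivative T u ut &
              {ae mu, forall t, 0 < t < T ->
                exists fx ux uxx : R -> R,
                  [/\ is_weak_derivative setT (f \o u t) fx,
                      is_weak_derivative setT (u t) ux,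
                      is_weak_derivative setT ux uxx,
                      [/\ L2 (ut t), L2 fx & L2 uxx] &
                      {ae mu, forall x, ut t x + fx x = uxx x}]}]]) /\
  {ae mu, forall x, u 0 x = u0 x}.

Definition weighted_energy um uS sigma (X : R -> R) u (t : R) : \bar R :=
  let uSX := fun x => uS (x - sigma * t + X t) in
  ((2^-1)%:E *
   \int[mu]_x ((5 * um - uSX x) * (u t x - uSX x) ^+ 2)%:E)%E.

End degenerate_shock.

(* Main.v *)
Require Import Defs.
From HB Require Import structures.
From mathcomp Require Import all_boot all_order all_algebra.
From mathcomp Require Import all_classical all_reals all_analysis measurable_realfun.
From mathcomp Require Import ring lra.
Import Order.TTheory GRing.Theory Num.Theory.
Import numFieldNormedType.Exports.
Local Open Scope classical_set_scope.
Local Open Scope ring_scope.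
Set Implicit Arguments.
Unset Strict Implicit.
Unset Printing Implicit Defensive.

(** Since the shift is unconstrained, at each time t it may be chosen to minimise
    over Z the energy e(t, Z) relative to the translated profile S_Z = u^S(. + Z);
    the claim is then that the minimum m(t) never exceeds e(0, 0).  With
    w = u - S_Z and a = 5 um - S_Z, the first-order condition at a minimiser is
    K = 0, where K = \int S_Z' (w^2/2 + a w).

    Freezing the time, the equation gives
      \int a w u_t <= (32/um) K^2 - sigma K.
    Integrating by parts, the left side plus sigma K is the integral of
    S_Z' brk - a w_x^2, where brk is a quartic polynomial in w up to errors
    controlled by eps_f.  Adding the multiple 8 um m K, with m = w(x0) and
    S_Z(x0) = - um, and the derivative of the calibration
      R = a F h d^2 + 2 a F ph' m d + T m^2,   d = w - ph(S) m,   F = S_Z',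
    with explicit functions h, ph, T of S (one choice on each side of x0), turns
    the integrand into a sum of squares and a quadratic form in (d, m) whose
    coefficients are polynomials in S; R vanishes at both ends of the line and its
    jump at x0 has the favourable sign.

    Between two close times s < t, with Z a minimiser at s, e(t, Z) - e(s, Z) is the
    integral over (s, t) of <u_t, z>, where z = a (w_t + w_s)/2.  As z is close to
    a w at all intermediate times, where moreover K is small, the increment of m is
    at most eta times the integral of C + |u_t|^2, with eta as small as desired.
    Such estimates add up over consecutive intervals, and eta -> 0. *)

(** * Polynomial certificates *)

(** No smallness of [w] is assumed, so its cubic and quartic terms cannot be estimated by the
    quadratic ones; they are completed. For um = 1 and the cubic flux the multiplier term [8 m K]
    contributes [4 m w^2], and all terms of degree 3 and 4 become
    [3/4 (w^2 + 2/3 ((5 + S) w + 4 m))^2] minus a quadratic form in [(w, m)]. That this remainder is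
    quadratic is the reason for a multiplier proportional to the point value [m]. [ph(S) m] is a
    trial shape for [w], normalised by [ph(- um) = 1]: [d] vanishes at [x0], where the two one-sided
    calibrations meet through [T] alone. Completing the square in [w_x] produces [h' + h^2], which
    is [g''/g] for [h = g'/g], hence explicit for an explicit [g]; the cross term of [R] cancels the
    mixed product [h ph' m d]. The jump of [T] at [x0] yields more than [um^3 m^2 / 2] on the good
    side, even after the small value of [T] at the perturbed left state is subtracted. This pays for
    the multiplier: [8 um m K <= um^3 m^2 / 2 + 32/um K^2], which is the origin of [32/um]. *)

Section alg.
Context {R : realFieldType}.

Lemma quadratic_form_ge0 (A e N d m : R) : 0 < A -> e ^+ 2 <= 4 * A * N ->
  0 <= A * d ^+ 2 + e * (m * d) + N * m ^+ 2.
Proof.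
move=> A0 h; rewrite -(pmulr_rge0 _ (_ : 0 < 4 * A)); last by lra.
have -> : 4 * A * (A * d ^+ 2 + e * (m * d) + N * m ^+ 2) =
  (2 * A * d + e * m) ^+ 2 + (4 * A * N - e ^+ 2) * m ^+ 2 by ring.
by rewrite addr_ge0 ?sqr_ge0// mulr_ge0 ?sqr_ge0// subr_ge0.
Qed.

(* Polynomial inequalities on an interval are certified by nonnegative
   combinations of Bernstein monomials. *)
Lemma bernstein8_ge0 (x y : R) : 0 <= x -> 0 <= y ->
  [/\ [/\ 0 <= y ^+ 8, 0 <= x * y ^+ 7, 0 <= x ^+ 2 * y ^+ 6 & 0 <= x ^+ 3 * y ^+ 5],
      0 <= x ^+ 4 * y ^+ 4 &
      [/\ 0 <= x ^+ 5 * y ^+ 3, 0 <= x ^+ 6 * y ^+ 2, 0 <= x ^+ 7 * y & 0 <= x ^+ 8]].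
Proof. by move=> x0 y0; split; [split|idtac|split]; rewrite ?mulr_ge0 ?exprn_ge0. Qed.

Lemma bernstein7_ge0 (x y : R) : 0 <= x -> 0 <= y ->
  [/\ 0 <= y ^+ 7, 0 <= x * y ^+ 6, 0 <= x ^+ 2 * y ^+ 5 & 0 <= x ^+ 3 * y ^+ 4] /\
  [/\ 0 <= x ^+ 4 * y ^+ 3, 0 <= x ^+ 5 * y ^+ 2, 0 <= x ^+ 6 * y & 0 <= x ^+ 7].
Proof. by move=> x0 y0; split; split; rewrite ?mulr_ge0 ?exprn_ge0. Qed.

Lemma bernstein4_ge0 (x y : R) : 0 <= x -> 0 <= y ->
  [/\ 0 <= y ^+ 4, 0 <= x * y ^+ 3, 0 <= x ^+ 2 * y ^+ 2, 0 <= x ^+ 3 * y & 0 <= x ^+ 4].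
Proof. by move=> x0 y0; split; rewrite ?mulr_ge0 ?exprn_ge0. Qed.

(* For um = 1 and z = 1 - S in [0, 2] (right half-line), calibration leaves the form
   Ar/(101/50 - z) d^2 + er m d + (Nr - tr) m^2, where tr is the derivative of T.  The
   margins 1/40 absorb the deviation from the cubic flux. *)
Definition Ar z : R := (24 - 3*z - 4*z^+2) * (1/8 * (101/50 - z) + z) -
  (12 - z - z^+2) * (9/64 * (101/50 - z) + z/4) - (z*(33+z)/3) * (101/50 - z).
Definition er z : R := 5/2 * (24*z - 3*z^+2 - 4*z^+3) - 2 * (z*(33+z)/3) * (7/2 - 5/4*z)
  + 8 * (6 + 4*z) / 3.
Definition Nr z : R := 25/16 * (12*z^+2 - z^+3 - z^+4) - (z*(33+z)/3) * (7/2 - 5/4*z)^+2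
  + 8 * (6 + 4*z) / 3 * (7/2 - 5/4*z) - 16/3.
Definition tr z : R := - 1 - 111*z + 132*z^+2 - 163/5 * z^+3.

(** Positivity of the leading coefficient and the discriminant condition for the form less its
    margins, both cleared of the denominator [101/50 - z]. The second inequality has degree 7, the
    first less than 4. *)
Lemma right_polys z : 0 <= z -> z <= 2 ->
  1/40 * (101/50 - z) < Ar z /\
  er z ^+ 2 * (101/50 - z) <= 4 * (Ar z - 1/40 * (101/50 - z)) * (Nr z - tr z - 1/40).
Proof.
move=> z0 z2; rewrite /Ar /er /Nr /tr.
have [z1|z1] := leP z 1.
  have [[a1 a2 a3 a4] [a5 a6 a7 a8]] := @bernstein7_ge0 z (1 - z) z0 ltac:(lra).
  have [b1 b2 b3 b4 b5] := @bernstein4_ge0 z (1 - z) z0 ltac:(lra).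
  split; lra.
have [[a1 a2 a3 a4] [a5 a6 a7 a8]] := @bernstein7_ge0 (z - 1) (2 - z) ltac:(lra) ltac:(lra).
have [b1 b2 b3 b4 b5] := @bernstein4_ge0 (z - 1) (2 - z) ltac:(lra) ltac:(lra).
split; lra.
Qed.

(* The left half-line, with v = S + 2 and 1 - 7/10 v - v^2/4 in place of 101/50 - z. *)
Definition Al v : R := (63*v - 51*v^+2 + 13*v^+3 - v^+4) / 2
  + (63 - 102*v + 39*v^+2 - 4*v^+3) * (7/10 + v/2)
  - (3-v)*(36-v)/3 * (1 - 7/10*v - v^+2/4).
Definition el v : R := 2/3 * (63 - 102*v + 39*v^+2 - 4*v^+3)
  - 2 * ((3-v)*(36-v)/3) * (4/3 - v/3) + 8 * (18 - 4*v) / 3.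
Definition Nl v : R := 1/9 * (63*v - 51*v^+2 + 13*v^+3 - v^+4)
  - ((3-v)*(36-v)/3) * (4/3 - v/3)^+2 + 8 * (18 - 4*v) / 3 * (4/3 - v/3) - 16/3.
Definition tl v : R := - 7 + 27*v - 10*v^+2.

Lemma left_polys v : - (1/100) <= v -> v <= 1 ->
  1/40 * (1 - 7/10*v - v^+2/4) < Al v /\
  el v ^+ 2 * (1 - 7/10*v - v^+2/4) <=
    4 * (Al v - 1/40 * (1 - 7/10*v - v^+2/4)) * (Nl v - tl v - 1/40).
Proof.
move=> v0 v1; rewrite /Al /el /Nl /tl.
have [[a1 a2 a3 a4] a5 [a6 a7 a8 a9]] := @bernstein8_ge0 (v + 1/100) (1 - v) ltac:(lra) ltac:(lra).
have [b1 b2 b3 b4 b5] := @bernstein4_ge0 (v + 1/100) (1 - v) ltac:(lra) ltac:(lra).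
split; lra.
Qed.

End alg.

Section alg.
Context {R : realFieldType}.
Implicit Types k d m w a b : R.

Lemma normM_le (a b A B : R) : `|a| <= A -> `|b| <= B -> `|a * b| <= A * B.
Proof. by move=> h1 h2; rewrite normrM ler_pM. Qed.

Lemma norm_mulD_le (a b A B c d C D : R) : `|a| <= A -> `|b| <= B -> `|c| <= C ->
  `|d| <= D -> `|a * b + c * d| <= A * B + C * D.
Proof.
by move=> *; apply: le_trans (ler_normD _ _) _; apply: lerD; exact: normM_le.
Qed.

(** Writing [w^2 = (w^2 + 2/3 a) - 2/3 a] gives [w^4 <= 2 (w^2 + 2/3 a)^2 + 8/9 a^2], so the square
    absorbs the quartic part of the error as soon as [2 k <= 3/4]. *)
Lemma complete_square k a w b : 0 <= k -> 8 * k <= 3 -> `|b| <= k * (w ^+ 2 + w ^+ 4) ->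
  - (k * w ^+ 2 + 8/9 * k * a ^+ 2) <= 3/4 * (w ^+ 2 + 2/3 * a) ^+ 2 - b.
Proof.
move=> k0 k1; rewrite ler_norml => /andP[_ b1].
have s0 := sqr_ge0 (w ^+ 2 + 2/3 * a).
have h : w ^+ 4 <= 2 * (w ^+ 2 + 2/3 * a) ^+ 2 + 8/9 * a ^+ 2.
  by have := sqr_ge0 (w ^+ 2 + 4/3 * a); lra.
have h1 := ler_wpM2l k0 h.
have h2 : 2 * k * (w ^+ 2 + 2/3 * a) ^+ 2 <= 3/4 * (w ^+ 2 + 2/3 * a) ^+ 2.
  by apply: ler_wpM2r => //; lra.
lra.
Qed.

(** Once [w] and [a] are expressed through [d] and [m], the errors cost less than [2000 k] on each
    of [d^2] and [m^2]. Half of the margin [1/40] exceeds this because [k <= 1/250000]; the other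
    half of the [m^2] margin is the left-hand side. *)
Lemma perturb_margin k d m w a s rc r1 r2 Q b : 0 <= k -> 500 * (500 * k) <= 1 ->
  `|b| <= k * (w ^+ 2 + w ^+ 4) ->
  s = 3/4 * (w ^+ 2 + 2/3 * a) ^+ 2 ->
  `|rc| <= 960 * k -> `|r1| <= 40 * k -> `|r2| <= 38 * k ->
  w ^+ 2 <= 2 * d ^+ 2 + 25 * m ^+ 2 -> a ^+ 2 <= 72 * w ^+ 2 + 32 * m ^+ 2 ->
  1/40 * (d ^+ 2 + m ^+ 2) <= Q ->
  m ^+ 2 / 80 <= Q + (s - b) - rc * d ^+ 2 - r1 * (m * d) + r2 * m ^+ 2.
Proof.
move=> k0 k1 hb hs hrc hr1 hr2 hw ha hQ.
have k2 : 8 * k <= 3 by clear -k0 k1; lra.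
have hC := complete_square a k0 k2 hb; rewrite -hs in hC.
have d2 := sqr_ge0 d; have m2 := sqr_ge0 m.
have f1 : 500 * (500 * k) * (d ^+ 2 + m ^+ 2) <= 1 * (d ^+ 2 + m ^+ 2).
  by apply: ler_wpM2r => //; rewrite addr_ge0.
have f2 : 0 <= k * d ^+ 2 by rewrite mulr_ge0.
have f3 : 0 <= k * m ^+ 2 by rewrite mulr_ge0.
have e1 : rc * d ^+ 2 <= 960 * k * d ^+ 2.
  by apply: ler_wpM2r => //; apply: le_trans (ler_norm _) hrc.
have g : `|m * d| <= (m ^+ 2 + d ^+ 2) / 2.
  have h1 := sqr_ge0 (m - d); have h2 := sqr_ge0 (m + d).
  by rewrite ler_norml; apply/andP; clear -h1 h2; split; lra.
have e2 := le_trans (ler_norm _) (normM_le hr1 g).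
have e3 : - (38 * k) * m ^+ 2 <= r2 * m ^+ 2.
  apply: ler_wpM2r => //.
  by move: hr2; rewrite ler_norml => /andP[+ _].
have e6 := ler_wpM2l k0 hw; have e7 := ler_wpM2l k0 ha.
clear -hC f1 f2 f3 e1 e2 e3 e6 e7 hQ d2 m2.
lra.
Qed.

Lemma right_form (z i d m : R) : 0 <= z -> z <= 2 -> 0 < i -> (101/50 - z) * i = 1 ->
  1/40 * (d ^+ 2 + m ^+ 2) <= Ar z * i * d ^+ 2 + er z * (m * d) + (Nr z - tr z) * m ^+ 2.
Proof.
move=> z0 z2 i0 ci; have [q1 q2] := right_polys z0 z2.
have := @quadratic_form_ge0 R (Ar z * i - 1/40) (er z) (Nr z - tr z - 1/40) d m.
have h1 : 0 < Ar z * i - 1/40.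
  have := mulr_gt0 i0 (_ : 0 < Ar z - 1/40 * (101/50 - z)); rewrite subr_gt0 => /(_ q1).
  have -> : i * (Ar z - 1/40 * (101/50 - z)) = Ar z * i - 1/40 * ((101/50 - z) * i) by ring.
  by rewrite ci mulr1.
have h2 : er z ^+ 2 <= 4 * (Ar z * i - 1/40) * (Nr z - tr z - 1/40).
  have := ler_wpM2r (ltW i0) q2.
  have -> : er z ^+ 2 * (101/50 - z) * i = er z ^+ 2 * ((101/50 - z) * i) by ring.
  have -> : 4 * (Ar z - 1/40 * (101/50 - z)) * (Nr z - tr z - 1/40) * i =
    4 * (Ar z * i - 1/40 * ((101/50 - z) * i)) * (Nr z - tr z - 1/40) by ring.
  by rewrite ci !mulr1.
by move=> /(_ h1 h2); move: (Ar z * i) (er z) (Nr z) (tr z) => ? ? ? ? {}h1; lra.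
Qed.

(** The hypothesis of [cal_ineqP] for um = 1. [Fa] and [Fb] stand for [F / z^2] and [F1 / z]: these
    powers of [z] cancel the poles at [z = 0] of [h = (1/8 + z i) / z] and of
    [h' + h^2 = (9/64 + z i / 4) / z^2]. The errors [d0] and [d1] of the flux are therefore relative
    ones. *)
Lemma right_pointwise (k z d0 d1 w m b : R) : 0 <= k -> 500 * (500 * k) <= 1 ->
  0 <= z -> z <= 2 -> `|d0| <= k -> `|d1| <= k -> `|b| <= k * (w ^+ 2 + w ^+ 4) ->
  forall Fa Fb i P1 P2 d : R, Fa = 3 - z + d0 -> Fb = 3 * z - 6 + d1 ->
  i = (101/50 - z)^-1 ->
  P1 = (4 + z) * Fb - z * Fa -> P2 = (4 + z) * Fa ->
  d = w - (7/2 - 5/4 * z) * m ->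
  m ^+ 2 / 80 <= - (P1 * (1/8 + z * i) + P2 * (9/64 + z * i / 4)) * d ^+ 2
   - 5/2 * (z * P1) * (m * d) + 25/16 * (z ^+ 2 * P2) * m ^+ 2 - tr z * m ^+ 2
   - ((15 * z - 12) * w ^+ 2 - (6 - z) * w ^+ 3 - 3/4 * w ^+ 4 + b)
   + 8 * m * (w ^+ 2 / 2 + (4 + z) * w).
Proof.
move=> k0 k1 z0 z2 hd0 hd1 hb Fa Fb i P1 P2 d EFa EFb Ei EP1 EP2 Ed.
have c0 : 1/50 <= 101/50 - z by clear -z2; lra.
have i0 : 0 < i by rewrite Ei invr_gt0; clear -c0; lra.
have ci : (101/50 - z) * i = 1 by rewrite Ei mulfV//; apply/eqP; clear -c0; lra.
have i50 : i <= 50 by clear -c0 i0 ci; nra.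
have zi0 : 0 <= z * i by rewrite mulr_ge0// ltW.
have zi : z * i <= 100 by clear -z0 z2 i0 i50; nra.
have Q := right_form d m z0 z2 i0 ci.
have EA : Ar z * i = (24 - 3*z - 4*z^+2) * (1/8 + z * i) -
    (12 - z - z^+2) * (9/64 + z * i/4) - (z*(33+z)/3).
  rewrite /Ar.
  have -> : ((24 - 3*z - 4*z^+2) * (1/8 * (101/50 - z) + z) -
    (12 - z - z^+2) * (9/64 * (101/50 - z) + z/4) - (z*(33+z)/3) * (101/50 - z)) * i
   = (24 - 3*z - 4*z^+2) * (1/8 * ((101/50 - z) * i) + z * i) -
    (12 - z - z^+2) * (9/64 * ((101/50 - z) * i) + z * i/4) - (z*(33+z)/3) * ((101/50 - z) * i).
    by clear; ring.
  by rewrite ci !mulr1.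
pose al := (6 - z) * w + 4 * m.
have z4 : `|4 + z| <= 6 by clear -z0 z2; rewrite ger0_norm; lra.
have zz : `|z| <= 2 by rewrite ger0_norm.
pose r1 := (4 + z) * d1 + - z * d0; pose r2 := (4 + z) * d0.
have hr1 : `|r1| <= 8 * k.
  have nz : `|- z| <= 2 by rewrite normrN.
  by apply: le_trans (norm_mulD_le z4 hd1 nz hd0) _; clear -k0; lra.
have hr2 : `|r2| <= 6 * k by exact: normM_le.
pose rc := r1 * (1/8 + z * i) + r2 * (9/64 + z * i / 4).
have hrc : `|rc| <= 960 * k.
  have g1 : `|1/8 + z * i| <= 1/8 + 100 by clear -zi zi0; rewrite ger0_norm; lra.
  have g2 : `|9/64 + z * i / 4| <= 9/64 + 25 by clear -zi zi0; rewrite ger0_norm; lra.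
  by apply: le_trans (norm_mulD_le hr1 g1 hr2 g2) _; clear -k0; lra.
pose s1 := 5/2 * (z * r1).
have hs1 : `|s1| <= 40 * k.
  have n5 : `|5/2 : R| <= 5/2 by clear; rewrite ger0_norm; lra.
  by apply: le_trans (normM_le n5 (normM_le zz hr1)) _; clear -k0; lra.
pose s2 := 25/16 * (z ^+ 2 * r2).
have hs2 : `|s2| <= 38 * k.
  have n5 : `|25/16 : R| <= 25/16 by clear; rewrite ger0_norm; lra.
  have zz2 : `|z ^+ 2| <= 4 by rewrite normrX; clear -zz z0; rewrite ger0_norm// in zz *; nra.
  by apply: le_trans (normM_le n5 (normM_le zz2 hr2)) _; clear -k0; lra.
have -> : - (P1 * (1/8 + z * i) + P2 * (9/64 + z * i / 4)) * d ^+ 2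
   - 5/2 * (z * P1) * (m * d) + 25/16 * (z ^+ 2 * P2) * m ^+ 2 - tr z * m ^+ 2
   - ((15 * z - 12) * w ^+ 2 - (6 - z) * w ^+ 3 - 3/4 * w ^+ 4 + b)
   + 8 * m * (w ^+ 2 / 2 + (4 + z) * w) =
  (Ar z * i * d ^+ 2 + er z * (m * d) + (Nr z - tr z) * m ^+ 2)
  + (3/4 * (w ^+ 2 + 2/3 * al) ^+ 2 - b)
  - rc * d ^+ 2 - s1 * (m * d) + s2 * m ^+ 2.
  rewrite EA /rc /s1 /s2 /r1 /r2 /al EP1 EP2 EFa EFb /er /Nr Ed.
  move: (z * i) (tr z) => zi_ tz; clear; by field.
(* The two remaining bounds use that the trial shape is at most [7/2], so that [2 (7/2)^2 <= 25],
   and that [6 - z <= 6]. *)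
apply: (perturb_margin k0 k1 hb erefl hrc hs1 hs2 _ _ Q).
  have -> : w = d + (7/2 - 5/4 * z) * m by rewrite Ed; ring.
  have h1 := sqr_ge0 (d - (7/2 - 5/4 * z) * m).
  have h2 : (7/2 - 5/4 * z) ^+ 2 * m ^+ 2 <= 49/4 * m ^+ 2.
    by apply: ler_wpM2r; [exact: sqr_ge0|clear -z0 z2; nra].
  have h3 := sqr_ge0 m; clear -h1 h2 h3; lra.
rewrite /al; have h1 := sqr_ge0 ((6 - z) * w - 4 * m).
have h2 : (6 - z) ^+ 2 * w ^+ 2 <= 36 * w ^+ 2.
  by apply: ler_wpM2r; [exact: sqr_ge0|clear -z0 z2; nra].
clear -h1 h2; lra.
Qed.

Lemma left_form (v i d m : R) : - (1/100) <= v -> v <= 1 -> 0 < i ->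
  (1 - 7/10*v - v^+2/4) * i = 1 ->
  1/40 * (d ^+ 2 + m ^+ 2) <= Al v * i * d ^+ 2 + el v * (m * d) + (Nl v - tl v) * m ^+ 2.
Proof.
move=> v0 v1 i0; have [] := left_polys v0 v1; set ps := 1 - 7/10*v - v^+2/4 => q1 q2 ci.
have := @quadratic_form_ge0 R (Al v * i - 1/40) (el v) (Nl v - tl v - 1/40) d m.
have h1 : 0 < Al v * i - 1/40.
  have := mulr_gt0 i0 (_ : 0 < Al v - 1/40 * ps); rewrite subr_gt0 => /(_ q1).
  have -> : i * (Al v - 1/40 * ps) = Al v * i - 1/40 * (ps * i) by ring.
  by rewrite ci mulr1.
have h2 : el v ^+ 2 <= 4 * (Al v * i - 1/40) * (Nl v - tl v - 1/40).
  have := ler_wpM2r (ltW i0) q2.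
  have -> : el v ^+ 2 * ps * i = el v ^+ 2 * (ps * i) by ring.
  have -> : 4 * (Al v - 1/40 * ps) * (Nl v - tl v - 1/40) * i =
    4 * (Al v * i - 1/40 * (ps * i)) * (Nl v - tl v - 1/40) by ring.
  by rewrite ci !mulr1.
by move=> /(_ h1 h2); move: (Al v * i) (el v) (Nl v) (tl v) => ? ? ? ? {}h1; lra.
Qed.

(** Here [h] has no pole, since the denominator stays above [1/20]. The error [d0] is additive and
    not relative to [v], because [F] vanishes at the true left state, which need not be [v = 0]. *)
Lemma left_pointwise (k v d0 d1 w m b : R) : 0 <= k -> 500 * (500 * k) <= 1 ->
  - (1/100) <= v -> v <= 1 -> `|d0| <= k -> `|d1| <= k -> `|b| <= k * (w ^+ 2 + w ^+ 4) ->
  forall F F1 i P1 P2 d : R, F = v * (3 - v) ^+ 2 + d0 ->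
  F1 = (3 - v) ^+ 2 - 2 * v * (3 - v) + d1 ->
  i = (1 - 7/10*v - v^+2/4)^-1 ->
  P1 = (7 - v) * F1 - F -> P2 = (7 - v) * F ->
  d = w - (4/3 - v/3) * m ->
  m ^+ 2 / 80 <= - ((P1 * (- (7/10) - v/2) + P2 * (- (1/2))) * i) * d ^+ 2
   + 2/3 * P1 * (m * d) + 1/9 * P2 * m ^+ 2 - tl v * m ^+ 2
   - ((33 - 15 * v) * w ^+ 2 - (3 + v) * w ^+ 3 - 3/4 * w ^+ 4 + b)
   + 8 * m * (w ^+ 2 / 2 + (7 - v) * w).
Proof.
move=> k0 k1 v0 v1 hd0 hd1 hb F F1 i P1 P2 d EF EF1 Ei EP1 EP2 Ed.
have c0 : 1/20 <= 1 - 7/10*v - v^+2/4 by clear -v0 v1; nra.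
have i0 : 0 < i by rewrite Ei invr_gt0; clear -c0; lra.
have ci : (1 - 7/10*v - v^+2/4) * i = 1 by rewrite Ei mulfV//; apply/eqP; clear -c0; lra.
have i20 : i <= 20 by clear -c0 i0 ci; nra.
have Q := left_form d m v0 v1 i0 ci.
have EA : Al v * i = ((63*v - 51*v^+2 + 13*v^+3 - v^+4) / 2
  + (63 - 102*v + 39*v^+2 - 4*v^+3) * (7/10 + v/2)) * i - (3-v)*(36-v)/3.
  by rewrite /Al [LHS]mulrBl -(mulrA ((3-v)*(36-v)/3)) ci mulr1.
pose al := (3 + v) * w + 4 * m.
have v7 : `|7 - v| <= 8 by clear -v0 v1; rewrite ger0_norm; lra.
pose r1 := (7 - v) * d1 + - 1 * d0; pose r2 := (7 - v) * d0.
have n1 : `|- 1 : R| <= 1 by rewrite normrN1.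
have hr1 : `|r1| <= 9 * k.
  by apply: le_trans (norm_mulD_le v7 hd1 n1 hd0) _; clear -k0; lra.
have hr2 : `|r2| <= 8 * k by exact: normM_le.
pose rc := (r1 * (- (7/10) - v/2) + r2 * (- (1/2))) * i.
have hrc : `|rc| <= 960 * k.
  have g1 : `|- (7/10) - v/2| <= 2 by clear -v0 v1; rewrite ler_norml; apply/andP; split; lra.
  have g2 : `|- (1/2) : R| <= 1 by clear; rewrite ler_norml; apply/andP; split; lra.
  have gi : `|i| <= 20 by rewrite ger0_norm// ltW.
  by apply: le_trans (normM_le (norm_mulD_le hr1 g1 hr2 g2) gi) _; clear -k0; lra.
pose s1 := - (2/3) * r1.
have hs1 : `|s1| <= 40 * k.
  have n5 : `|- (2/3) : R| <= 1 by clear; rewrite ler_norml; apply/andP; split; lra.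
  by apply: le_trans (normM_le n5 hr1) _; clear -k0; lra.
pose s2 := 1/9 * r2.
have hs2 : `|s2| <= 38 * k.
  have n5 : `|1/9 : R| <= 1 by clear; rewrite ger0_norm; lra.
  by apply: le_trans (normM_le n5 hr2) _; clear -k0; lra.
have -> : - ((P1 * (- (7/10) - v/2) + P2 * (- (1/2))) * i) * d ^+ 2
   + 2/3 * P1 * (m * d) + 1/9 * P2 * m ^+ 2 - tl v * m ^+ 2
   - ((33 - 15 * v) * w ^+ 2 - (3 + v) * w ^+ 3 - 3/4 * w ^+ 4 + b)
   + 8 * m * (w ^+ 2 / 2 + (7 - v) * w) =
  (Al v * i * d ^+ 2 + el v * (m * d) + (Nl v - tl v) * m ^+ 2)
  + (3/4 * (w ^+ 2 + 2/3 * al) ^+ 2 - b)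
  - rc * d ^+ 2 - s1 * (m * d) + s2 * m ^+ 2.
  rewrite EA /rc /s1 /s2 /r1 /r2 /al EP1 EP2 EF EF1 /el /Nl Ed.
  move: (i) (tl v) => i_ tz; clear; by field.
apply: (perturb_margin k0 k1 hb erefl hrc hs1 hs2 _ _ Q).
  have -> : w = d + (4/3 - v/3) * m by rewrite Ed; ring.
  have h1 := sqr_ge0 (d - (4/3 - v/3) * m).
  have h2 : (4/3 - v/3) ^+ 2 * m ^+ 2 <= 49/4 * m ^+ 2.
    by apply: ler_wpM2r; [exact: sqr_ge0|clear -v0 v1; nra].
  have h3 := sqr_ge0 m; clear -h1 h2 h3; lra.
rewrite /al; have h1 := sqr_ge0 ((3 + v) * w - 4 * m).
have h2 : (3 + v) ^+ 2 * w ^+ 2 <= 36 * w ^+ 2.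
  by apply: ler_wpM2r; [exact: sqr_ge0|clear -v0 v1; nra].
clear -h1 h2; lra.
Qed.
End alg.

(** * Differential calculus and the flux *)
Section calculus.
Context {R : realType}.
Implicit Types f g : R -> R.

Lemma derD f g (x a b : R) : is_derive x 1 f a -> is_derive x 1 g b ->
  is_derive x 1 (fun y => f y + g y) (a + b).
Proof. by move=> ? ?; exact: is_deriveD. Qed.

Lemma derB f g (x a b : R) : is_derive x 1 f a -> is_derive x 1 g b ->
  is_derive x 1 (fun y => f y - g y) (a - b).
Proof. by move=> ? ?; exact: is_deriveB. Qed.

Lemma derN f (x a : R) : is_derive x 1 f a -> is_derive x 1 (fun y => - f y) (- a).
Proof. by move=> ?; exact: is_deriveN. Qed.

Lemma derM f g (x a b : R) : is_derive x 1 f a -> is_derive x 1 g b ->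
  is_derive x 1 (fun y => f y * g y) (f x * b + g x * a).
Proof. by move=> ? ?; exact: is_deriveM. Qed.

Lemma derX f (n : nat) (x a : R) : is_derive x 1 f a ->
  is_derive x 1 (fun y => f y ^+ n) (n%:R * f x ^+ n.-1 * a).
Proof.
move=> ?; rewrite (_ : (fun y => f y ^+ n) = f ^+ n); first exact: is_deriveX.
by rewrite exprfctE.
Qed.

Lemma derV f (x a : R) : f x != 0 -> is_derive x 1 f a ->
  is_derive x 1 (fun y => (f y)^-1) (- (f x) ^- 2 * a).
Proof. by move=> h ?; exact: is_deriveV. Qed.

Lemma derC (c x : R) : is_derive x 1 (fun=> c) 0.
Proof. exact: is_derive_cst. Qed.

Lemma derI (x : R) : is_derive x 1 (fun y => y) 1.
Proof. exact: is_derive_id. Qed.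

Lemma derComp f g (x a b : R) : is_derive x 1 g b -> is_derive (g x) 1 f a ->
  is_derive x 1 (fun y => f (g y)) (a * b).
Proof. by move=> ? ?; exact: is_derive1_comp. Qed.

Lemma der_cont f (x a : R) : is_derive x 1 f a -> {for x, continuous f}.
Proof. by move=> [d _]; apply/differentiable_continuous/derivable1_diffP. Qed.

Lemma der_val f (x a : R) : is_derive x 1 f a -> derive1 f x = a.
Proof. by move=> [_]; rewrite derive1E. Qed.

Lemma derAl (c x : R) : is_derive x 1 (+%R c) 1.
Proof. by have := derD (derC c x) (derI x); rewrite add0r. Qed.

Lemma derMl (c x : R) : is_derive x 1 ( *%R c) c.
Proof. by have := derM (derC c x) (derI x); rewrite mulr0 mulr1 addr0. Qed.

Lemma derE f (x a b : R) : is_derive x 1 f a -> a = b -> is_derive x 1 f b.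
Proof. by move=> h <-. Qed.

Lemma derivable_der f (x : R) : derivable f x 1 -> is_derive x 1 f (derive1 f x).
Proof. by move=> h; split => //; rewrite derive1E. Qed.
End calculus.

Ltac der := match goal with
  | |- is_derive _ _ (fun y => ?c) _ => notypeclasses refine (derC _ _)
  | |- is_derive _ _ (GRing.mul _) _ => notypeclasses refine (derMl _ _)
  | |- is_derive _ _ (GRing.add _) _ => notypeclasses refine (derAl _ _)
  | |- is_derive _ _ (fun y => _ + _) _ => notypeclasses refine (derD _ _); der
  | |- is_derive _ _ (fun y => - _) _ => notypeclasses refine (derN _); der
  | |- is_derive _ _ (fun y => _ * _) _ => notypeclasses refine (derM _ _); der
  | |- is_derive _ _ (fun y => _ ^+ _) _ => notypeclasses refine (derX _ _); der
  | |- is_derive _ _ (fun y => _ ^-1) _ => notypeclasses refine (derV _ _); [idtac|der]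
  | |- is_derive _ _ (fun y => y) _ => notypeclasses refine (derI _)
  | H : forall x, is_derive x _ ?g _ |- is_derive _ _ (fun y => ?g y) _ => refine (H _)
  | H : forall x, is_derive x _ ?g _ |- is_derive _ _ ?g _ => refine (H _)
  | H : is_derive _ _ ?g _ |- is_derive _ _ (fun y => ?g y) _ => refine H
  | H : forall x, is_derive x _ ?g _ |- is_derive _ _ (fun y => ?g _) _ =>
      notypeclasses refine (@derComp _ g _ _ _ _ _ _); [der|refine (H _)]
  | |- is_derive _ _ _ _ => eassumption
  | _ => idtac
  end.

Ltac derive_by := notypeclasses refine (derE _ _); [der|].

Section mean_value.
Context {R : realType}.
Implicit Types f g : R -> R.

Lemma mvt_seg f f1 (a b : R) : a <= b ->
  (forall x : R, a <= x <= b -> is_derive x 1 f (f1 x)) ->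
  exists2 c, a <= c <= b & f b - f a = f1 c * (b - a).
Proof.
move=> ab h.
have [||c cab ->] := @MVT_segment R f f1 a b ab; last first.
- by exists c => //; rewrite in_itv in cab.
- apply: derivable_within_continuous => x /[!in_itv]/= xab.
  by have [] := h _ xab.
- by move=> x /[!in_itv]/= /andP[/ltW ax /ltW xb]; apply: h; rewrite ax.
Qed.

Lemma mvt f f1 (a b : R) : (forall x : R, is_derive x 1 f (f1 x)) ->
  exists2 c, `|c - a| <= `|b - a| & f b - f a = f1 c * (b - a).
Proof.
move=> h; have [ab|/ltW ba] := leP a b.
  have [c /andP[ac cb] e] := mvt_seg ab (fun x _ => h x).
  by exists c => //; rewrite !ger0_norm ?subr_ge0// lerD2r.
have [c /andP[ac cb] e] := mvt_seg ba (fun x _ => h x).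
exists c; first by rewrite !ler0_norm ?subr_le0// lerN2 lerD2r.
by rewrite -(opprB a b) mulrN -e opprB.
Qed.

Lemma der_ge0_nondecreasing f f1 (a b : R) : a <= b ->
  (forall x : R, a <= x <= b -> is_derive x 1 f (f1 x)) ->
  (forall x, a <= x <= b -> 0 <= f1 x) -> f a <= f b.
Proof.
move=> ab h h0; have [c hc e] := mvt_seg ab h.
by rewrite -subr_ge0 e mulr_ge0 ?subr_ge0// h0.
Qed.

Lemma der0_cst f (a b : R) : (forall x : R, is_derive x 1 f 0) -> f a = f b.
Proof. by move=> h; apply: is_derive_0_is_cst. Qed.
End mean_value.

Section flux.
Context {R : realType}.
Context (um e : R) (f f1 f2 : R -> R) (um0 : 0 < um) (e0 : 0 <= e)
  (df : forall x : R, is_derive x 1 f (f1 x)) (df1 : forall x : R, is_derive x 1 f1 (f2 x))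
  (hq : forall y, `|f2 y - 6 * y| <= e * (um + `|y|)).

Let q y := f y - y ^+ 3.
Let q1 y := f1 y - 3 * y ^+ 2.
Let q2 y := f2 y - 6 * y.

Let dq (x : R) : is_derive x 1 q (q1 x).
Proof. by rewrite /q; derive_by; rewrite /q1 /=; ring. Qed.

Let dq1 (x : R) : is_derive x 1 q1 (q2 x).
Proof. by rewrite /q1; derive_by; rewrite /q2 /=; ring. Qed.

Let q1_lip a b : `|q1 b - q1 a| <= e * (um + `|a| + `|b - a|) * `|b - a|.
Proof.
have [s sab ->] := mvt a b dq1.
rewrite normrM ler_wpM2r//; apply: le_trans (hq _) _.
rewrite ler_wpM2l// -addrA lerD2l -lerBlDl.
by apply: le_trans (lerB_dist _ _) _.
Qed.

Let q_taylor a b :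
  `|q b - q a - q1 a * (b - a)| <= e * (um + `|a| + `|b - a|) * (b - a) ^+ 2.
Proof.
have [s sab ->] := mvt a b dq.
rewrite -mulrBl normrM -real_normK ?num_real// expr2 mulrA ler_wpM2r//.
apply: le_trans (q1_lip _ _) _; apply: ler_pM => //.
  by rewrite mulr_ge0// !addr_ge0// ltW.
by rewrite ler_wpM2l// lerD2l.
Qed.

(* The profile equation is S' = excess S; for the flux S^3 the excess is
   (S - um)^2 (S + 2 um). *)
Definition excess S := f S - f um - f1 um * (S - um).

Lemma excess_der (x : R) : is_derive x 1 excess (f1 x - f1 um).
Proof. by rewrite /excess; derive_by; rewrite /=; ring. Qed.

Lemma excess_near S : - (3 * um) <= S <= um ->
  `|excess S - (S - um) ^+ 2 * (S + 2 * um)| <= 6 * e * um * (S - um) ^+ 2.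
Proof.
move=> /andP[S1 S2]; have h := q_taylor um S.
have -> : excess S - (S - um) ^+ 2 * (S + 2 * um) = q S - q um - q1 um * (S - um).
  by rewrite /excess /q /q1; ring.
apply: le_trans h _; rewrite ler_wpM2r ?sqr_ge0// -mulrA mulrCA ler_wpM2l//.
rewrite (ger0_norm (ltW um0)) ler0_norm ?subr_le0//; lra.
Qed.

Lemma excess1_near S : - (3 * um) <= S <= um ->
  `|f1 S - f1 um - (3 * S ^+ 2 - 3 * um ^+ 2)| <= 6 * e * um * `|S - um|.
Proof.
move=> /andP[S1 S2]; have h := q1_lip um S.
have -> : f1 S - f1 um - (3 * S ^+ 2 - 3 * um ^+ 2) = q1 S - q1 um.
  by rewrite /q1; ring.
apply: le_trans h _; rewrite ler_wpM2r// -mulrA mulrCA ler_wpM2l//.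
rewrite (ger0_norm (ltW um0)) ler0_norm ?subr_le0//; lra.
Qed.

Section bracket.
Context (Fp : R -> R) (dFp : forall x : R, is_derive x 1 Fp (f x)).

(** The density left in front of [S'] after integration by parts, apart from the [f1 um] multiple of
    [K]. [Fp] is a primitive of the flux, and [Fp (S + w) - Fp S - f S * w] comes from moving the
    derivative off the nonlinear flux difference. *)
Definition bracket S w :=
  f1 um * w ^+ 2 / 2 - (f1 S - f1 um) * w ^+ 2 / 2 + (Fp (S + w) - Fp S - f S * w)
  - (5 * um - S) * (f (S + w) - f S - f1 S * w) - w * (f (S + w) - f S).

(** Second-order Taylor remainder at [S] of a primitive of [q]. Its derivative in [w] is the
    first-order remainder of [q], which [q_taylor] controls. *)
Let g3 S w := Fp (S + w) - (S + w) ^+ 4 / 4 - (Fp S - S ^+ 4 / 4) - q S * w - q1 S * w ^+ 2 / 2.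

Let g3_bound S w : `|g3 S w| <= e * (um + `|S| + `|w|) * w ^+ 2 * `|w|.
Proof.
have [|c] := @mvt R (g3 S) (fun w => q (S + w) - q S - q1 S * w) 0 w.
  move=> x; rewrite /g3; derive_by.
  rewrite /q /q1 /=. by field.
rewrite !subr0 => cw.
have -> : g3 S 0 = 0 by rewrite /g3 addr0; ring.
rewrite subr0 => ->; rewrite normrM ler_wpM2r//.
have := q_taylor S (S + c); have -> : S + c - S = c by ring.
move=> /le_trans; apply; apply: ler_pM.
- by rewrite mulr_ge0// !addr_ge0// ltW.
- exact: sqr_ge0.
- by rewrite ler_wpM2l// lerD2l.
- by rewrite -(real_normK (num_real c)) -(real_normK (num_real w)) lerXn2r// nnegrE.
Qed.

(** Every term is affine in the flux, so the error is the same expression in [q]: a difference of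
    [q1] and Taylor remainders of order at least two. The mixed power [um |w|^3] is split between
    [um^2 w^2] and [w^4]; hence the shape of the bound, in the scale-free variable [w / um]. *)
Lemma bracket_near S w : - (3 * um) <= S <= um ->
  exists2 b, `|b| <= 100 * e * ((w / um) ^+ 2 + (w / um) ^+ 4) &
  bracket S w = (3 * um ^+ 2 - 15 * um * S) * w ^+ 2 - (5 * um + S) * w ^+ 3
     - 3/4 * w ^+ 4 + um ^+ 4 * b.
Proof.
move=> /andP[S1 S2].
pose r2 := q (S + w) - q S - q1 S * w.
pose t := (q1 um - q1 S) * w ^+ 2 + g3 S w - (5 * um - S + w) * r2.
have um1 : um != 0 by rewrite gt_eqF.
exists (t / um ^+ 4); last first.
  rewrite [X in _ + X]mulrC divfK ?expf_neq0// /t /g3 /r2 /q /q1 /bracket; by field.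
have S3 : `|S| <= 3 * um by rewrite ler_norml S1 (le_trans S2)//; lra.
have t1 : `|q1 um - q1 S| <= 32 * e * um ^+ 2.
  rewrite distrC; apply: le_trans (q1_lip _ _) _.
  have h : `|S - um| <= 4 * um by rewrite ler0_norm ?subr_le0//; lra.
  rewrite (ger0_norm (ltW um0)).
  have -> : 32 * e * um ^+ 2 = (e * (8 * um)) * (4 * um) by ring.
  apply: ler_pM => //; first by rewrite mulr_ge0// !addr_ge0// ltW.
  by rewrite ler_wpM2l//; lra.
have w0 := normr_ge0 w.
have t2 : `|r2| <= e * (4 * um + `|w|) * `|w| ^+ 2.
  have := q_taylor S (S + w); have -> : S + w - S = w by ring.
  move=> /le_trans; apply; rewrite real_normK ?num_real//.
  by rewrite ler_wpM2r ?sqr_ge0// ler_wpM2l//; lra.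
have t3 : `|g3 S w| <= e * (4 * um + `|w|) * `|w| ^+ 2 * `|w|.
  apply: le_trans (g3_bound _ _) _; rewrite ler_wpM2r// real_normK ?num_real//.
  by rewrite ler_wpM2r ?sqr_ge0// ler_wpM2l//; lra.
have t4 : `|5 * um - S + w| <= 8 * um + `|w|.
  apply: le_trans (ler_normD _ _) _; rewrite lerD2r ger0_norm; lra.
have t5 : `|t| <= 100 * e * (um ^+ 2 * `|w| ^+ 2 + `|w| ^+ 4).
  have : `|t| <= 32 * e * um ^+ 2 * `|w| ^+ 2 + e * (4 * um + `|w|) * `|w| ^+ 2 * `|w| +
     (8 * um + `|w|) * (e * (4 * um + `|w|) * `|w| ^+ 2).
    apply: le_trans (ler_normB _ _) _; apply: lerD; last exact: normM_le.
    apply: le_trans (ler_normD _ _) _; apply: lerD => //.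
    by apply: normM_le; rewrite // normrX.
  move=> /le_trans; apply.
  have := mulr_ge0 e0 (mulr_ge0 (exprn_ge0 2 w0) (sqr_ge0 (um - `|w|))).
  have := mulr_ge0 e0 (exprn_ge0 4 w0).
  have := mulr_ge0 e0 (mulr_ge0 (exprn_ge0 2 w0) (sqr_ge0 um)).
  move: `|w| => x; lra.
rewrite normrM normfV (ger0_norm (exprn_ge0 4 (ltW um0))) ler_pdivrMr ?exprn_gt0//.
apply: le_trans t5 _.
have -> : `|w| ^+ 4 = w ^+ 4 by rewrite !(exprM _ 2 2) real_normK ?num_real.
rewrite real_normK ?num_real// le_eqVlt; apply/orP; left; apply/eqP; by field.
Qed.
End bracket.
End flux.

(** * The calibration and its pointwise inequality *)

Section calibration.
Context {R : realType}.
Implicit Types um S w m z : R.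

(* wx stands for w_x, F for S_x, F1 for dF/dS, and T1 for dT/dS; the left-hand
   side is the derivative of R plus the gain F um^2 m^2 / 80. *)
Definition cal_ineq (um F F1 S w wx m brk h h1 ph ph1 T1 : R) : Prop :=
  let a := 5 * um - S in let d := w - ph * m in let P := a * F1 - F in
  let dx := wx - ph1 * F * m in
  F * ((P * h + a * F * h1) * d ^+ 2 + 2 * P * ph1 * m * d + T1 * m ^+ 2)
    + 2 * a * F * h * d * dx + 2 * a * F * ph1 * m * dx + F * um ^+ 2 * m ^+ 2 / 80
  <= a * wx ^+ 2 - F * brk + 8 * um * m * F * (w ^+ 2 / 2 + a * w).

Lemma norm_mulr_ge0 (x c : R) : 0 <= c -> `|x| * c = `|x * c|.
Proof. by move=> c0; rewrite normrM [`|c|]ger0_norm. Qed.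

(** The difference of the two sides is [F] times the hypothesis plus the square
    [a (wx - F (h d + ph1 m))^2]. Expanding that square makes the products [h ph1 m d] cancel and
    leaves [h1 + h^2] on [d^2] and [ph1^2] on [m^2]. *)
Lemma cal_ineqP (um F F1 S w wx m brk h h1 ph ph1 T1 : R) :
  let a := 5 * um - S in let d := w - ph * m in let P := a * F1 - F in
  0 <= a -> 0 <= F ->
  um ^+ 2 * m ^+ 2 / 80 <= - (P * h + a * F * (h1 + h ^+ 2)) * d ^+ 2 - 2 * P * ph1 * m * d
    + a * F * ph1 ^+ 2 * m ^+ 2 - T1 * m ^+ 2 - brk + 8 * um * m * (w ^+ 2 / 2 + a * w) ->
  cal_ineq um F F1 S w wx m brk h h1 ph ph1 T1.
Proof.
move=> a d P a0 F0 h0; rewrite /cal_ineq -/a -/d -/P.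
have h2 := ler_wpM2l F0 h0.
have h3 := mulr_ge0 a0 (sqr_ge0 (wx - F * (h * d + ph1 * m))).
clearbody a d P; clear h0; lra.
Qed.

(* The suffix r stands for the right of x0, in the variable z = 1 - S/um, and l for its
   left, in v = S/um + 2; hl is the logarithmic derivative of psl. *)
Definition hr um S : R := (8^-1 * (1 - S / um)^-1 + (101/50 - (1 - S / um))^-1) / um.
Definition hr1 um S : R := (8^-1 * (1 - S / um)^-2 - (101/50 - (1 - S / um))^-2) / um ^+ 2.
Definition phr um S : R := 7/2 - 5/4 * (1 - S / um).
Definition ptr z : R := z + 111/2 * z ^+ 2 - 44 * z ^+ 3 + 163/20 * z ^+ 4.
Definition Tr um S : R := um ^+ 3 * ptr (1 - S / um).

Definition psl v : R := 1 - 7/10 * v - v ^+ 2 / 4.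
Definition psl1 v : R := - (7/10) - v / 2.
Definition hl um S : R := psl1 (S / um + 2) * (psl (S / um + 2))^-1 / um.
Definition hl1 um S : R := (- 2^-1 * (psl (S / um + 2))^-1
   - psl1 (S / um + 2) ^+ 2 * (psl (S / um + 2))^-2) / um ^+ 2.
Definition phl um S : R := 4/3 - (S / um + 2) / 3.
Definition ptl v : R := - 7 * v + 27/2 * v ^+ 2 - 10/3 * v ^+ 3.
Definition Tl um S : R := um ^+ 3 * ptl (S / um + 2).

(** [hr] is the logarithmic derivative in [S] of [z^(-1/8) (101/50 - z)], with [z = 1 - S/um]. Its
    second factor keeps [hr] finite up to [z = 2], that is [S = - um], because [101/50 > 2]. *)
Lemma hr_der um S : um != 0 -> 1 - S / um != 0 -> 101/50 - (1 - S / um) != 0 ->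
  is_derive S 1 (hr um) (hr1 um S).
Proof.
move=> u0 z0 x0; rewrite /hr /hr1; derive_by => //.
rewrite /=; move: z0 x0; set z := 1 - _ => z0; move: (101/50 - z) => c c0; by field; rewrite c0 z0 u0.
Qed.

Lemma phr_der um S : um != 0 -> is_derive S 1 (phr um) (5 / (4 * um)).
Proof. by move=> u0; rewrite /phr; derive_by; rewrite /=; field. Qed.

Lemma Tr_der um S : um != 0 -> is_derive S 1 (Tr um) (um ^+ 2 * tr (1 - S / um)).
Proof. by move=> u0; rewrite /Tr /ptr; derive_by; rewrite /tr /=; field. Qed.

Lemma hl_der um S : um != 0 -> psl (S / um + 2) != 0 ->
  is_derive S 1 (hl um) (hl1 um S).
Proof.
move=> u0 p0; rewrite /hl /hl1.
have dp : is_derive S 1 (fun y => psl (y / um + 2)) (psl1 (S / um + 2) / um).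
  by rewrite /psl /psl1; derive_by; rewrite /=; field.
have dp1 : is_derive S 1 (fun y => psl1 (y / um + 2)) (- 2^-1 / um).
  by rewrite /psl1; derive_by; rewrite /=; field.
have := derM (derM dp1 (@derV _ (fun y => psl (y / um + 2)) S _ p0 dp)) (derC (um^-1) S).
move=> /derE; apply; move: p0; set p := psl _ => p0; set q := psl1 _; by field; rewrite p0 u0.
Qed.

Lemma phl_der um S : um != 0 -> is_derive S 1 (phl um) (- 1 / (3 * um)).
Proof. by move=> u0; rewrite /phl; derive_by; rewrite /=; field. Qed.

Lemma Tl_der um S : um != 0 -> is_derive S 1 (Tl um) (um ^+ 2 * tl (S / um + 2)).
Proof. by move=> u0; rewrite /Tl /ptl; derive_by; rewrite /tl /=; field. Qed.

Section steps.
Context (um k S w wx m F F1 brk b : R).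
Hypotheses (um0 : 0 < um) (k0 : 0 <= k) (k1 : 500 * (500 * k) <= 1).
Hypotheses (F0 : 0 <= F)
 (hF : `|F - (S - um) ^+ 2 * (S + 2 * um)| <= k / 16 * um * (S - um) ^+ 2)
 (hF1 : `|F1 - (3 * S ^+ 2 - 3 * um ^+ 2)| <= k / 16 * um * `|S - um|)
 (hb : `|b| <= k * ((w / um) ^+ 2 + (w / um) ^+ 4))
 (hbrk : brk = (3 * um ^+ 2 - 15 * um * S) * w ^+ 2 - (5 * um + S) * w ^+ 3
     - 3/4 * w ^+ 4 + um ^+ 4 * b).

(** Homogeneity: with [S = um (1 - z)] and [w], [m] measured in units of [um], both sides carry the
    factor [um^4], and the statement reduces to [right_pointwise]. *)
Lemma right_cal : - um <= S -> S < um ->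
  cal_ineq um F F1 S w wx m brk (hr um S) (hr1 um S) (phr um S) (5 / (4 * um))
     (um ^+ 2 * tr (1 - S / um)).
Proof.
move=> S1 S2; have u0 : um != 0 by rewrite gt_eqF.
pose z := 1 - S / um.
have ES : S = um * (1 - z) by rewrite /z; by field.
have z0 : 0 < z by rewrite /z subr_gt0 ltr_pdivrMr// mul1r.
have z2 : z <= 2.
  have h : um * z = um - S by rewrite /z; by field.
  by rewrite -(ler_pM2l um0) h; move: S1; lra.
have Ez : 1 - S / um = z by [].
clearbody z.
have zn : z != 0 by rewrite gt_eqF.
pose d0 := F / (um ^+ 3 * z ^+ 2) - (3 - z); pose d1 := F1 / (um ^+ 2 * z) - (3 * z - 6).
have EF : F = um ^+ 3 * z ^+ 2 * (3 - z + d0) by rewrite /d0; by field; rewrite zn u0.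
have EF1 : F1 = um ^+ 2 * z * (3 * z - 6 + d1) by rewrite /d1; by field; rewrite zn u0.
have p0 : 0 < um ^+ 3 * z ^+ 2 by rewrite mulr_gt0 ?exprn_gt0.
have p1 : 0 < um ^+ 2 * z by rewrite mulr_gt0 ?exprn_gt0.
have hd0 : `|d0| <= k.
  rewrite -(ler_pM2r p0) (norm_mulr_ge0 _ (ltW p0)).
  have -> : d0 * (um ^+ 3 * z ^+ 2) = F - (S - um) ^+ 2 * (S + 2 * um).
    by rewrite EF ES; ring.
  apply: le_trans hF _; rewrite ES.
  have -> : k / 16 * um * (um * (1 - z) - um) ^+ 2 = k / 16 * (um ^+ 3 * z ^+ 2) by ring.
  by rewrite ler_pM2r//; move: k0; lra.
have hd1 : `|d1| <= k.
  rewrite -(ler_pM2r p1) (norm_mulr_ge0 _ (ltW p1)).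
  have -> : d1 * (um ^+ 2 * z) = F1 - (3 * S ^+ 2 - 3 * um ^+ 2).
    by rewrite EF1 ES; ring.
  apply: le_trans hF1 _; rewrite ES.
  have -> : um * (1 - z) - um = - (um * z) by ring.
  rewrite normrN ger0_norm ?mulr_ge0 ?(ltW um0) ?(ltW z0)//.
  have -> : k / 16 * um * (um * z) = k / 16 * (um ^+ 2 * z) by ring.
  by rewrite ler_pM2r//; move: k0; lra.
have := right_pointwise (m := m / um) k0 k1 (ltW z0) z2 hd0 hd1 hb erefl erefl erefl erefl erefl erefl.
rewrite -(ler_pM2l (exprn_gt0 4 um0)) => H.
apply: cal_ineqP => //; first by move: S2 um0; lra.
have c0 : 101/50 - z != 0 by apply/eqP; move: z2; lra.
have Ea : 5 * um - S = um * (4 + z) by rewrite ES; ring.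
move: H; rewrite hbrk /hr /hr1 /phr Ez Ea EF EF1 ES.
clearbody d0 d1; move: (101/50 - z) c0 (tr z) => c c0 t.
set X := (X in X <= _ -> _); set Y := (Y in _ <= Y -> _).
set X' := (X in _ -> X <= _); set Y' := (Y in _ -> _ <= Y).
have -> : X = X' by rewrite /X /X'; by field.
have -> // : Y = Y'.
by rewrite /Y /Y'; field; rewrite c0 zn u0.
Qed.

Lemma left_cal : - (2 + 1/100) * um <= S -> S <= - um ->
  cal_ineq um F F1 S w wx m brk (hl um S) (hl1 um S) (phl um S) (- 1 / (3 * um))
     (um ^+ 2 * tl (S / um + 2)).
Proof.
move=> S1 S2; have u0 : um != 0 by rewrite gt_eqF.
pose v := S / um + 2.
have ES : S = um * (v - 2) by rewrite /v; by field.
have Ev : S / um + 2 = v by [].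
clearbody v.
have v0 : - (1/100) <= v by rewrite -(ler_pM2l um0); move: S1; rewrite ES; lra.
have v1 : v <= 1 by rewrite -(ler_pM2l um0); move: S2; rewrite ES; lra.
pose d0 := F / um ^+ 3 - v * (3 - v) ^+ 2.
pose d1 := F1 / um ^+ 2 - ((3 - v) ^+ 2 - 2 * v * (3 - v)).
have EF : F = um ^+ 3 * (v * (3 - v) ^+ 2 + d0) by rewrite /d0; by field; rewrite u0.
have EF1 : F1 = um ^+ 2 * ((3 - v) ^+ 2 - 2 * v * (3 - v) + d1) by rewrite /d1; by field; rewrite u0.
have p0 : 0 < um ^+ 3 by rewrite exprn_gt0.
have p1 : 0 < um ^+ 2 by rewrite exprn_gt0.
have hd0 : `|d0| <= k.
  rewrite -(ler_pM2r p0) (norm_mulr_ge0 _ (ltW p0)).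
  have -> : d0 * um ^+ 3 = F - (S - um) ^+ 2 * (S + 2 * um).
    by rewrite EF ES; ring.
  apply: le_trans hF _; rewrite ES.
  have -> : k / 16 * um * (um * (v - 2) - um) ^+ 2 = k * (3 - v) ^+ 2 / 16 * um ^+ 3 by field.
  (* The factor 16 in the hypotheses on [F] and [F1] is spent here: [(3 - v)^2 <= 16], where on the
     right half-line the factors of [z] cancelled. *)
  rewrite ler_pM2r// ler_pdivrMr// ler_wpM2l//; move: v0 v1; nra.
have hd1 : `|d1| <= k.
  rewrite -(ler_pM2r p1) (norm_mulr_ge0 _ (ltW p1)).
  have -> : d1 * um ^+ 2 = F1 - (3 * S ^+ 2 - 3 * um ^+ 2).
    by rewrite EF1 ES; ring.
  apply: le_trans hF1 _; rewrite ES.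
  have -> : um * (v - 2) - um = - (um * (3 - v)) by ring.
  rewrite normrN ger0_norm ?mulr_ge0 ?(ltW um0)//; last by move: v1; lra.
  have -> : k / 16 * um * (um * (3 - v)) = k * (3 - v) / 16 * um ^+ 2 by field.
  rewrite ler_pM2r// ler_pdivrMr// ler_wpM2l//; move: v0 v1; nra.
have := left_pointwise (m := m / um) k0 k1 v0 v1 hd0 hd1 hb erefl erefl erefl erefl erefl erefl.
rewrite -(ler_pM2l (exprn_gt0 4 um0)) => H.
apply: cal_ineqP => //; first by move: S2 um0; lra.
have c0 : psl v != 0 by apply/eqP; rewrite /psl; move: v0 v1; nra.
have Ea : 5 * um - S = um * (7 - v) by rewrite ES; ring.
move: H; rewrite hbrk /hl /hl1 /phl Ev Ea EF EF1 ES /psl1 -/(psl v).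
clearbody d0 d1; move: (psl v) c0 (tl v) => c c0 t.
set X := (X in X <= _ -> _); set Y := (Y in _ <= Y -> _).
set X' := (X in _ -> X <= _); set Y' := (Y in _ -> _ <= Y).
have -> : X = X' by rewrite /X /X'; by field.
have -> // : Y = Y'.
by rewrite /Y /Y'; field; rewrite c0 u0.
Qed.
End steps.
End calibration.

(** * Integrals over segments and integration by parts *)

Section integral_toolkit.
Context {R : realType}.
Local Notation mu := (@lebesgue_measure R).
Implicit Types (f g : R -> R) (a b c x y : R).

Definition int a b f : R := \int[mu]_(x in `[a, b]) f x.
Definition intg a b f := mu.-integrable `[a, b] (EFin \o f).

Lemma intg_cont a b f : continuous f -> intg a b f.
Proof.
move=> cf; apply: continuous_compact_integrable; first exact: segment_compact.
exact: continuous_subspaceT.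
Qed.

Lemma intgS a b c d f : c <= a -> b <= d -> intg c d f -> intg a b f.
Proof.
move=> ca bd; apply: integrableS => //.
by apply: subset_itv; rewrite bnd_simp.
Qed.

Lemma intgN a b f : intg a b f -> intg a b (fun x => `|f x|).
Proof. exact: integrable_norm. Qed.

Lemma intgD a b f g : intg a b f -> intg a b g -> intg a b (fun x => f x + g x).
Proof. by move=> h1 h2; apply: (integrableD _ h1 h2). Qed.

Lemma intgZ a b k f : intg a b f -> intg a b (fun x => k * f x).
Proof. by move=> h1; apply: (integrableZl _ k h1). Qed.

Lemma intgB a b f g : intg a b f -> intg a b g -> intg a b (fun x => f x - g x).
Proof. by move=> h1 h2; apply: (integrableB _ h1 h2). Qed.

Lemma int_split a b c f : intg a c f -> a <= b -> b <= c ->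
  int a c f = int a b f + int b c f.
Proof.
move=> h ab bc; apply/eqP; rewrite addrC -subr_eq; apply/eqP.
rewrite /int Rintegral_itvB ?bnd_simp// Rintegral_itv_obnd_cbnd//.
by apply: integrableS h => //; apply: subset_itv; rewrite bnd_simp.
Qed.

Lemma int_set1 a f : int a a f = 0.
Proof. by rewrite /int set_itv1 Rintegral_set1. Qed.

Lemma int_ge0 a b f : (forall x, a <= x <= b -> 0 <= f x) -> 0 <= int a b f.
Proof. by move=> h; apply: Rintegral_ge0 => x /=; rewrite in_itv/= => /h. Qed.

Lemma le_int a b f g : intg a b f -> intg a b g ->
  (forall x, a <= x <= b -> f x <= g x) -> int a b f <= int a b g.
Proof. by move=> hf hg h; apply: le_Rintegral => // x /=; rewrite in_itv/= => /h. Qed.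

Lemma le_norm_int a b f : intg a b f -> `|int a b f| <= int a b (fun x => `|f x|).
Proof. by move=> h; exact: le_normr_Rintegral. Qed.

Lemma int_cst a b k : a <= b -> int a b (fun=> k) = k * (b - a).
Proof.
move=> ab; rewrite /int Rintegral_cst//.
have h : mu `[a, b]%classic = (b - a)%:E.
  rewrite lebesgue_measure_itv/= lte_fin; have [//|ba] := ltP a b.
  have -> : b = a by apply/eqP; rewrite eq_le ab ba.
  by rewrite subrr.
exact: (congr1 (fun z => k * fine z) h).
Qed.

Lemma intD a b f g : intg a b f -> intg a b g ->
  int a b (fun x => f x + g x) = int a b f + int a b g.
Proof. by move=> hf hg; rewrite /int RintegralD. Qed.

Lemma intB a b f g : intg a b f -> intg a b g ->
  int a b (fun x => f x - g x) = int a b f - int a b g.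
Proof. by move=> hf hg; rewrite /int RintegralB. Qed.

Lemma intZ a b k f : intg a b f -> int a b (fun x => k * f x) = k * int a b f.
Proof. by move=> hf; rewrite /int RintegralZl. Qed.

Lemma eq_int a b f g : (forall x, a <= x <= b -> f x = g x) -> int a b f = int a b g.
Proof. by move=> h; apply: eq_Rintegral => x; rewrite inE/= in_itv/= => /h. Qed.

Lemma int_abs_small a b f : intg a b f -> forall e, 0 < e -> exists2 d, 0 < d &
  forall x y, a <= x -> x <= y -> y <= b -> y - x < d -> int x y (fun t => `|f t|) < e.
Proof.
move=> hf e e0; pose fab := f \_ `[a, b].
have ifab : mu.-integrable setT (EFin \o fab).
  by rewrite -restrict_EFin; apply/integrable_restrict => //=; rewrite setTI.
have [d [d0 h]] := integral_normr_continuous ifab e0.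
exists d => // x y ax xy yb yxd.
rewrite (_ : int x y _ = \int[mu]_(t in `[x, y]) `|fab t|).
  apply: h => //.
  have hm : (mu `[x, y]%classic < d%:E)%E.
    by rewrite lebesgue_measure_itv/= lte_fin; case: ifP => _; rewrite -?EFinB ?lte_fin.
  exact: hm.
apply: eq_int => t /andP[xt ty]; rewrite /fab patchE mem_set//=.
by rewrite in_itv/= (le_trans ax xt) (le_trans ty yb).
Qed.

Lemma primitive_exists f : continuous f ->
  exists2 P : R -> R, (forall x, is_derive x 1 P (f x)) &
    forall a b, a <= b -> int a b f = P b - P a.
Proof.
move=> cf; pose P x := if 0 <= x then int 0 x f else - int x 0 f.
have PE N y : N <= 0 -> N <= y -> P y = int N y f - int N 0 f.
  move=> N0 Ny; rewrite /P; case: (leP 0 y) => y0.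
    have -> := int_split (intg_cont N y cf) N0 y0; ring.
  have -> := int_split (intg_cont N 0 cf) Ny (ltW y0); ring.
exists P => [x|a b ab]; last first.
  pose N := Num.min 0 a.
  have N0 : N <= 0 by rewrite /N ge_min lexx.
  have Na : N <= a by rewrite /N ge_min lexx orbT.
  rewrite (PE N b N0 (le_trans Na ab)) (PE N a N0 Na).
  have -> := int_split (intg_cont N b cf) Na ab; ring.
(* A base point to the left of both 0 and [x] makes [x] interior, so that one formula for [P] is
   valid on a neighbourhood of [x] even when [x = 0]. *)
pose N := Num.min 0 x - 1.
have m0 : Num.min 0 x <= 0 by rewrite ge_min lexx.
have mx : Num.min 0 x <= x by rewrite ge_min lexx orbT.
have N0 : N < 0 by rewrite /N; lra.
have Nx : N < x by rewrite /N; lra.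
have [d1 d2] := @continuous_FTC1_closed R f N x (x + 1) ltac:(lra) (intg_cont _ _ cf) Nx (cf x).
have D : is_derive x 1 (fun y => int N y f - int N 0 f) (f x).
  by derive_by; [exact: derivable_der d1|rewrite d2 addr0].
apply: near_eq_is_derive D.
near=> y; rewrite (PE N y) ?(ltW N0)//.
apply: ltW; near: y; exact: lt_nbhsr.
Unshelve. all: by end_near. Qed.

Lemma ftc_int F f a b : continuous f -> (forall x, is_derive x 1 F (f x)) -> a <= b ->
  int a b f = F b - F a.
Proof.
move=> cf dF ab; have [P dP ->//] := primitive_exists cf.
have := @der0_cst R (fun x => P x - F x) a b.
have h x : is_derive x 1 (fun x => P x - F x) 0 by derive_by; rewrite subrr.
by move=> /(_ h) ?; lra.
Qed.

(** Telescoping over a mesh finer than [d]. Only increments over short intervals enter, so the lemma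
    applies to functions that are not known to be differentiable anywhere. *)
Lemma der_bound_cst f a b : a <= b ->
  (forall e, 0 < e -> exists2 d, 0 < d & forall x y, a <= x -> x <= y -> y <= b -> y - x < d ->
     `|f y - f x| <= e * (y - x)) -> f a = f b.
Proof.
move=> ab h; apply/eqP; rewrite -subr_eq0 -normr_le0; apply/ler_addgt0Pr => e e0; rewrite add0r.
have e1 : 0 < e / (b - a + 1) by rewrite divr_gt0//; lra.
have [d d0 hd] := h _ e1.
pose n := `|Num.ceil ((b - a) / d)|%N.+1.
pose s (k : nat) := a + (b - a) * (k%:R / n%:R).
have n0 : 0 < n%:R :> R by rewrite ltr0n.
have step : (b - a) / n%:R < d.
  rewrite ltr_pdivrMr// mulrC -ltr_pdivrMr// (le_lt_trans (Num.Theory.ceil_ge _))//.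
  rewrite /n -natr1; apply: (@le_lt_trans _ _ (`|Num.ceil ((b - a) / d)|%N%:R)); last by rewrite ltrDl.
  by rewrite natr_absz ler_int ler_norm.
have H (k : nat) : (k <= n)%N -> `|f (s k) - f a| <= e / (b - a + 1) * (s k - a).
  elim: k => [_|k ih kn]; first by rewrite /s mul0r mulr0 addr0 !subrr normr0 mulr0.
  have kn' : k%:R / n%:R <= 1 :> R by rewrite ler_pdivrMr// mul1r ler_nat ltnW.
  have sk : s k.+1 - s k = (b - a) / n%:R by rewrite /s -natr1; ring.
  have k0 : 0 <= k%:R / n%:R :> R by rewrite divr_ge0.
  have k1 : k.+1%:R / n%:R <= 1 :> R by rewrite ler_pdivrMr// mul1r ler_nat.
  have := hd (s k) (s k.+1).
  have a1 : a <= s k by rewrite /s lerDl mulr_ge0// subr_ge0.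
  have a2 : s k <= s k.+1 by rewrite -subr_ge0 sk divr_ge0 ?subr_ge0// ltW.
  have a3 : s k.+1 <= b.
    by rewrite /s -lerBrDl ler_piMr// subr_ge0.
  rewrite sk => /(_ a1 a2 a3 step) h1; rewrite -sk in h1.
  have := ih (ltnW kn) => h2.
  have -> : f (s k.+1) - f a = (f (s k.+1) - f (s k)) + (f (s k) - f a) by ring.
  apply: le_trans (ler_normD _ _) _; apply: le_trans (lerD h1 h2) _.
  by rewrite -mulrDr; have -> : s k.+1 - s k + (s k - a) = s k.+1 - a by ring.
have := H n (leqnn n); have -> : s n = b by rewrite /s divff ?gt_eqF// mulr1; ring.
rewrite distrC => /le_trans; apply.
by rewrite mulrAC ler_pdivrMr; [rewrite ler_pM2l//; lra|lra].
Qed.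
End integral_toolkit.

Section ac.
Context {R : realType}.
Local Notation mu := (@lebesgue_measure R).
Implicit Types (f g h : R -> R) (a b c x y : R).

Lemma cont_bounded a b f : continuous f ->
  exists2 L, 0 <= L & forall x, a <= x <= b -> `|f x| <= L.
Proof.
move=> cf; have [ab|ba] := leP a b; last first.
  by exists 0 => // x /andP[ax xb]; move: (le_lt_trans (le_trans ax xb) ba); rewrite ltxx.
have cn : {within `[a, b], continuous (fun x => `|f x|)}.
  by apply: continuous_subspaceT => x; apply: continuous_comp; [exact: cf|exact: norm_continuous].
have [c _ hc] := EVT_max ab cn.
by exists `|f c| => // x xab; apply: hc; rewrite in_itv.
Qed.

Lemma intgM_cont a b g h : continuous g -> intg a b h -> intg a b (fun x => g x * h x).
Proof.
move=> cg ih; have [L L0 hL] := cont_bounded a b cg.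
have mg : measurable_fun `[a, b] g.
  by apply: subspace_continuous_measurable_fun => //; exact: continuous_subspaceT.
have bg : [bounded g x | x in `[a, b]%classic].
  exists L; split; first exact: num_real.
  by move=> M LM x /=; rewrite in_itv/= => /hL /le_trans; apply; exact: ltW.
have mD : measurable (`[a, b]%classic : set R) by exact: measurable_itv.
have H := @integrableMr _ _ _ mu _ mD g (EFin \o h) mg bg ih.
by rewrite /intg (_ : _ \o _ = ((EFin \o g) \* (EFin \o h))%E).
Qed.

(** Integration by parts against a primitive [P] of a merely integrable [h]. Instead of
    differentiating [P] almost everywhere, the defect of the formula on [[a, x]] is shown to have
    increments [o(y - x)] uniformly, and [der_bound_cst] applies. *)
Lemma ac_parts a b h P g g1 : a <= b -> intg a b h -> continuous P ->
  (forall x, a <= x -> x <= b -> P x = P a + int a x h) ->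
  (forall x, is_derive x 1 g (g1 x)) -> continuous g1 ->
  int a b (fun x => g x * h x) = g b * P b - g a * P a - int a b (fun x => g1 x * P x).
Proof.
move=> ab ih cP hP dg cg1.
have cg : continuous g by move=> x; exact: der_cont (dg x).
have cgP : continuous (fun x => g1 x * P x) by move=> x; exact: cvgM (cg1 x) (cP x).
have [Q dQ hQ] := primitive_exists cgP.
have [L L0 hL] := cont_bounded a b cg1.
have igh := intgM_cont cg ih.
pose D x := g x * P x - int a x (fun x => g x * h x) - Q x.
suff : D a = D b by rewrite /D int_set1 (hQ _ _ ab); lra.
apply: der_bound_cst => // e e0.
have e1 : 0 < e / (2 * L + 1) by rewrite divr_gt0//; lra.
have [d d0 hd] := int_abs_small ih e1.
exists d => // x y ax xy yb yxd; have {}hd := hd x y ax xy yb yxd.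
have ayb : a <= y by exact: le_trans ax xy.
have xb : x <= b by exact: le_trans xy yb.
have ihay : intg a y h by apply: intgS ih.
have ihxy : intg x y h by apply: intgS ih.
have ighxy : intg x y (fun x => g x * h x) by apply: intgS igh.
have ighay : intg a y (fun x => g x * h x) by apply: intgS igh.
set eps := int x y (fun t => `|h t|) in hd.
have EP : P y - P x = int x y h.
  by rewrite (hP y)// (hP x)// (int_split ihay ax xy); ring.
have PE t : x <= t -> t <= y -> `|P x - P t| <= eps.
  move=> xt ty.
  have iat : intg a t h by apply: intgS ih; rewrite // (le_trans ty).
  have -> : P x - P t = - int x t h.
    by rewrite (hP x)// (hP t) ?(le_trans ax)// ?(le_trans ty)// (int_split iat ax xt); ring.
  have ixt : intg x t h by apply: intgS ihay; rewrite // .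
  rewrite normrN; apply: le_trans (le_norm_int ixt) _.
  rewrite /eps (int_split (intgN ihxy) xt ty) lerDl; apply: int_ge0 => ? _; exact: normr_ge0.
(* Each integrand contains a difference that vanishes at an endpoint: the first integral gains
   [y - x] from the smoothness of [g], the second gains [eps] from the continuity of [P]. *)
have ED : D y - D x = int x y (fun t => (g y - g t) * h t) + int x y (fun t => g1 t * (P x - P t)).
  have i1 : intg x y (fun t => g y * h t) by exact: intgZ.
  have i2 : intg x y (fun t => g1 t * P x) by apply: intg_cont => t; apply: cvgM; [exact: cg1|exact: cvg_cst].
  have i3 : intg x y (fun t => g1 t * P t) by exact: intg_cont.
  have -> : int x y (fun t => (g y - g t) * h t) = g y * int x y h - int x y (fun t => g t * h t).
    by rewrite -(intZ _ ihxy) -intB//; apply: eq_int => t _; ring.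
  have -> : int x y (fun t => g1 t * (P x - P t)) = (g y - g x) * P x - (Q y - Q x).
    rewrite -(hQ _ _ xy) -(ftc_int cg1 dg xy) mulrC -intZ; last exact: intg_cont.
    rewrite -intB//; last by apply: intgZ; exact: intg_cont.
    by apply: eq_int => t _; ring.
  by rewrite /D -EP (int_split ighay ax xy); ring.
rewrite ED; apply: le_trans (ler_normD _ _) _.
have xy0 : 0 <= y - x by rewrite subr_ge0.
have b1 : `|int x y (fun t => (g y - g t) * h t)| <= L * (y - x) * eps.
  have i1 : intg x y (fun t => (g y - g t) * h t).
    by apply: intgM_cont => // t; apply: cvgB; [exact: cvg_cst|exact: cg].
  apply: le_trans (le_norm_int i1) _; rewrite /eps -intZ; last exact: intgN.
  apply: le_int; [exact: intgN|exact/intgZ/intgN|] => t /andP[xt ty].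
  rewrite normrM ler_wpM2r//.
  have [c /andP[tc cy] ->] := mvt_seg ty (fun x _ => dg x).
  rewrite normrM ler_pM//; last by rewrite ger0_norm ?subr_ge0// lerD2l lerN2.
  by apply: hL; rewrite (le_trans ax (le_trans xt tc)) (le_trans cy yb).
have b2 : `|int x y (fun t => g1 t * (P x - P t))| <= L * eps * (y - x).
  have c2 : continuous (fun t => g1 t * (P x - P t)).
    by move=> t; apply: cvgM; [exact: cg1|apply: cvgB; [exact: cvg_cst|exact: cP]].
  apply: le_trans (le_norm_int (intg_cont _ _ c2)) _; rewrite -(int_cst _ xy).
  apply: le_int; [exact/intgN/intg_cont|by apply: intg_cont => ?; exact: cvg_cst|].
  move=> t /andP[xt ty]; rewrite normrM ler_pM//; last exact: PE.
  by apply: hL; rewrite (le_trans ax xt) (le_trans ty yb).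
have e2 : 2 * L * eps <= e.
  have eps0 : 0 <= eps by apply: int_ge0.
  apply: le_trans (_ : 2 * L * (e / (2 * L + 1)) <= _).
    by rewrite ler_wpM2l ?mulr_ge0// ltW.
  by rewrite mulrA ler_pdivrMr; [nra|lra].
apply: le_trans (lerD b1 b2) _.
have := ler_wpM2r xy0 e2; lra.
Qed.
End ac.

(** * The calibrated inequality on a segment *)

Section interval_inequality.
Context {R : realType}.
Context (um e k : R) (f f1 f2 Fp S U U1 ut : R -> R).
Hypotheses (um0 : 0 < um) (e0 : 0 <= e) (ek : 100 * e <= k) (k1 : 500 * (500 * k) <= 1).
Hypotheses (df : forall x : R, is_derive x 1 f (f1 x))
  (df1 : forall x : R, is_derive x 1 f1 (f2 x))
  (hq : forall y : R, `|f2 y - 6 * y| <= e * (um + `|y|))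
  (dFp : forall x : R, is_derive x 1 Fp (f x)).
Let F x := excess um f f1 (S x).
Let F1 x := f1 (S x) - f1 um.
Hypotheses (dS : forall x : R, is_derive x 1 S (F x))
  (F0 : forall x, 0 < F x)
  (S_gt : forall x, - (2 + 1/100) * um <= S x) (S_lt : forall x, S x < um).
Hypotheses (dU : forall x : R, is_derive x 1 U (U1 x)) (cU1 : continuous U1)
  (iut : forall a b, intg a b ut)
  (hut : forall a b, a <= b -> (U1 b - f (U b)) - (U1 a - f (U a)) = int a b ut).
Context (x0 : R) (Sx0 : S x0 = - um).

Let w x := U x - S x.
Let w1 x := U1 x - F x.
Let a x := 5 * um - S x.
Let Dl x := f (U x) - f (S x).
Let G x := Fp (U x) - Fp (S x) - f (S x) * w x.
Let K x := w x ^+ 2 / 2 + a x * w x.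
Let m := w x0.
Let bd x := a x * w x * (w1 x - Dl x) + F x * w x ^+ 2 / 2 + a x * G x.
Let Rc (h ph : R -> R) (ph1 : R) (T : R -> R) x :=
  a x * F x * h (S x) * (w x - ph (S x) * m) ^+ 2
  + 2 * a x * F x * ph1 * m * (w x - ph (S x) * m) + T (S x) * m ^+ 2.

Let k0 : 0 <= k. Proof. by move: e0 ek; lra. Qed.

Let dF (x : R) : is_derive x 1 F (F1 x * F x).
Proof. by rewrite /F; exact: (derComp (dS x) (excess_der um df (S x))). Qed.

Let dw (x : R) : is_derive x 1 w (w1 x).
Proof. by rewrite /w; derive_by. Qed.

Let cF : continuous F. Proof. by move=> x; exact: der_cont (dF x). Qed.
Let cw : continuous w. Proof. by move=> x; exact: der_cont (dw x). Qed.
Let cS : continuous S. Proof. by move=> x; exact: der_cont (dS x). Qed.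
Let cU : continuous U. Proof. by move=> x; exact: der_cont (dU x). Qed.
Let cw1 : continuous w1. Proof. by move=> x; apply: cvgB; [exact: cU1|exact: cF]. Qed.
Let cP : continuous (fun x => U1 x - f (U x)).
Proof.
move=> x; apply: cvgB; first exact: cU1.
by apply: (@continuous_comp _ _ _ U f); [exact: cU|exact: der_cont (df (U x))].
Qed.

Let g1 x := a x * w1 x - F x * w x.
Let dg (x : R) : is_derive x 1 (fun x => a x * w x) (g1 x).
Proof. by rewrite /a; derive_by; rewrite /g1 /a; ring. Qed.
Let ca : continuous a. Proof. by move=> x; apply: cvgB; [exact: cvg_cst|exact: cS]. Qed.
Let cg1 : continuous g1.
Proof.
by move=> x; apply: cvgB; apply: cvgM; [exact: ca|exact: cw1|exact: cF|exact: cw].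
Qed.

(** A potential for the exact terms: its derivative exchanges [g1 * (U1 - f U)], left over from
    integrating by parts against [ut], for the dissipation, the bracket and a multiple of
    [F * K]. *)
Let L x := F x * w x ^+ 2 / 2 + a x * G x + a x * w x * (f um + f1 um * (S x - um)).
Let dL (x : R) : is_derive x 1 L
  (- (g1 x * (U1 x - f (U x))) + a x * w1 x ^+ 2
   - F x * bracket um f f1 Fp (S x) (w x) + f1 um * (F x * K x)).
Proof.
have dFpU : is_derive x 1 (fun x => Fp (U x)) (f (U x) * U1 x) by exact: derComp.
have dFpS : is_derive x 1 (fun x => Fp (S x)) (f (S x) * F x) by exact: derComp.
have EU : U x = S x + w x by rewrite /w; ring.
have EU1 : U1 x = w1 x + F x by rewrite /w1; ring.
have EF : f (S x) = F x + f um + f1 um * (S x - um) by rewrite /F /excess; ring.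
rewrite /L /G /a; derive_by.
rewrite /= /bracket -EU /g1 /K /F1 /a /w1 EU1.
rewrite {2 3}/w1 EU1 EF; by field.
Qed.

Let dRc h h1 ph ph1 T T1 (x : R) : is_derive (S x) 1 h h1 -> is_derive (S x) 1 ph ph1 ->
  is_derive (S x) 1 T T1 -> is_derive x 1 (Rc h ph ph1 T)
  (F x * (((a x * F1 x - F x) * h (S x) + a x * F x * h1) * (w x - ph (S x) * m) ^+ 2
     + 2 * (a x * F1 x - F x) * ph1 * m * (w x - ph (S x) * m) + T1 * m ^+ 2)
   + 2 * a x * F x * h (S x) * (w x - ph (S x) * m) * (w1 x - ph1 * F x * m)
   + 2 * a x * F x * ph1 * m * (w1 x - ph1 * F x * m)).
Proof.
move=> dh dph dT.
have dhS : is_derive x 1 (fun x => h (S x)) (h1 * F x) by exact: derComp.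
have dpS : is_derive x 1 (fun x => ph (S x)) (ph1 * F x) by exact: derComp.
have dTS : is_derive x 1 (fun x => T (S x)) (T1 * F x) by exact: derComp.
rewrite /Rc /a; derive_by; rewrite /=; ring.
Qed.

Let half h h1 ph ph1 T T1 A B E1 E2 : A <= B ->
  (forall x : R, is_derive x 1 E1 (g1 x * (U1 x - f (U x)))) ->
  (forall x : R, is_derive x 1 E2 (F x * K x)) ->
  (forall x, A <= x <= B -> [/\ is_derive (S x) 1 h (h1 x), is_derive (S x) 1 ph ph1,
     is_derive (S x) 1 T (T1 x) &
     cal_ineq um (F x) (F1 x) (S x) (w x) (w1 x) m (bracket um f f1 Fp (S x) (w x))
       (h (S x)) (h1 x) (ph (S x)) ph1 (T1 x)]) ->
  - (E1 B - E1 A) <= L B - L A - (Rc h ph ph1 T B - Rc h ph ph1 T A)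
    + (8 * um * m - f1 um) * (E2 B - E2 A).
Proof.
move=> AB dE1 dE2 H.
pose V x := E1 x + L x - Rc h ph ph1 T x + (8 * um * m - f1 um) * E2 x.
suff : V A <= V B by rewrite /V; lra.
pose V1 x := g1 x * (U1 x - f (U x)) + (- (g1 x * (U1 x - f (U x))) + a x * w1 x ^+ 2
   - F x * bracket um f f1 Fp (S x) (w x) + f1 um * (F x * K x)) -
  (F x * (((a x * F1 x - F x) * h (S x) + a x * F x * h1 x) * (w x - ph (S x) * m) ^+ 2
     + 2 * (a x * F1 x - F x) * ph1 * m * (w x - ph (S x) * m) + T1 x * m ^+ 2)
   + 2 * a x * F x * h (S x) * (w x - ph (S x) * m) * (w1 x - ph1 * F x * m)
   + 2 * a x * F x * ph1 * m * (w1 x - ph1 * F x * m))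
  + (8 * um * m - f1 um) * (F x * K x).
apply: (@der_ge0_nondecreasing R V V1 A B AB) => x xAB; have [h_ p_ t_ c_] := H x xAB.
  have dR := dRc h_ p_ t_.
  have dL' := dL x; have dE1' := dE1 x; have dE2' := dE2 x.
  rewrite /V; apply: derE (derD (derB (derD dE1' dL') dR) (derM (derC (8 * um * m - f1 um) x) dE2')) _.
  rewrite /V1 /=; ring.
move: c_; rewrite /cal_ineq -/(a x).
have : 0 <= F x * um ^+ 2 * m ^+ 2 / 80.
  apply: divr_ge0 => //; apply: mulr_ge0 (sqr_ge0 m).
  exact: mulr_ge0 (ltW (F0 x)) (sqr_ge0 um).
rewrite /V1 /K; lra.
Qed.

Let near_k y : - (3 * um) <= y <= um ->
  [/\ `|excess um f f1 y - (y - um) ^+ 2 * (y + 2 * um)| <= k / 16 * um * (y - um) ^+ 2,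
   `|f1 y - f1 um - (3 * y ^+ 2 - 3 * um ^+ 2)| <= k / 16 * um * `|y - um| &
   forall v, exists2 b, `|b| <= k * ((v / um) ^+ 2 + (v / um) ^+ 4) &
     bracket um f f1 Fp y v = (3 * um ^+ 2 - 15 * um * y) * v ^+ 2 - (5 * um + y) * v ^+ 3
     - 3/4 * v ^+ 4 + um ^+ 4 * b].
Proof.
move=> hy; have ek6 : 6 * e <= k / 16 by move: ek e0; lra.
split.
- apply: le_trans (excess_near um0 e0 df df1 hq hy) _.
  by rewrite ler_wpM2r ?sqr_ge0// ler_wpM2r// ltW.
- apply: le_trans (excess1_near um0 e0 df1 hq hy) _.
  by rewrite ler_wpM2r// ler_wpM2r// ltW.
- move=> v; have [b hb ->] := bracket_near um0 e0 df df1 hq dFp v hy.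
  exists b => //; apply: le_trans hb _; rewrite ler_wpM2r//.
  by rewrite addr_ge0// exprn_even_ge0.
Qed.

Let S_mono x y : x <= y -> S x <= S y.
Proof. by move=> xy; apply: der_ge0_nondecreasing xy _ _ => z _ //; exact: ltW. Qed.

Lemma interval_ineq A B : A <= x0 -> x0 <= B ->
  int A B (fun x => a x * w x * ut x) <=
    bd B - bd A - Rc (hr um) (phr um) (5 / (4 * um)) (Tr um) B
    + Rc (hl um) (phl um) (- 1 / (3 * um)) (Tl um) A - (19/6 - 12/5) * um ^+ 3 * m ^+ 2
    + (8 * um * m - f1 um) * int A B (fun x => F x * K x).
Proof.
move=> Ax0 x0B; have AB : A <= B by exact: le_trans x0B.
have un : um != 0 by rewrite gt_eqF.
have cg1P : continuous (fun x => g1 x * (U1 x - f (U x))).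
  by move=> x; apply: cvgM; [exact: cg1|exact: cP].
have cK : continuous (fun x => F x * K x).
  have c2 : continuous (fun x => w x * w x) by move=> x; apply: cvgM; exact: cw.
  move=> x; apply: cvgM; first exact: cF.
  rewrite /K; apply: cvgD; last by apply: cvgM; [exact: ca|exact: cw].
  by apply: cvgM; [exact: c2|exact: cvg_cst].
have [E1 dE1 iE1] := primitive_exists cg1P.
have [E2 dE2 iE2] := primitive_exists cK.
rewrite (ac_parts AB (iut A B) cP _ dg cg1); last first.
  by move=> x Ax _; have := hut Ax; lra.
rewrite (iE1 _ _ AB) (iE2 _ _ AB).
have Hr := @half (hr um) (fun x => hr1 um (S x)) (phr um) (5 / (4 * um)) (Tr um)
  (fun x => um ^+ 2 * tr (1 - S x / um)) x0 B E1 E2 x0B dE1 dE2.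
have Hl := @half (hl um) (fun x => hl1 um (S x)) (phl um) (- 1 / (3 * um)) (Tl um)
  (fun x => um ^+ 2 * tl (S x / um + 2)) A x0 E1 E2 Ax0 dE1 dE2.
have {}Hr := Hr _; have {}Hl := Hl _.
(* Both trial shapes equal 1 at [S = - um], so [d = 0] at [x0] and only [T] survives: [ptr 2 = 12/5]
   here, [ptl 1 = 19/6] on the left. *)
have Er : Rc (hr um) (phr um) (5 / (4 * um)) (Tr um) x0 = 12/5 * um ^+ 3 * m ^+ 2.
  rewrite /Rc Sx0 /phr /Tr /ptr.
  have -> : 1 - - um / um = 2 by field.
  by rewrite -/m; field.
have El : Rc (hl um) (phl um) (- 1 / (3 * um)) (Tl um) x0 = 19/6 * um ^+ 3 * m ^+ 2.
  rewrite /Rc Sx0 /phl /Tl /ptl.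
  have -> : - um / um + 2 = 1 by field.
  by rewrite -/m; field.
rewrite Er in Hr; rewrite El in Hl.
have -> : bd B = a B * w B * (U1 B - f (U B)) + L B.
  by rewrite /bd /L /Dl /w1 /F /excess; ring.
have -> : bd A = a A * w A * (U1 A - f (U A)) + L A.
  by rewrite /bd /L /Dl /w1 /F /excess; ring.
suff : (forall x, x0 <= x <= B -> [/\ is_derive (S x) 1 (hr um) (hr1 um (S x)),
     is_derive (S x) 1 (phr um) (5 / (4 * um)),
     is_derive (S x) 1 (Tr um) (um ^+ 2 * tr (1 - S x / um)) &
     cal_ineq um (F x) (F1 x) (S x) (w x) (w1 x) m (bracket um f f1 Fp (S x) (w x))
       (hr um (S x)) (hr1 um (S x)) (phr um (S x)) (5 / (4 * um)) (um ^+ 2 * tr (1 - S x / um))]) /\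
  (forall x, A <= x <= x0 -> [/\ is_derive (S x) 1 (hl um) (hl1 um (S x)),
     is_derive (S x) 1 (phl um) (- 1 / (3 * um)),
     is_derive (S x) 1 (Tl um) (um ^+ 2 * tl (S x / um + 2)) &
     cal_ineq um (F x) (F1 x) (S x) (w x) (w1 x) m (bracket um f f1 Fp (S x) (w x))
       (hl um (S x)) (hl1 um (S x)) (phl um (S x)) (- 1 / (3 * um)) (um ^+ 2 * tl (S x / um + 2))]).
  by move=> [/Hr + /Hl]; lra.
split=> x /andP[x1 x2].
- have S1 : - um <= S x by rewrite -Sx0 S_mono.
  have S2 := S_lt x.
  have z0 : S x / um < 1 by rewrite ltr_pdivrMr// mul1r.
  have z1 : - 1 <= S x / um by rewrite ler_pdivlMr// mulN1r.
  have hy : - (3 * um) <= S x <= um by rewrite (ltW S2) andbT; move: S1 um0; lra.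
  have [q1 q2 q3] := near_k hy; have [b hb Eb] := q3 (w x).
  split; [apply: hr_der => //; apply/eqP; lra|exact: phr_der|exact: Tr_der|].
  apply: (@right_cal R um k (S x) (w x) (w1 x) m (F x) (F1 x) _ b um0 k0 k1 (ltW (F0 x)) q1 q2 hb Eb) => //.
- have S1 : S x <= - um by rewrite -Sx0 S_mono.
  have S2 := S_gt x.
  have z0 : - (2 + 1/100) <= S x / um by rewrite ler_pdivlMr.
  have z1 : S x / um <= - 1 by rewrite ler_pdivrMr// mulN1r.
  have hy : - (3 * um) <= S x <= um by apply/andP; split; move: S1 S2 um0; lra.
  have [q1 q2 q3] := near_k hy; have [b hb Eb] := q3 (w x).
  split; [apply: hl_der => //; apply/eqP; rewrite /psl; nra|exact: phl_der|exact: Tl_der|].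
  apply: (@left_cal R um k (S x) (w x) (w1 x) m (F x) (F1 x) _ b um0 k0 k1 (ltW (F0 x)) q1 q2 hb Eb) => //.
Qed.
End interval_inequality.

(** * Integrals over the line and square-integrable functions *)

Section whole_line.
Context {R : realType}.
Local Notation mu := (@lebesgue_measure R).
Implicit Types (f g h : R -> R).

Definition itg f := mu.-integrable setT (EFin \o f).
Definition I f : R := \int[mu]_x f x.
Definition L2f f := measurable_fun setT f /\ itg (fun x => f x ^+ 2).

Lemma itg_meas f : itg f -> measurable_fun setT f.
Proof. by move=> /integrableP[/measurable_EFinP]. Qed.

Lemma measE f : measurable_fun setT f -> measurable_fun setT (EFin \o f).
Proof. by move=> ?; apply/measurable_EFinP. Qed.

Lemma itgD f g : itg f -> itg g -> itg (fun x => f x + g x).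
Proof. by move=> h1 h2; apply: (integrableD _ h1 h2). Qed.

Lemma itgB f g : itg f -> itg g -> itg (fun x => f x - g x).
Proof. by move=> h1 h2; apply: (integrableB _ h1 h2). Qed.

Lemma itgZ k f : itg f -> itg (fun x => k * f x).
Proof. by move=> h1; apply: (integrableZl _ k h1). Qed.

Lemma itg_le f g : measurable_fun setT f -> itg g -> (forall x, `|f x| <= g x) -> itg f.
Proof.
move=> mf ig fg; apply: (le_integrable _ _ _ ig) => //; first exact/measurable_EFinP.
by move=> x _; rewrite /= lee_fin (le_trans (fg x))// ler_norm.
Qed.

Lemma ID f g : itg f -> itg g -> I (fun x => f x + g x) = I f + I g.
Proof. by move=> *; rewrite /I RintegralD. Qed.
Lemma IB f g : itg f -> itg g -> I (fun x => f x - g x) = I f - I g.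
Proof. by move=> *; rewrite /I RintegralB. Qed.
Lemma IZ k f : itg f -> I (fun x => k * f x) = k * I f.
Proof. by move=> *; rewrite /I RintegralZl. Qed.
Lemma I_le f g : itg f -> itg g -> (forall x, f x <= g x) -> I f <= I g.
Proof. by move=> *; rewrite /I le_Rintegral. Qed.
Lemma I_ge0 f : (forall x, 0 <= f x) -> 0 <= I f.
Proof. by move=> h; apply: Rintegral_ge0. Qed.
Lemma I_ext f g : f =1 g -> I f = I g.
Proof. by move=> /funext ->. Qed.

Lemma aeS (P Q : R -> Prop) : (forall x, P x -> Q x) ->
  {ae mu, forall x, P x} -> {ae mu, forall x, Q x}.
Proof. exact: (@filterS _ _ (ae_filter_ringOfSetsType mu)). Qed.

Lemma aeI (P Q : R -> Prop) : {ae mu, forall x, P x} -> {ae mu, forall x, Q x} ->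
  {ae mu, forall x, P x /\ Q x}.
Proof. exact: (@filterI _ _ (ae_filter_ringOfSetsType mu)). Qed.

Lemma aeT (P : R -> Prop) : (forall x, P x) -> {ae mu, forall x, P x}.
Proof. by move=> h; apply: aeS (@filterT _ _ (ae_filter_ringOfSetsType mu)) => x _. Qed.

Lemma I_ae f g : {ae mu, forall x, f x = g x} -> itg f -> itg g -> I f = I g.
Proof.
move=> fg ifi ig; rewrite /I /Rintegral; congr fine.
have mf : measurable_fun setT (EFin \o f) := measurable_int mu ifi.
have mg : measurable_fun setT (EFin \o g) := measurable_int mu ig.
have H : ae_eq mu setT (EFin \o f) (EFin \o g).
  by apply: aeS fg => x fgx _ /=; rewrite fgx.
exact: (@ae_eq_integral _ _ _ mu setT (EFin \o g) (EFin \o f) measurableT mf mg H).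
Qed.

Lemma EFin_I f : itg f -> (I f)%:E = (\int[mu]_x (f x)%:E)%E.
Proof. by move=> h; rewrite /I /Rintegral fineK//; exact: integrable_fin_num. Qed.

Lemma itg_intg a b f : itg f -> intg a b f.
Proof. by apply: integrableS. Qed.

Lemma int_le_I a b f : itg f -> (forall x, 0 <= f x) -> int a b f <= I f.
Proof.
move=> fi f0; rewrite -lee_fin EFin_I// /int /Rintegral fineK.
  apply: (@ge0_subset_integral _ _ _ mu `[a, b]%classic setT _ measurableT (EFin \o f)) => //.
  - exact: (measurable_int mu fi).
  - by move=> x _; rewrite lee_fin.
by apply: integrable_fin_num => //; exact: itg_intg.
Qed.

Lemma I_dct (f_ : nat -> R -> R) f g : (forall n, measurable_fun setT (f_ n)) ->
  measurable_fun setT f -> itg g -> (forall x, f_ ^~ x @ \oo --> f x) ->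
  (forall n x, `|f_ n x| <= g x) -> I (f_ n) @[n --> \oo] --> I f.
Proof.
move=> mf_ mf ig cf fg.
have c1 : {ae mu, forall x, setT x -> (fun n => (f_ n x)%:E) @ \oo --> (EFin \o f) x}.
  by apply: aeT => x _ /=; apply: cvg_EFin; [exact: nearW|exact: cf].
have c2 : {ae mu, forall x, forall n : nat, setT x -> (`|(f_ n x)%:E| <= (EFin \o g) x)%E}.
  by apply: aeT => x n _ /=; rewrite lee_fin.
have [h1 _ h2] := @dominated_convergence _ _ R mu setT measurableT (fun n x => (f_ n x)%:E)
  (EFin \o f) (EFin \o g) (fun n => measE (mf_ n)) (measE mf) c1 ig c2.
rewrite /I /Rintegral; apply: fine_cvg; rewrite fineK; first exact: h2.
exact: integrable_fin_num.
Qed.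

Lemma int_lim f (A B : nat -> R) : itg f -> (forall n, A n <= - n%:R) ->
  (forall n, n%:R <= B n) -> int (A n) (B n) f @[n --> \oo] --> I f.
Proof.
move=> fi hA hB.
rewrite (_ : (fun n => int (A n) (B n) f) = (fun n => I (f \_ `[A n, B n]))); last first.
  by apply/funext => n; rewrite /int Rintegral_mkcond.
have mf := itg_meas fi.
apply: (@I_dct _ _ (fun x => `|f x|)) => //.
- move=> n; apply/(measurable_restrictT _ _).1 => //.
  exact: measurable_funS mf.
- exact: integrable_norm.
- move=> x; apply: cvg_near_cst; near=> n.
  rewrite /= patchE mem_set//= in_itv/=; apply/andP.
  have nx : `|x| <= n%:R by near: n; exact: nbhs_infty_ger.
  move: nx; rewrite ler_norml => /andP[h1 h2].
  by rewrite (le_trans (hA n))// (le_trans h2).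
- by move=> n x; rewrite patchE; case: ifP => //; rewrite normr0.
Unshelve. all: by end_near. Qed.

Lemma L2f_mul f g : L2f f -> L2f g -> itg (fun x => f x * g x).
Proof.
move=> [mf hf] [mg hg]; apply: (itg_le _ (itgD hf hg)).
  exact: measurable_funM.
move=> x; rewrite ler_norml; have := sqr_ge0 (f x - g x); have := sqr_ge0 (f x + g x).
have := sqr_ge0 (f x); have := sqr_ge0 (g x).
by move=> *; apply/andP; split; lra.
Qed.

Lemma L2fD f g : L2f f -> L2f g -> L2f (fun x => f x + g x).
Proof.
move=> hf hg; split; first by apply: measurable_funD; [exact: hf.1|exact: hg.1].
have h := itgD (itgD hf.2 (itgZ 2 (L2f_mul hf hg))) hg.2.
rewrite /itg (_ : EFin \o _ = EFin \o (fun x => f x ^+ 2 + 2 * (f x * g x) + g x ^+ 2))//.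
by apply/funext => x /=; congr (_%:E); ring.
Qed.

Lemma L2fZ k f : L2f f -> L2f (fun x => k * f x).
Proof.
move=> hf; split; first by apply: measurable_funM => //; exact: hf.1.
have h := itgZ (k ^+ 2) hf.2.
rewrite /itg (_ : EFin \o _ = EFin \o (fun x => k ^+ 2 * f x ^+ 2))//.
by apply/funext => x /=; congr (_%:E); ring.
Qed.

Lemma L2fB f g : L2f f -> L2f g -> L2f (fun x => f x - g x).
Proof.
move=> hf hg; have := L2fD hf (L2fZ (- 1) hg).
by rewrite (_ : (fun x => _) = (fun x => f x - g x))//; apply/funext => x; ring.
Qed.

Lemma L2f_le f g : measurable_fun setT f -> L2f g -> (forall x, `|f x| <= `|g x|) -> L2f f.
Proof.
move=> mf hg fg; split => //; apply: (itg_le _ hg.2).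
  exact: measurable_funX.
move=> x; rewrite normrX -(real_normK (num_real (g x))).
by rewrite lerXn2r ?nnegrE.
Qed.

Lemma L2f_bounded c f g : measurable_fun setT g -> (forall x, `|g x| <= c) -> L2f f ->
  L2f (fun x => g x * f x).
Proof.
move=> mg gc hf; apply: (L2f_le _ (L2fZ c hf)).
  by apply: measurable_funM => //; exact: hf.1.
move=> x; rewrite !normrM ler_wpM2r//; apply: le_trans (gc x) _; exact: ler_norm.
Qed.

(** The weighted Young form takes the place of the Cauchy-Schwarz inequality throughout; the weight
    [t] is chosen at each use. *)
Lemma young_I f g t : 0 < t -> L2f f -> L2f g ->
  `|I (fun x => f x * g x)| <= t / 2 * I (fun x => f x ^+ 2) + (2 * t)^-1 * I (fun x => g x ^+ 2).
Proof.
move=> t0 hf hg; have i := L2f_mul hf hg.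
have tn : t != 0 by rewrite gt_eqF.
have P s : s ^+ 2 = 1 -> s * I (fun x => f x * g x) <=
    t / 2 * I (fun x => f x ^+ 2) + (2 * t)^-1 * I (fun x => g x ^+ 2).
  move=> s1; rewrite -!IZ ?hf.2 ?hg.2// -?ID; [|by apply: itgZ; have [] := hf|by apply: itgZ; have [] := hg].
  apply: I_le; [exact: itgZ|apply: itgD; apply: itgZ; [exact: hf.2|exact: hg.2]|].
  move=> x; rewrite -subr_ge0.
  have -> : t / 2 * f x ^+ 2 + (2 * t)^-1 * g x ^+ 2 - s * (f x * g x) =
    (2 * t)^-1 * (t * s * f x - g x) ^+ 2 + t / 2 * (1 - s ^+ 2) * f x ^+ 2 by field.
  by rewrite s1 subrr mulr0 mul0r addr0 mulr_ge0 ?sqr_ge0// invr_ge0 mulr_ge0// ltW.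
have := P 1; have := P (-1); rewrite sqrrN expr1n mul1r mulN1r => /(_ erefl) h1 /(_ erefl) h2.
by rewrite ler_norml h2 andbT lerNl.
Qed.
End whole_line.

Section sequences.
Context {R : realType}.

Lemma cvg0_harmonic (s : nat -> R) : (forall n, `|s n| <= n.+1%:R^-1) -> s @ \oo --> 0.
Proof.
move=> h; apply: (@squeeze_cvgr _ _ _ _ (fun n => - n.+1%:R^-1) (fun n => n.+1%:R^-1)).
- by apply: nearW => n; have := h n; rewrite ler_norml.
- by rewrite -oppr0; apply: cvgN; exact: cvg_harmonic.
- exact: cvg_harmonic.
Qed.

Lemma cvg_eql (s : nat -> R) (a b : R) : s @ \oo --> a -> a = b -> s @ \oo --> b.
Proof. by move=> h <-. Qed.

(** A nonnegative function that stays above [e] on a segment of length [(I g + 1) / e] would have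
    integral larger than [I g]. This replaces decay at infinity, which integrability alone does not
    give. *)
Lemma itg_small (g : R -> R) : itg g -> (forall x, 0 <= g x) ->
  forall N e, 0 < e -> (exists2 x, N <= x & g x < e) /\ (exists2 x, x <= N & g x < e).
Proof.
move=> ig g0 N e e0; pose L := (I g + 1) / e.
have I0 : 0 <= I g by exact: I_ge0.
have L0 : 0 <= L by rewrite divr_ge0// ?ltW//; lra.
have key a b : b - a = L -> ~ (forall x, a <= x <= b -> e <= g x).
  move=> ab h; have ab' : a <= b by lra.
  have := int_le_I a b ig g0.
  have : int a b (fun=> e) <= int a b g.
    by apply: le_int => //; [by apply: intg_cont => ?; exact: cvg_cst|exact: itg_intg].
  rewrite (int_cst _ ab') ab /L mulrC divfK ?gt_eqF//; lra.
split; apply: contrapT => h.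
- apply: (key N (N + L)); first by ring.
  move=> x /andP[Nx _]; rewrite leNgt; apply/negP => gx; apply: h; by exists x.
- apply: (key (N - L) N); first by ring.
  move=> x /andP[_ Nx]; rewrite leNgt; apply/negP => gx; apply: h; by exists x.
Qed.
Lemma psl_gt0 (v : R) : - (1/100) <= v -> v <= 1/100 -> 0 < psl v.
Proof. by rewrite /psl => h1 h2; nra. Qed.

Lemma ptl_small (v : R) : - (1/100) <= v -> v <= 1/100 -> ptl v <= 8/100.
Proof. by rewrite /ptl => h1 h2; nra. Qed.
End sequences.

(** * The inequality at a frozen time on the whole line *)

Section spatial.
Context {R : realType}.
Context (um e k : R) (f f1 f2 Fp S U U1 ut : R -> R).
Hypotheses (um0 : 0 < um) (e0 : 0 <= e) (ek : 100 * e <= k) (k1 : 500 * (500 * k) <= 1).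
Hypotheses (df : forall x : R, is_derive x 1 f (f1 x))
  (df1 : forall x : R, is_derive x 1 f1 (f2 x))
  (hq : forall y : R, `|f2 y - 6 * y| <= e * (um + `|y|)).
Let F x := excess um f f1 (S x).
Context (ul M : R).
Hypotheses (dS : forall x : R, is_derive x 1 S (F x))
  (F0 : forall x, 0 < F x)
  (S_gt : forall x, ul <= S x) (S_lt : forall x, S x < um)
  (ul_ge : - (2 + 1/100) * um <= ul) (ul_le : ul <= - (2 - 1/100) * um)
  (ul0 : excess um f f1 ul = 0)
  (Sy : S x @[x --> +oo] --> um) (SNy : S x @[x --> -oo] --> ul)
  (FM : forall x, F x <= M) (iF : itg F).
Hypotheses (dU : forall x : R, is_derive x 1 U (U1 x)) (cU1 : continuous U1)
  (iut : forall a b, intg a b ut)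
  (hut : forall a b, a <= b -> (U1 b - f (U b)) - (U1 a - f (U a)) = int a b ut)
  (Lut : L2f ut) (Lw : L2f (fun x => U x - S x)) (Lw1 : L2f (fun x => U1 x - F x)).
Context (x0 : R) (Sx0 : S x0 = - um).

Let w x := U x - S x.
Let w1 x := U1 x - F x.
Let a x := 5 * um - S x.
Let K x := w x ^+ 2 / 2 + a x * w x.
Let m := w x0.

Let cf : continuous f. Proof. by move=> x; exact: der_cont (df x). Qed.
Let cS : continuous S. Proof. by move=> x; exact: der_cont (dS x). Qed.
Let ca : continuous a. Proof. by move=> x; apply: cvgB; [exact: cvg_cst|exact: cS]. Qed.
Let cex : continuous (excess um f f1).
Proof. by move=> x; exact: der_cont (excess_der um df x). Qed.

Let a_bd x : `|a x| <= 8 * um.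
Proof. by have h1 := S_gt x; have h2 := S_lt x; have h3 := ul_ge; have h4 := um0; rewrite /a ger0_norm; lra. Qed.

Lemma itg_weight_w_ut : itg (fun x => a x * w x * ut x).
Proof.
apply: L2f_mul => //; apply: (L2f_bounded _ a_bd Lw).
exact: continuous_measurable_fun.
Qed.

Let cF : continuous F.
Proof. by move=> x; apply: (@continuous_comp _ _ _ S); [exact: cS|exact: cex]. Qed.

Let mF : measurable_fun setT F.
Proof. exact: continuous_measurable_fun. Qed.

Let absF x : `|F x| <= M.
Proof. by rewrite ger0_norm// ltW. Qed.

Let LF : L2f F.
Proof.
split=> //; apply: (itg_le _ (itgZ M iF)); first exact: measurable_funX.
by move=> x; rewrite ger0_norm ?sqr_ge0// expr2 ler_wpM2r// ltW.
Qed.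

Lemma itg_FK : itg (fun x => F x * K x).
Proof.
have h1 : itg (fun x => F x * (w x * w x)).
  apply: (itg_le _ (itgZ M Lw.2)).
    by apply: measurable_funM => //; apply: measurable_funM; exact: Lw.1.
  by move=> x; rewrite normrM -expr2 [`|w x ^+ 2|]ger0_norm ?sqr_ge0// ler_wpM2r ?sqr_ge0.
have h2 : itg (fun x => F x * (a x * w x)).
  apply: L2f_mul => //; apply: (L2f_bounded _ a_bd Lw); exact: continuous_measurable_fun.
have := itgD (itgZ (2^-1) h1) h2; rewrite /itg; congr (integrable _ _ _).
by apply/funext => x /=; congr (_%:E); rewrite /K; ring.
Qed.

(** The boundary terms as a function of the values [s] of [S], [o] of [w] and [o1] of [w_x] only, so
    that their limit follows from the limits of these three sequences. *)
Let bds (s o o1 : R) : R := (5 * um - s) * o * (o1 - (f (s + o) - f s)) + excess um f f1 s * o ^+ 2 / 2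
  + (5 * um - s) * (Fp (s + o) - Fp s - f s * o).

Hypothesis dFp : forall x : R, is_derive x 1 Fp (f x).
Let cFp : continuous Fp. Proof. by move=> x; exact: der_cont (dFp x). Qed.

Let cvg_at (g : R -> R) (s : nat -> R) (c : R) : continuous g -> s @ \oo --> c ->
  g (s n) @[n --> \oo] --> g c.
Proof. by move=> cg sc; apply: (@continuous_cvg _ _ _ _ _ s g c); [exact: cg|exact: sc]. Qed.

Let bds_cvg (s o o1 : nat -> R) (c : R) : s @ \oo --> c -> o @ \oo --> 0 -> o1 @ \oo --> 0 ->
  bds (s n) (o n) (o1 n) @[n --> \oo] --> 0.
Proof.
move=> sc oc o1c.
have so : (fun n => s n + o n) @ \oo --> c by apply: (cvg_eql (cvgD sc oc)); rewrite addr0.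
have fso := cvg_at cf so; have fs := cvg_at cf sc.
have Fso := cvg_at cFp so; have Fs := cvg_at cFp sc.
have ex := cvg_at cex sc.
have as_ : 5 * um - s n @[n --> \oo] --> 5 * um - c by apply: cvgB => //; exact: cvg_cst.
have o2 : o n ^+ 2 / 2 @[n --> \oo] --> 0.
  apply: (@cvg_eql R _ (0 * 0 / 2)); last by rewrite !mul0r.
  by apply: cvgM; [rewrite (_ : (fun n => _) = (fun n => o n * o n)) //; exact: cvgM|exact: cvg_cst].
apply: (@cvg_eql R _ ((5 * um - c) * 0 * (0 - (f c - f c)) + excess um f f1 c * 0
  + (5 * um - c) * (Fp c - Fp c - f c * 0))); last by ring.
rewrite /bds; apply: cvgD; first apply: cvgD.
- apply: cvgM; first exact: cvgM.
  by apply: cvgB => //; exact: cvgB.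
- rewrite (_ : (fun n => _) = (fun n => excess um f f1 (s n) * (o n ^+ 2 / 2))); first exact: cvgM.
  by apply/funext => n; rewrite mulrA.
- by apply: cvgM => //; apply: cvgB; [exact: cvgB|exact: cvgM].
Qed.

Let rest (ph : R -> R) (ph1 : R) (T : R -> R) (s o : R) : R :=
  2 * (5 * um - s) * excess um f f1 s * ph1 * m * (o - ph s * m) + T s * m ^+ 2.

Let rest_cvg (ph : R -> R) (ph1 : R) (T : R -> R) (s o : nat -> R) (c : R) : continuous ph -> continuous T ->
  excess um f f1 c = 0 -> s @ \oo --> c -> o @ \oo --> 0 ->
  rest ph ph1 T (s n) (o n) @[n --> \oo] --> T c * m ^+ 2.
Proof.
move=> cph cT ex0 sc oc.
have ex := cvg_at cex sc; have ps := cvg_at cph sc; have ts := cvg_at cT sc.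
apply: (@cvg_eql R _ (2 * (5 * um - c) * excess um f f1 c * ph1 * m * (0 - ph c * m)
   + T c * m ^+ 2)); last by rewrite ex0; ring.
rewrite /rest; apply: cvgD; last by apply: cvgM => //; exact: cvg_cst.
apply: cvgM; last by apply: cvgB => //; apply: cvgM => //; exact: cvg_cst.
do 2 (apply: cvgM; last exact: cvg_cst).
apply: cvgM => //; apply: cvgM; first exact: cvg_cst.
by apply: cvgB => //; exact: cvg_cst.
Qed.

Lemma spatial_ineq : I (fun x => a x * w x * ut x) <=
  32 / um * I (fun x => F x * K x) ^+ 2 - f1 um * I (fun x => F x * K x).
Proof.
have un : um != 0 by rewrite gt_eqF.
pose g x := w x ^+ 2 + w1 x ^+ 2.
have ig : itg g by apply: itgD; [exact: Lw.2|exact: Lw1.2].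
have g0 x : 0 <= g x by rewrite addr_ge0 ?sqr_ge0.
have small n x : g x < (n.+1%:R^-1) ^+ 2 -> `|w x| <= n.+1%:R^-1 /\ `|w1 x| <= n.+1%:R^-1.
  move=> h; have n0 : 0 <= n.+1%:R^-1 :> R by rewrite invr_ge0.
  split; rewrite -(ler_pXn2r (isT : (0 < 2)%N)) ?nnegrE// real_normK ?num_real//.
    by apply: le_trans (ltW h); rewrite lerDl sqr_ge0.
  by apply: le_trans (ltW h); rewrite lerDr sqr_ge0.
(* The endpoints are not [- n] and [n]: they are chosen beyond them, where [w] and [w_x] are
   simultaneously at most [1/(n+1)]. *)
have ex n : exists BA : R * R, [/\ n%:R <= BA.1, x0 <= BA.1, BA.2 <= - n%:R, BA.2 <= x0 &
    g BA.1 < (n.+1%:R^-1) ^+ 2 /\ g BA.2 < (n.+1%:R^-1) ^+ 2].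
  have n0 : 0 < (n.+1%:R^-1) ^+ 2 :> R by rewrite exprn_gt0// invr_gt0.
  have [[B hB gB] _] := itg_small ig g0 (Num.max n%:R x0) n0.
  have [_ [A hA gA]] := itg_small ig g0 (Num.min (- n%:R) x0) n0.
  move: hB hA; rewrite ge_max le_min => /andP[h1 h2] /andP[h3 h4].
  by exists (B, A).
have [BA hBA] := choice ex.
pose B n := (BA n).1; pose A n := (BA n).2.
have Bn n : n%:R <= B n by have [] := hBA n.
have An n : A n <= - n%:R by have [] := hBA n.
have wB : w (B n) @[n --> \oo] --> 0.
  by apply: cvg0_harmonic => n; have [_ _ _ _ [/small[]]] := hBA n.
have w1B : w1 (B n) @[n --> \oo] --> 0.
  by apply: cvg0_harmonic => n; have [_ _ _ _ [/small[]]] := hBA n.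
have wA : w (A n) @[n --> \oo] --> 0.
  by apply: cvg0_harmonic => n; have [_ _ _ _ [_ /small[]]] := hBA n.
have w1A : w1 (A n) @[n --> \oo] --> 0.
  by apply: cvg0_harmonic => n; have [_ _ _ _ [_ /small[]]] := hBA n.
have By : B @ \oo --> +oo.
  apply/cvgryPge => x; near=> n; apply: le_trans (Bn n).
  by near: n; exact: nbhs_infty_ger.
have ANy : A @ \oo --> -oo.
  apply/cvgrNyPle => x; near=> n; apply: le_trans (An n) _; rewrite lerNl.
  by near: n; exact: nbhs_infty_ger.
have SB : S (B n) @[n --> \oo] --> um by exact: cvg_comp By Sy.
have SA : S (A n) @[n --> \oo] --> ul by exact: cvg_comp ANy SNy.
have b1 := bds_cvg SB wB w1B; have b2 := bds_cvg SA wA w1A.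
have exum : excess um f f1 um = 0 by rewrite /excess; ring.
have cphr : continuous (phr um) by move=> x; exact: der_cont (phr_der x un).
have cphl : continuous (phl um) by move=> x; exact: der_cont (phl_der x un).
have cTr : continuous (Tr um) by move=> x; exact: der_cont (Tr_der x un).
have cTl : continuous (Tl um) by move=> x; exact: der_cont (Tl_der x un).
have r1 := @rest_cvg (phr um) (5 / (4 * um)) (Tr um) _ _ _ cphr cTr exum SB wB.
have r2 := @rest_cvg (phl um) (- 1 / (3 * um)) (Tl um) _ _ _ cphl cTl ul0 SA wA.
(* At the left end [hl] is continuous, since [psl] is positive near the left state, and the factor
   [excess] tends to 0. *)
have r3 : (5 * um - S (A n)) * excess um f f1 (S (A n)) * hl um (S (A n)) *
    (w (A n) - phl um (S (A n)) * m) ^+ 2 @[n --> \oo] --> 0.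
  have v1 : ul / um <= - 2 + 1 / 100 by rewrite ler_pdivrMr//; move: ul_le; lra.
  have v0 : - (2 + 1/100) <= ul / um by rewrite ler_pdivlMr//; move: ul_ge; lra.
  have chl : {for ul, continuous (hl um)}.
    have pn : psl (ul / um + 2) != 0 by rewrite gt_eqF//; apply: psl_gt0; lra.
    exact: der_cont (hl_der un pn).
  have hs : hl um (S (A n)) @[n --> \oo] --> hl um ul.
    exact: (@continuous_cvg _ _ _ _ _ (fun n => S (A n)) (hl um) ul).
  have ps := cvg_at cphl SA; have exs := cvg_at cex SA.
  have ds : w (A n) - phl um (S (A n)) * m @[n --> \oo] --> 0 - phl um ul * m.
    by apply: cvgB => //; apply: cvgM => //; exact: cvg_cst.
  apply: (@cvg_eql R _ ((5 * um - ul) * excess um f f1 ul * hl um ul *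
    ((0 - phl um ul * m) * (0 - phl um ul * m)))); last by rewrite ul0; ring.
  apply: cvgM; last by apply: cvgM.
  by apply: cvgM => //; apply: cvgM => //; apply: cvgB => //; exact: cvg_cst.
have i1 := int_lim itg_weight_w_ut An Bn.
have i2 := int_lim itg_FK An Bn.
have lim_rhs : bds (S (B n)) (w (B n)) (w1 (B n)) - bds (S (A n)) (w (A n)) (w1 (A n))
   - rest (phr um) (5 / (4 * um)) (Tr um) (S (B n)) (w (B n))
   + ((5 * um - S (A n)) * excess um f f1 (S (A n)) * hl um (S (A n)) *
    (w (A n) - phl um (S (A n)) * m) ^+ 2
    + rest (phl um) (- 1 / (3 * um)) (Tl um) (S (A n)) (w (A n)))
   - (19/6 - 12/5) * um ^+ 3 * m ^+ 2
   + (8 * um * m - f1 um) * int (A n) (B n) (fun x => F x * K x) @[n --> \oo] -->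
   0 - 0 - Tr um um * m ^+ 2 + (0 + Tl um ul * m ^+ 2)
   - (19/6 - 12/5) * um ^+ 3 * m ^+ 2 + (8 * um * m - f1 um) * I (fun x => F x * K x).
  apply: cvgD; last by apply: cvgM => //; exact: cvg_cst.
  apply: cvgB; last exact: cvg_cst.
  by apply: cvgD; [apply: cvgB => //; exact: cvgB|exact: cvgD].
have step n : int (A n) (B n) (fun x => a x * w x * ut x) <=
   bds (S (B n)) (w (B n)) (w1 (B n)) - bds (S (A n)) (w (A n)) (w1 (A n))
   - rest (phr um) (5 / (4 * um)) (Tr um) (S (B n)) (w (B n))
   + ((5 * um - S (A n)) * excess um f f1 (S (A n)) * hl um (S (A n)) *
    (w (A n) - phl um (S (A n)) * m) ^+ 2
    + rest (phl um) (- 1 / (3 * um)) (Tl um) (S (A n)) (w (A n)))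
   - (19/6 - 12/5) * um ^+ 3 * m ^+ 2
   + (8 * um * m - f1 um) * int (A n) (B n) (fun x => F x * K x).
  have [_ xB _ Ax _] := hBA n.
  have Sge x : - (2 + 1/100) * um <= S x by exact: le_trans ul_ge (S_gt x).
  have := @interval_ineq R um e k f f1 f2 Fp S U U1 ut um0 e0 ek k1 df df1 hq dFp dS F0
    Sge S_lt dU cU1 iut hut x0 Sx0 (A n) (B n) Ax xB.
  have Ubs x : U x = S x + (U x - S x) by ring.
  rewrite -/(F (B n)) -/(F (A n)) -/(w (B n)) -/(w (A n)) -/(w x0) -/m.
  (* [hr] blows up as [S] tends to [um], so no limit is taken in this term: it enters with a minus
     sign and is dropped by its sign. *)
  have hpos : 0 <= (5 * um - S (B n)) * F (B n) * hr um (S (B n)) *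
     (w (B n) - phr um (S (B n)) * m) ^+ 2.
    have SB1 : - um <= S (B n).
      rewrite -Sx0; apply: der_ge0_nondecreasing xB _ _ => z _ //; exact: ltW.
    have z0 : S (B n) / um < 1 by rewrite ltr_pdivrMr// mul1r.
    have z1 : - 1 <= S (B n) / um by rewrite ler_pdivlMr// mulN1r.
    rewrite mulr_ge0 ?sqr_ge0// mulr_ge0//.
      by rewrite mulr_ge0 ?(ltW (F0 _))//; have := S_lt (B n); move: um0; lra.
    rewrite /hr divr_ge0 ?(ltW um0)// addr_ge0// ?mulr_ge0// ?invr_ge0//; lra.
  have EB : (5 * um - S (B n)) * w (B n) * (U1 (B n) - F (B n) - (f (U (B n)) - f (S (B n)))) +
    F (B n) * w (B n) ^+ 2 / 2 + (5 * um - S (B n)) * (Fp (U (B n)) - Fp (S (B n)) - f (S (B n)) * w (B n))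
    = bds (S (B n)) (w (B n)) (w1 (B n)) by rewrite /bds -/(F (B n)) (_ : S (B n) + w (B n) = U (B n)) // /w; ring.
  have EA : (5 * um - S (A n)) * w (A n) * (U1 (A n) - F (A n) - (f (U (A n)) - f (S (A n)))) +
    F (A n) * w (A n) ^+ 2 / 2 + (5 * um - S (A n)) * (Fp (U (A n)) - Fp (S (A n)) - f (S (A n)) * w (A n))
    = bds (S (A n)) (w (A n)) (w1 (A n)) by rewrite /bds -/(F (A n)) (_ : S (A n) + w (A n) = U (A n)) // /w; ring.
  rewrite EB EA -/(F _) => h; apply: le_trans h _.
  rewrite /rest -/(F (B n)) -/(F (A n)); move: hpos; rewrite /w; lra.
have := ler_cvg_to i1 lim_rhs (nearW _ step).
have Tr0 : Tr um um = 0 by rewrite /Tr /ptr divff// subrr; ring.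
(* [T] need not vanish at the perturbed left state. The loss is affordable:
   [19/6 - 12/5 - 8/100 > 1/2]. *)
have Tl0 : Tl um ul <= um ^+ 3 * (8 / 100).
  have v1 : ul / um <= - 2 + 1 / 100 by rewrite ler_pdivrMr//; move: ul_le; lra.
  have v0 : - (2 + 1/100) <= ul / um by rewrite ler_pdivlMr//; move: ul_ge; lra.
  by rewrite /Tl ler_wpM2l ?exprn_ge0 ?(ltW um0)//; apply: ptl_small; lra.
rewrite Tr0; set Q := I (fun x => F x * K x) => h; apply: le_trans (h _ _) _.
have h2 := ler_wpM2r (sqr_ge0 m) Tl0.
(* Young's inequality for the multiplier [8 um m Q], paid by the share [um^3 m^2 / 2] of the jump at
   [x0]. *)
have h3 : 0 <= (um ^+ 3)^-1 / 2 * (um ^+ 3 * m - 8 * um * Q) ^+ 2.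
  by rewrite mulr_ge0 ?sqr_ge0// mulr_ge0// invr_ge0 exprn_ge0// ltW.
have E3 : (um ^+ 3)^-1 / 2 * (um ^+ 3 * m - 8 * um * Q) ^+ 2 =
  um ^+ 3 * m ^+ 2 / 2 - 8 * um * m * Q + 32 / um * Q ^+ 2 by field.
have h4 : 0 <= um ^+ 3 * m ^+ 2 by rewrite mulr_ge0 ?sqr_ge0// exprn_ge0// ltW.
rewrite E3 in h3; lra.
Unshelve. all: by end_near. Qed.
End spatial.

(** * Test functions and weak derivatives *)
Section smooth_step.
Context {R : realType}.
Implicit Types (f g : R -> R) (p : {poly R}).

(** Meant for the origin, the only point where [flat] changes formula. *)
Lemma der_quadratic_bound f (x C : R) :
  (forall h, `|h| <= 1 -> `|f (x + h) - f x| <= C * h ^+ 2) -> is_derive x 1 f 0.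
Proof.
move=> h.
have C0 : 0 <= C.
  by have := h 1; rewrite normr1 lexx expr1n mulr1 => /(_ isT); exact: le_trans.
have cv : (fun t : R => t^-1 *: (f (t *: 1 + x) - f x)) @ 0^' --> (0 : R).
  apply/cvgrPdist_le => e e0.
  have d0 : 0 < Num.min 1 (e / (C + 1)).
    by rewrite lt_min ltr01/= divr_gt0//; lra.
  near=> t.
  have t0 : t != 0 by near: t; exact: nbhs_dnbhs_neq.
  have td : `|t| < Num.min 1 (e / (C + 1)).
    by near: t; apply: dnbhs0_lt.
  move: td; rewrite lt_min => /andP[t1 te].
  rewrite sub0r normrN /GRing.scale/= mulr1 normrM normfV (addrC t x).
  rewrite mulrC ler_pdivrMr ?normr_gt0//.
  apply: le_trans (h _ (ltW t1)) _.
  rewrite -(real_normK (num_real t)) expr2 mulrA ler_wpM2r//.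
  have : (C + 1) * `|t| <= e by rewrite mulrC -ler_pdivlMr ?(ltW te)//; lra.
  by have := normr_ge0 t; lra.
split; first by apply/cvg_ex; exists 0.
by rewrite /derive; apply/cvg_lim.
Unshelve. all: by end_near. Qed.

(** The standard flat function with a polynomial in [1/x] in front. This makes the family stable
    under differentiation, with [p] replaced by [X^2 (p - p')], so all orders are treated at
    once. *)
Definition flat p (x : R) : R := if 0 < x then p.[x^-1] * expR (- x^-1) else 0.

Lemma poly_growth p : exists2 C, 0 <= C & forall z : R, 1 <= z -> `|p.[z]| <= C * z ^+ size p.
Proof.
exists (\sum_(i < size p) `|p`_i|) => [|z z1]; first by apply: sumr_ge0.
rewrite horner_coef mulr_suml; apply: le_trans (ler_norm_sum _ _ _) _.
apply: ler_sum => i _; rewrite normrM normrX ler_wpM2l// ger0_norm ?(le_trans ler01)//.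
by rewrite ler_weXn2l// ltnW.
Qed.

Lemma flat_bound p : exists C, forall x : R, `|x| <= 1 -> `|flat p x| <= C * x ^+ 2.
Proof.
have [C C0 hC] := poly_growth p.
(* The term of degree [n] of the exponential series beats the growth [x^-(size p)] of the polynomial
   and leaves the factor [x^2]. *)
pose n := (size p).+2.
exists (C * n`!%:R) => x x1; rewrite /flat; case: ltP => x0; last first.
  by rewrite normr0 mulr_ge0 ?sqr_ge0// mulr_ge0.
have x1' : x <= 1 by move: x1; rewrite ler_norml => /andP[].
have z1 : 1 <= x^-1 by rewrite invf_ge1.
have z0 : 0 < x^-1 by rewrite invr_gt0.
rewrite normrM [`|expR _|]ger0_norm ?expR_ge0//.
have he : (x^-1) ^+ n / n`!%:R <= expR x^-1.
  by have := expR_ge1Dxn (size p).+1 (ltW z0); rewrite -/n; lra.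
rewrite expRN ler_pdivrMr ?expR_gt0//.
apply: le_trans (hC _ z1) _.
have -> : C * n`!%:R * x ^+ 2 * expR x^-1 = C * (n`!%:R * x ^+ 2 * expR x^-1) by ring.
rewrite ler_wpM2l//.
have f0 : 0 < n`!%:R * x ^+ 2 by rewrite mulr_gt0 ?exprn_gt0// ltr0n fact_gt0.
apply: le_trans (ler_wpM2l (ltW f0) he); rewrite le_eqVlt; apply/orP; left; apply/eqP.
rewrite /n -addn2 exprD.
have -> : (x^-1) ^+ 2 = (x ^+ 2)^-1 by rewrite exprVn.
have fn : ((size p + 2)`!)%:R != 0 :> R by rewrite pnatr_eq0 -lt0n fact_gt0.
have xn : x != 0 by rewrite gt_eqF.
move: (x^-1 ^+ size p) ((size p + 2)`!%:R) fn => u v vn; by field; rewrite vn xn.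
Qed.

Lemma flat_der p (x : R) : is_derive x 1 (flat p) (flat ('X^2 * (p - p^`())) x).
Proof.
have [x0|x0|->] := ltrgtP x 0.
- have -> : flat ('X^2 * (p - p^`())) x = 0 by rewrite /flat ltNge (ltW x0).
  apply: near_eq_is_derive (derC 0 x).
  near=> y; rewrite /flat ifF//; apply/negbTE; rewrite -leNgt ltW//.
  by near: y; exact: lt_nbhsl.
- have -> : flat ('X^2 * (p - p^`())) x = ('X^2 * (p - p^`())).[x^-1] * expR (- x^-1) by rewrite /flat x0.
  have xn : x != 0 by rewrite gt_eqF.
  have dV : is_derive x 1 (fun y : R => y^-1) (- x ^- 2 * 1).
    by apply: (@derV R (fun y => y)) => //; exact: derI.
  have dp : is_derive x 1 (fun y => p.[y^-1]) (p^`().[x^-1] * (- x ^- 2 * 1)).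
    by apply: (@derComp R (fun y => p.[y]) (fun y => y^-1)) => //; exact: is_derive_poly.
  have dN := derN dV.
  have de : is_derive x 1 (fun y => expR (- y^-1)) (expR (- x^-1) * - (- x ^- 2 * 1)).
    by apply: (@derComp R expR (fun y => - y^-1)) => //; exact: is_derive_expR.
  have D : is_derive x 1 (fun y => p.[y^-1] * expR (- y^-1))
      (('X^2 * (p - p^`())).[x^-1] * expR (- x^-1)).
    apply: derE (derM dp de) _.
    rewrite hornerM hornerXn hornerD hornerN; move: (p^`().[_]) (p.[_]) (expR _) => a b c.
    by rewrite exprVn; field.
  apply: near_eq_is_derive D.
  by near=> y; rewrite /flat ifT//; near: y; exact: lt_nbhsr.
- have -> : flat ('X^2 * (p - p^`())) 0 = 0 by rewrite /flat ltxx.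
  have [C hC] := flat_bound p.
  apply: (@der_quadratic_bound _ _ C) => h h1; have z : flat p 0 = 0 by rewrite /flat ltxx.
  by rewrite add0r z subr0; exact: hC.
Unshelve. all: by end_near. Qed.

(* A class closed under differentiation, so that its members are C^oo without any
   bookkeeping of higher derivatives. *)
Inductive smooth_class : (R -> R) -> Prop :=
 | smooth_flat p : smooth_class (flat p)
 | smooth_cst c : smooth_class (fun=> c)
 | smooth_add f g : smooth_class f -> smooth_class g -> smooth_class (fun x => f x + g x)
 | smooth_mul f g : smooth_class f -> smooth_class g -> smooth_class (fun x => f x * g x)
 | smooth_aff f (a b : R) : smooth_class f -> smooth_class (fun x => f (a * x + b))
 | smooth_prim f g : smooth_class f -> (forall x : R, is_derive x 1 g (f x)) -> smooth_class g.

Lemma smooth_der f : smooth_class f -> exists2 f1, smooth_class f1 & forall x : R, is_derive x 1 f (f1 x).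
Proof.
elim=> {f} [p|c|f g _ [f1 s1 d1] _ [g1 s2 d2]|f g sf [f1 s1 d1] sg [g1 s2 d2]|f a b _ [f1 s1 d1]|f g sf _ dg].
- by exists (flat ('X^2 * (p - p^`()))); [exact: smooth_flat|exact: flat_der].
- by exists (fun=> 0); [exact: smooth_cst|move=> x; exact: derC].
- by exists (fun x => f1 x + g1 x); [exact: smooth_add|move=> x; exact: derD].
- exists (fun x => f x * g1 x + g x * f1 x); first by apply: smooth_add; exact: smooth_mul.
  by move=> x; exact: derM.
- exists (fun x => f1 (a * x + b) * a); first by apply: smooth_mul; [exact: smooth_aff|exact: smooth_cst].
  move=> x; have da : is_derive x 1 (fun x => a * x + b) a.
    by apply: derE (derD (derM (derC a x) (derI x)) (derC b x)) _; ring.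
  exact: (@derComp R f (fun x => a * x + b)).
- by exists f.
Qed.

Lemma smooth_cont f : smooth_class f -> continuous f.
Proof. by move=> /smooth_der[f1 _ h] x; exact: der_cont (h x). Qed.

Lemma smooth_Cdiff f : smooth_class f -> forall k, Cdiff k f.
Proof.
move=> sf k; have S j : smooth_class (derive1n j f).
  elim: j => [//|j /smooth_der[f1 s1 d1]]; rewrite derive1nS.
  by rewrite (_ : derive1 _ = f1)//; apply/funext => x; exact: der_val.
split; last exact: smooth_cont.
by move=> j _ x; have [f1 _ d1] := smooth_der (S j); have [] := d1 x.
Qed.

Lemma smooth_step_exists : exists H eta : R -> R, exists M : R,
  [/\ smooth_class H, smooth_class eta, (forall x : R, is_derive x 1 H (eta x)),
      (forall x, 0 <= eta x <= M) /\ (forall x, ~ 0 <= x <= 1 -> eta x = 0) &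
      [/\ forall x, x <= 0 -> H x = 0, forall x, 1 <= x -> H x = 1 & forall x, 0 <= H x <= 1]].
Proof.
pose e0 x := flat 1 x * flat 1 (- 1 * x + 1).
have se : smooth_class e0 by apply: smooth_mul; [|apply: smooth_aff]; exact: smooth_flat.
have f0 (x : R) : 0 <= flat 1 x.
  by rewrite /flat; case: ifP => //; rewrite hornerE mul1r expR_ge0.
have fp (x : R) : 0 < x -> 0 < flat 1 x.
  by move=> x0; rewrite /flat x0 hornerE mul1r expR_gt0.
have fz (x : R) : x <= 0 -> flat 1 x = 0 by move=> x0; rewrite /flat ltNge x0.
have e0z x : ~ 0 <= x <= 1 -> e0 x = 0.
  move=> h; rewrite /e0; have [x0|x0] := leP x 0; first by rewrite fz// mul0r.
  have [x1|x1] := leP x 1; first by exfalso; apply: h; rewrite ltW.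
  by rewrite [X in _ * X]fz ?mulr0//; lra.
have e0p x : 0 <= e0 x by rewrite mulr_ge0.
have [P dP iP] := primitive_exists (smooth_cont se).
have Pm a b : a <= b -> P a <= P b by move=> ab; exact: (der_ge0_nondecreasing ab (fun x _ => dP x) (fun x _ => e0p x)).
(* The mean value point lies well inside [(0, 1)], where [e0] is positive; so the total mass
   [P 1 - P 0] can be normalised to 1. *)
have [c cb cE] := @mvt_seg R P e0 (1/3) (2/3) ltac:(lra) (fun x _ => dP x).
have c0 : 0 < P 1 - P 0.
  have h1 : 0 < P (2/3) - P (1/3).
    rewrite cE; apply: mulr_gt0; last by lra.
    by rewrite /e0; apply: mulr_gt0; apply: fp; lra.
  have := Pm 0 (1/3) ltac:(lra); have := Pm (2/3) 1 ltac:(lra); lra.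
pose k := (P 1 - P 0)^-1.
have k0 : 0 < k by rewrite invr_gt0.
have [M M0 hM] := @cont_bounded R 0 1 _ (smooth_cont se).
pose eta x := k * e0 x; pose H x := k * (P x - P 0).
have dH (x : R) : is_derive x 1 H (eta x).
  rewrite /H; apply: derE (derM (derC k x) (derB (dP x) (derC (P 0) x))) _.
  by rewrite /eta; ring.
have seta : smooth_class eta by apply: smooth_mul => //; exact: smooth_cst.
have P0 x : x <= 0 -> P x = P 0.
  move=> x0; have [d /andP[_ d0] E] := mvt_seg x0 (fun x _ => dP x).
  have : e0 d = 0.
    have [->|dn] := eqVneq d 0; first by rewrite /e0 fz ?mul0r.
    by apply: e0z => /andP[d0' _]; move/eqP: dn; apply; apply/eqP; rewrite eq_le d0 d0'.
  by move=> ez; move: E; rewrite ez mul0r; lra.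
have P1 x : 1 <= x -> P x = P 1.
  move=> x1; have [d /andP[d1 _] E] := mvt_seg x1 (fun x _ => dP x).
  have : e0 d = 0 by rewrite /e0 [X in _ * X]fz ?mulr0//; lra.
  by move=> ez; move: E; rewrite ez mul0r; lra.
exists H, eta, (k * M); split => //.
- exact: smooth_prim seta dH.
- split=> x; last by move=> /e0z; rewrite /eta => ->; rewrite mulr0.
  apply/andP; split; first by rewrite mulr_ge0// ltW.
  rewrite ler_pM2l//; have [x01|/negP x01] := boolP (0 <= x <= 1).
    by apply: le_trans (hM x x01); exact: ler_norm.
  by rewrite e0z.
- split=> x.
  + by move=> /P0; rewrite /H => ->; rewrite subrr mulr0.
  + by move=> /P1; rewrite /H => ->; rewrite mulVf// gt_eqF.
  + have h0 : P 0 <= P x.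
      by have [x0|/ltW x0] := leP 0 x; [exact: Pm|rewrite (P0 _ x0)].
    have h1 : P x <= P 1.
      by have [x0|/ltW x0] := leP x 1; [exact: Pm|rewrite (P1 _ x0)].
    rewrite /H mulr_ge0 ?(ltW k0) ?subr_ge0//=.
    by rewrite mulrC ler_pdivrMr// mul1r lerD2r.
Qed.
End smooth_step.

Section weak_derivative.
Context {R : realType}.
Local Notation mu := (@lebesgue_measure R).
Implicit Types (f g h phi : R -> R) (D : set R).

Lemma locint_intg D f a b : locally_integrable D f -> `[a, b] `<=` D -> intg a b f.
Proof.
move=> [mf oD fin] abD; apply/integrableP; split.
  by apply/measurable_EFinP; apply: measurable_funS abD mf; exact: open_measurable.
exact: (fin _ abD (@segment_compact _ a b)).
Qed.

Lemma int_supp D f a b : `[a, b] `<=` D -> (forall x, D x -> ~ (a <= x <= b) -> f x = 0) ->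
  \int[mu]_(x in D) f x = int a b f.
Proof.
move=> abD f0; rewrite /int Rintegral_mkcond [RHS]Rintegral_mkcond.
congr (Rintegral _ _ _); apply/funext => x; rewrite !patchE.
have [xab|xab] := boolP (x \in `[a, b]%classic).
  by rewrite mem_set//; apply: abD; move: xab; rewrite inE.
case: ifPn => // xD; apply: f0; first by move: xD; rewrite inE.
by move=> h; move: xab; rewrite notin_setE/= in_itv/=.
Qed.

Lemma int_supp_itv f a b c d : c <= a -> b <= d ->
  (forall x, c <= x <= d -> ~ (a <= x <= b) -> f x = 0) -> int c d f = int a b f.
Proof.
move=> ca bd f0; apply: int_supp => [|x /=]; last by rewrite in_itv; exact: f0.
by apply: subset_itv; rewrite bnd_simp.
Qed.

(* The one-sided Lebesgue points, at which difference quotients can be tested with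
   one-sided bumps. *)
Definition right_pt g (s : R) := forall e, 0 < e -> exists2 p, 0 < p &
  forall r, 0 < r -> r < p -> int s (s + r) (fun x => `|g x - g s|) <= e * r.

Section increment.
Context (H eta : R -> R) (M : R) (SH : smooth_class H) (Se : smooth_class eta)
  (dH : forall x : R, is_derive x 1 H (eta x))
  (e01 : forall x, 0 <= eta x <= M) (ez : forall x, ~ 0 <= x <= 1 -> eta x = 0)
  (H0 : forall x, x <= 0 -> H x = 0) (H1 : forall x, 1 <= x -> H x = 1)
  (H01 : forall x, 0 <= H x <= 1).

Let M0 : 0 <= M. Proof. by have /andP[] := e01 0; exact: le_trans. Qed.

Definition step_at (c r x : R) := H (r^-1 * x + - (r^-1 * c)).
Definition bump_at (c r x : R) := r^-1 * eta (r^-1 * x + - (r^-1 * c)).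
(** Both ramps lie to the right of their base points, on [[s, s + r]] and [[t, t + r]]. The
    derivative is then a difference of one-sided bumps, as [right_pt] requires, and the support
    reaches beyond [t]. *)
Definition plateau (s t r x : R) := step_at s r x - step_at t r x.

Let arg (c r x : R) : r^-1 * x + - (r^-1 * c) = (x - c) / r.
Proof. by ring. Qed.

Lemma step_at_der c r (x : R) : is_derive x 1 (step_at c r) (bump_at c r x).
Proof.
have da : is_derive x 1 (fun x => r^-1 * x + - (r^-1 * c)) (r^-1).
  by apply: derE (derD (derM (derC r^-1 x) (derI x)) (derC (- (r^-1 * c)) x)) _; ring.
by apply: derE (@derComp R H (fun x => r^-1 * x + - (r^-1 * c)) x _ _ da (dH _)) _; rewrite mulrC.
Qed.

Lemma plateau_Sm s t r : smooth_class (plateau s t r).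
Proof.
have h := smooth_add (smooth_aff r^-1 (- (r^-1 * s)) SH)
  (smooth_mul (smooth_cst (-1)) (smooth_aff r^-1 (- (r^-1 * t)) SH)).
rewrite (_ : plateau s t r = (fun x => H (r^-1 * x - r^-1 * s) + -1 * H (r^-1 * x - r^-1 * t)))//.
by apply/funext => x; rewrite /plateau /step_at mulN1r.
Qed.

Lemma plateau_der s t r x : derive1 (plateau s t r) x = bump_at s r x - bump_at t r x.
Proof. by apply: der_val; apply: derB; exact: step_at_der. Qed.

Lemma bump_at0 c r x : 0 < r -> ~ (c <= x <= c + r) -> bump_at c r x = 0.
Proof.
move=> r0 h; rewrite /bump_at arg ez ?mulr0// => /andP[h1 h2]; apply: h.
move: h1 h2; rewrite ler_pdivlMr// mul0r ler_pdivrMr// mul1r => h1 h2.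
by apply/andP; split; lra.
Qed.

Lemma step_at0 c r x : 0 < r -> x <= c -> step_at c r x = 0.
Proof. by move=> r0 h; rewrite /step_at arg H0// ler_pdivrMr// mul0r subr_le0. Qed.

Lemma step_at1 c r x : 0 < r -> c + r <= x -> step_at c r x = 1.
Proof. by move=> r0 h; rewrite /step_at arg H1// ler_pdivlMr// mul1r lerBrDl. Qed.

Lemma plateau0 s t r x : 0 < r -> s <= t -> ~ (s <= x <= t + r) -> plateau s t r x = 0.
Proof.
move=> r0 st h; rewrite /plateau; have [xs|xs] := leP x s.
  by rewrite !step_at0 ?subrr// (le_trans xs).
have [xt|xt] := leP x (t + r); first by exfalso; apply: h; rewrite (ltW xs).
by rewrite !step_at1 ?subrr// ?(ltW xt)//; lra.
Qed.

Lemma plateau_test D s t r : 0 < r -> s <= t -> `[s, t + r] `<=` D ->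
  test_function D (plateau s t r).
Proof.
move=> r0 st sD; split; first exact/smooth_Cdiff/plateau_Sm.
exists `[s, t + r]%classic; split => //; first exact: segment_compact.
by move=> x; rewrite /= in_itv/= => ?; exact: plateau0.
Qed.

Lemma bump_cont c r : continuous (bump_at c r).
Proof.
apply: smooth_cont; apply: smooth_mul; first exact: smooth_cst.
exact: smooth_aff.
Qed.

Lemma int_bump c r : 0 < r -> int c (c + r) (bump_at c r) = 1.
Proof.
move=> r0; have cr : c <= c + r by rewrite lerDl ltW.
by rewrite (ftc_int (@bump_cont c r) (@step_at_der c r) cr) step_at1// step_at0// subr0.
Qed.

Lemma bump_avg g c r e : 0 < r -> intg c (c + r) g ->
  int c (c + r) (fun x => `|g x - g c|) <= e * r ->
  `|int c (c + r) (fun x => g x * bump_at c r x) - g c| <= M * e.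
Proof.
move=> r0 ig he.
have icst : intg c (c + r) (fun=> g c) by apply: intg_cont => ?; exact: cvg_cst.
have cb := @bump_cont c r.
have i1 : intg c (c + r) (fun x => bump_at c r x * (g x - g c)).
  by apply: intgM_cont => //; exact: intgB.
have -> : int c (c + r) (fun x => g x * bump_at c r x) - g c =
    int c (c + r) (fun x => bump_at c r x * (g x - g c)).
  rewrite -[X in _ - X]mulr1 -(@int_bump c r r0) -intZ; last exact: intg_cont.
  rewrite -intB; last 2 first.
  - have := intgM_cont cb ig; rewrite /intg; congr (integrable _ _ _).
    by apply/funext => x /=; rewrite mulrC.
  - by apply: intgZ; exact: intg_cont.
  by apply: eq_int => x _; ring.
apply: le_trans (le_norm_int i1) _.
apply: le_trans (_ : int c (c + r) (fun x => r^-1 * M * `|g x - g c|) <= _).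
  apply: le_int => [||x _]; first exact: intgN.
    by apply: intgZ; apply: intgN; exact: intgB.
  rewrite normrM ler_wpM2r// /bump_at; have /andP[h1 h2] := e01 (r^-1 * x + - (r^-1 * c)).
  by rewrite ger0_norm ?mulr_ge0 ?invr_ge0 ?(ltW r0)// ler_wpM2l// invr_ge0 ltW.
rewrite intZ; last by apply: intgN; exact: intgB.
have rM : 0 <= r^-1 * M by rewrite mulr_ge0// invr_ge0 ltW.
apply: le_trans (ler_wpM2l rM he) _.
by rewrite le_eqVlt; apply/orP; left; apply/eqP; field; rewrite gt_eqF.
Qed.

Lemma plateau01 s t r x : 0 < r -> r <= t - s -> 0 <= plateau s t r x <= 1.
Proof.
move=> r0 rs; rewrite /plateau; have /andP[h1 h2] : 0 <= step_at s r x <= 1 by exact: H01.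
have /andP[h3 h4] : 0 <= step_at t r x <= 1 by exact: H01.
have [xs|xs] := leP x t; first by rewrite (step_at0 r0 xs) subr0 h1.
rewrite (@step_at1 s r x r0) ?subr_ge0 ?h4 ?gerBl//.
by apply: le_trans (ltW xs); rewrite -lerBrDl.
Qed.

Lemma plateau_int h s t b r e : 0 < r -> r <= t - s -> t + r <= b -> intg s b h ->
  int s (s + r) (fun x => `|h x|) <= e -> int t (t + r) (fun x => `|h x|) <= e ->
  `|int s b (fun x => h x * plateau s t r x) - int s t h| <= e + e.
Proof.
move=> r0 rs rb ih h1 h2; have r0' := ltW r0.
have st : s <= t by rewrite -subr_ge0 (le_trans r0').
have tr : t <= t + r by rewrite lerDl.
have tb := le_trans tr rb.
have sr : s + r <= t by rewrite -lerBrDl.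
have ssr : s <= s + r by rewrite lerDl.
have cpl : continuous (plateau s t r) by apply: smooth_cont; exact: plateau_Sm.
have ihp : intg s b (fun x => h x * plateau s t r x).
  have := intgM_cont cpl ih; rewrite /intg; congr (integrable _ _ _).
  by apply/funext => x /=; rewrite mulrC.
have ihst : intg s t h by exact: intgS ih.
have ihpst : intg s t (fun x => h x * plateau s t r x) by exact: intgS ihp.
rewrite (int_split ihp st tb) addrAC; apply: le_trans (ler_normD _ _) _; apply: lerD.
  have ihd : intg s t (fun x => h x * plateau s t r x - h x) by exact: intgB.
  rewrite -intB//; apply: le_trans (le_norm_int ihd) _.
  rewrite (@int_supp_itv _ s (s + r) _ _ (lexx s) sr); last first.
    move=> x /andP[sx xt] hx; rewrite /plateau (step_at0 r0 xt) step_at1 ?subr0 ?mulr1 ?subrr ?normr0//.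
    by rewrite leNgt; apply/negP => xr; apply: hx; rewrite sx ltW.
  apply: le_trans h1; apply: le_int => [||x _].
  - by apply: intgN; exact: intgS ihd.
  - by apply: intgN; exact: intgS ihst.
  have /andP[p0 p1] := plateau01 x r0 rs.
  have -> : h x * plateau s t r x - h x = h x * (plateau s t r x - 1) by ring.
  by rewrite normrM ler_piMr// ler0_norm ?subr_le0// opprB lerBlDr lerDl.
have ihptb : intg t b (fun x => h x * plateau s t r x) by exact: intgS ihp.
apply: le_trans (le_norm_int ihptb) _.
rewrite (@int_supp_itv _ t (t + r) _ _ (lexx t) rb); last first.
  move=> x /andP[tx xb] hx; rewrite plateau0 ?mulr0 ?normr0// => /andP[_ h3].
  by apply: hx; rewrite tx.
apply: le_trans h2; apply: le_int => [||x _].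
- by apply: intgN; exact: intgS ihptb.
- by apply: intgN; apply: intgS ih.
have /andP[p0 p1] := plateau01 x r0 rs.
by rewrite normrM ler_piMr// ger0_norm.
Qed.

(** Testing with a plateau: its derivative averages [g] near [s] and near [t], with opposite signs,
    while the plateau itself converges to the indicator of [[s, t]]. The point [b > t] leaves room
    for the right ramp. *)
Lemma weak_increment_aux D g h s t b : is_weak_derivative D g h -> `[s, b] `<=` D ->
  s < t -> t < b -> right_pt g s -> right_pt g t -> g t - g s = int s t h.
Proof.
move=> [lg lh wk] sbD st tb ps pt.
have ig := locint_intg lg sbD; have ih := locint_intg lh sbD.
apply/eqP; rewrite -subr_eq0 -normr_le0; apply/ler_addgt0Pr => e e0; rewrite add0r.
have M20 : 0 < 2 * M + 2 by rewrite ltr_wpDl// mulr_ge0.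
pose e1 := e / (2 * M + 2).
have e10 : 0 < e1 by rewrite divr_gt0.
have eE : M * e1 + M * e1 + (e1 + e1) = e by rewrite /e1; field; rewrite gt_eqF.
have [p1 p10 hp1] := ps _ e10; have [p2 p20 hp2] := pt _ e10.
have [d d0 hd] := int_abs_small ih e10.
pose m := Num.min (Num.min p1 p2) (Num.min d (Num.min (b - t) (t - s))).
have m0 : 0 < m by rewrite !lt_min p10 p20 d0 !subr_gt0 tb st.
pose r := m / 2; have r0 : 0 < r by rewrite divr_gt0.
have : r < m by rewrite /r ltr_pdivrMr// ltr_pMr// ltr1n.
rewrite !lt_min => /andP[/andP[rp1 rp2] /and3P[rd rb rs]].
have {}st := ltW st; have {}tb := ltW tb.
have trb : t + r <= b by rewrite -lerBrDl ltW.
have srt : s + r <= t by rewrite -lerBrDl ltW.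
have srb := le_trans srt tb.
have tr : t <= t + r by rewrite lerDl ltW.
have sr : s <= s + r by rewrite lerDl ltW.
have sub : `[s, t + r] `<=` D by apply: subset_trans sbD; apply: subset_itv; rewrite bnd_simp.
have := wk _ (plateau_test r0 st sub).
have part c : s <= c -> c + r <= b -> int s b (fun x => g x * bump_at c r x) =
    int c (c + r) (fun x => g x * bump_at c r x).
  move=> sc cb; apply: int_supp_itv => // x _ /(bump_at0 r0) ->; exact: mulr0.
have igb c : intg s b (fun x => g x * bump_at c r x).
  have := intgM_cont (@bump_cont c r) ig; rewrite /intg; congr (integrable _ _ _).
  by apply/funext => x /=; rewrite mulrC.
rewrite (@int_supp D _ s b sbD); last first.
  move=> x _ xsb; rewrite plateau_der !bump_at0// ?subrr ?mulr0//.
    by move=> /andP[h1 h2]; apply: xsb; rewrite (le_trans st)//= (le_trans h2).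
  by move=> /andP[h1 h2]; apply: xsb; rewrite h1 (le_trans h2).
rewrite (@eq_int _ _ _ _ (fun x => g x * bump_at s r x - g x * bump_at t r x)); last first.
  by move=> x _; rewrite plateau_der mulrBr.
rewrite intB// !part// (@int_supp D _ s b sbD); last first.
  move=> x _ xsb; rewrite plateau0 ?mulr0// => /andP[h1 h2]; apply: xsb.
  by rewrite h1 (le_trans h2).
have ig1 : intg s (s + r) g by exact: intgS ig.
have ig2 : intg t (t + r) g by exact: intgS ig.
have a1 := bump_avg r0 ig1 (hp1 r r0 rp1).
have a2 := bump_avg r0 ig2 (hp2 r r0 rp2).
have d1 : int s (s + r) (fun x => `|h x|) <= e1.
  by apply/ltW/hd; rewrite ?lexx// addrAC subrr add0r.
have d2 : int t (t + r) (fun x => `|h x|) <= e1.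
  by apply/ltW/hd; rewrite ?lexx// addrAC subrr add0r.
have b1 := plateau_int r0 (ltW rs) trb ih d1 d2.
move: a1 a2 b1; rewrite -eE.
move: (int s (s + r) _) (int t (t + r) _) (int s b _) (int s t h) => A A' P Q a1 a2 b1 E.
have -> : g t - g s - Q = (A - g s) - (A' - g t) + (P - Q).
  by rewrite -[P]opprK -E; ring.
apply: le_trans (ler_normD _ _) _; apply: lerD => //.
by apply: le_trans (ler_normB _ _) _; exact: lerD.
Qed.
End increment.

Lemma weak_increment D g h s t b : is_weak_derivative D g h -> `[s, b] `<=` D ->
  s < t -> t < b -> right_pt g s -> right_pt g t -> g t - g s = int s t h.
Proof.
have [H [eta [M [SH Se dH [e01 ez] [H0 H1 H01]]]]] := @smooth_step_exists R.
exact: (weak_increment_aux SH Se dH e01 ez H0 H1 H01).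
Qed.
End weak_derivative.

Section weak_primitive.
Context {R : realType}.
Local Notation mu := (@lebesgue_measure R).
Implicit Types (f g h k phi : R -> R) (D : set R).

Lemma locint_intgT f a b : locally_integrable setT f -> intg a b f.
Proof. by move=> /locint_intg; apply. Qed.

Lemma lebesgue_right_pt f s : locally_integrable setT f -> lebesgue_pt f s -> right_pt f s.
Proof.
move=> lf ls e e0.
(* Half of [e], because the averages are over balls of length [2 r] while [right_pt] normalises by
   [r]. *)
have e2 : (0%E < (e / 2)%:E :> \bar R)%E by rewrite lte_fin divr_gt0.
have : \forall r \near 0^'+, (davg f s r < (e / 2)%:E)%E.
  by move: ls => /fine_cvgP[h1 h2]; near=> r; rewrite -[davg _ _ _]fineK; [
    rewrite lte_fin; near: r; exact: (cvgr_lt _ h2 _ (divr_gt0 e0 _))|near: r; exact: h1].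
move=> [p /= p0 hp]; exists p => // r r0 rp.
have {hp} : (davg f s r < (e / 2)%:E)%E.
  by apply: hp => //=; rewrite sub0r normrN gtr0_norm.
rewrite /davg /iavg lebesgue_measure_ball ?(ltW r0)// => h.
have i1 : intg (s - r) (s + r) (fun x => `|f x - f s|).
  by apply: intgN; apply: intgB; [exact: locint_intgT|apply: intg_cont => ?; exact: cvg_cst].
have le : int (s - r) (s + r) (fun x => `|f x - f s|) <= e * r.
  rewrite /int /Rintegral.
  have -> : (\int[mu]_(x in `[(s - r)%R, (s + r)%R]) (`|f x - f s|)%:E =
    \int[mu]_(y in ball s r) `|((center (f s) \o f) y)%:E|)%E.
    rewrite ball_itv [RHS](_ : _ = \int[mu]_(y in `](s - r)%R, (s + r)%R[) (`|f y - f s|)%:E)%E; last first.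
      by apply: eq_integral => x _; rewrite /= /shift.
    rewrite integral_itv_bndoo//; apply: measurable_funS (measurable_int mu i1) => //.
    by apply: subset_itv; rewrite bnd_simp.
  move: h; set J := (\int[mu]_(y in _) _)%E => h.
  have J0 : (0 <= J)%E by exact: integral_ge0.
  have r2 : 0 < r *+ 2 by rewrite mulrn_wgt0.
  move: h J0; case: J => [j| |] //=; rewrite ?lee_fin inver (gt_eqF r2) => + J0; last first.
    by rewrite gt0_muley// lte_fin invr_gt0.
  rewrite -EFinM lte_fin ltr_pdivrMl// => /ltW h.
  by apply: le_trans h _; rewrite -mulr_natr le_eqVlt; apply/orP; left; apply/eqP; field.
apply: le_trans le; rewrite (int_split i1 (_ : s - r <= s) (_ : s <= s + r)).
- by rewrite lerDr; apply: int_ge0.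
- by rewrite lerBlDr lerDl ltW.
- by rewrite lerDl ltW.
Unshelve. all: by end_near. Qed.

Lemma ae_right_pt f : locally_integrable setT f -> {ae mu, forall x, right_pt f x}.
Proof.
by move=> lf; apply: aeS (lebesgue_differentiation lf) => x; exact: lebesgue_right_pt.
Qed.

Lemma cont_eps f (x e : R) : {for x, continuous f} -> 0 < e -> exists2 d, 0 < d &
  forall y, `|y - x| < d -> `|f y - f x| < e.
Proof.
move=> cf e0; have /cvgrPdist_lt/(_ _ e0)[d /= d0 hd] : f y @[y --> x] --> f x := cf.
by exists d => // y yx; rewrite distrC; apply: hd; rewrite /= distrC.
Qed.

Lemma eps_cont f (x : R) : (forall e, 0 < e -> exists2 d, 0 < d &
  forall y, `|y - x| < d -> `|f y - f x| <= e) -> {for x, continuous f}.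
Proof.
move=> h; apply/cvgrPdist_le => e e0; have [d d0 hd] := h _ e0.
by exists d => // y /= yx; rewrite distrC; apply: hd; rewrite distrC.
Qed.

Lemma continuous_right_pt f s b : s < b -> intg s b f -> {for s, continuous f} -> right_pt f s.
Proof.
move=> sb i0 cf e e0; have [d d0 hd] := cont_eps cf e0.
exists (Num.min d (b - s)); first by rewrite lt_min d0 subr_gt0.
move=> r r0; rewrite lt_min => /andP[rd rb].
have -> : e * r = int s (s + r) (fun=> e) by rewrite int_cst ?lerDl ?(ltW r0)//; ring.
have cc (c : R) : intg s (s + r) (fun=> c) by apply: intg_cont => ?; exact: cvg_cst.
apply: le_int => // [|x /andP[sx xr]].
  by apply: intgN; apply: intgB => //; apply: intgS i0 => //; lra.
by apply/ltW/hd; rewrite ger0_norm; lra.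
Qed.

Lemma negligible_itv (N : set R) a b : a < b -> mu.-negligible N ->
  exists2 x, a < x < b & ~ N x.
Proof.
move=> ab [A [mA A0 NA]]; apply: contrapT => h.
have : (mu `]a, b[%classic <= mu A)%E.
  apply: le_measure; rewrite ?inE// => x /=; rewrite in_itv/= => xab.
  by apply: NA; apply: contrapT => Nx; apply: h; exists x.
have -> : mu A = 0%E := A0.
have -> : mu `]a, b[%classic = (b - a)%:E.
  by rewrite lebesgue_measure_itv/= lte_fin ab EFinB.
by rewrite lee_fin leNgt subr_gt0 ab.
Qed.

Lemma ae_itv (P : R -> Prop) a b : a < b -> {ae mu, forall x, P x} ->
  exists2 x, a < x < b & P x.
Proof.
by move=> ab /(negligible_itv ab)[x xab /contrapT Px]; exists x.
Qed.

Lemma ae_eq_continuous f g : continuous f -> continuous g -> {ae mu, forall x, f x = g x} ->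
  f = g.
Proof.
move=> cf cg fg; apply/funext => x; apply/eqP; rewrite -subr_eq0 -normr_le0.
apply/ler_addgt0Pr => e e0; rewrite add0r leNgt; apply/negP => h.
have e2 : 0 < e / 2 by lra.
have [d1 d10 h1] := cont_eps (cf x) e2; have [d2 d20 h2] := cont_eps (cg x) e2.
have dm : 0 < Num.min d1 d2 by rewrite lt_min d10.
have [|y /andP[y1 y2] E] := @ae_itv _ x (x + Num.min d1 d2) _ fg; first by rewrite ltrDl.
have : `|y - x| < Num.min d1 d2 by rewrite ger0_norm; lra.
rewrite lt_min => /andP[/h1 + /h2]; rewrite E => {}h1 {}h2.
have := ler_distD (g y) (f x) (g x); rewrite (distrC (f x) (g y)) => h3.
by move: h h1 h2 h3; lra.
Qed.

Lemma int_primitive h (a c : R) : (forall x y, intg x y h) -> exists G : R -> R, [/\ continuous G, G a = c &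
  forall x y, x <= y -> G y - G x = int x y h].
Proof.
move=> ih; pose G x := c + (if a <= x then int a x h else - int x a h).
have inc x y : x <= y -> G y - G x = int x y h.
  move=> xy; rewrite /G; have [ax|xa] := leP a x.
    by rewrite (le_trans ax xy) (int_split (ih a y) ax xy); ring.
  have [ay|ya] := leP a y; first by rewrite (int_split (ih x y) (ltW xa) ay); ring.
  by rewrite (int_split (ih x a) xy (ltW ya)); ring.
exists G; split => //; last by rewrite /G lexx int_set1 addr0.
move=> x; apply: eps_cont => e e0.
have [d d0 hd] := int_abs_small (ih (x - 1) (x + 1)) e0.
exists (Num.min d 1) => [|y]; first by rewrite lt_min d0 ltr01.
rewrite lt_min => /andP[yd]; rewrite ltr_norml => /andP[y1 y2].
move: yd; have [xy|/ltW yx] := leP x y.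
  rewrite ger0_norm ?subr_ge0// inc// => yd; apply: le_trans (le_norm_int (ih _ _)) _.
  by apply/ltW/hd; lra.
rewrite ler0_norm ?subr_le0// opprB distrC inc// => yd; apply: le_trans (le_norm_int (ih _ _)) _.
by apply/ltW/hd; lra.
Qed.

(** The primitive of [h] is anchored at one Lebesgue point of [g]; by [weak_increment] it then
    agrees with [g] at every other one. *)
Lemma ac_rep g h : is_weak_derivative setT g h -> exists G, [/\ continuous G,
  {ae mu, forall x, g x = G x} & forall a b, a <= b -> G b - G a = int a b h].
Proof.
move=> wk; have [lg lh _] := wk.
have [x0 _ p0] := ae_itv (ltr01 : (0 : R) < 1) (ae_right_pt lg).
have [G [cG G0 Gi]] := int_primitive x0 (g x0) (fun x y => locint_intgT x y lh).
exists G; split => //; apply: aeS (ae_right_pt lg) => x px.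
have inc s t : s < t -> right_pt g s -> right_pt g t -> g t - g s = G t - G s.
  move=> st ps pt; have tt : t < t + 1 by rewrite ltrDl.
  by rewrite (weak_increment wk (@subsetT _ _) st tt ps pt) Gi// ltW.
have [xx|xx|->//] := ltgtP x x0.
  by have := inc _ _ xx px p0; rewrite G0; lra.
by have := inc _ _ xx p0 px; rewrite G0; lra.
Qed.

Lemma ae0_int0 k : locally_integrable setT k -> (forall a b, a <= b -> int a b k = 0) ->
  {ae mu, forall x, k x = 0}.
Proof.
move=> lk k0; apply: aeS (ae_right_pt lk) => x px.
apply/eqP; rewrite -normr_le0; apply/ler_addgt0Pr => e e0; rewrite add0r.
have [p p0 hp] := px _ e0; have p20 : 0 < p / 2 by lra.
have := hp _ p20 (_ : p / 2 < p).
have ik := locint_intgT x (x + p / 2) lk.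
have ic : intg x (x + p / 2) (fun=> k x) by apply: intg_cont => ?; exact: cvg_cst.
have := le_norm_int (intgB ik ic); rewrite intB// k0 ?lerDl ?(ltW p20)// int_cst ?lerDl ?(ltW p20)//.
rewrite sub0r normrN addrAC subrr add0r normrM (gtr0_norm p20) => h1 h2.
have := le_trans h1 (h2 _); rewrite ler_pM2r//; apply; lra.
Qed.

Lemma locintB D f g : locally_integrable D f -> locally_integrable D g ->
  locally_integrable D (fun x => f x - g x).
Proof.
move=> lf [mg oD ig]; apply: locally_integrableB => //.
Qed.

End weak_primitive.

(** * Density of test functions among continuous square-integrable functions *)

Section density.
Context {R : realType}.
Local Notation mu := (@lebesgue_measure R).
Implicit Types (f g h z phi : R -> R).

(** Only the first point is confined to the segment; the second may leave it. *)
Lemma unif_cont_seg z a b e : continuous z -> 0 < e -> exists2 d, 0 < d &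
  forall x y, a <= x <= b -> `|y - x| < d -> `|z y - z x| <= e.
Proof.
move=> cz e0; have := @segment_compact R a b.
move/compact_near_coveringP => /(_ R (0 : R)^'+
  (fun d x => forall y, `|y - x| < d -> `|z y - z x| <= e) _)[].
  move=> x _; have [d d0 hd] := cont_eps (cz x) (divr_gt0 e0 (ltr0n _ 2)).
  have d2 : 0 < d / 2 by lra.
  exists (ball x (d / 2), [set r | 0 < r < d / 2]) => /=.
    split; first exact: nbhsx_ballx.
    by exists (d / 2) => //= r; rewrite /= sub0r normrN => /ltr_normlW r1 r0; rewrite r0.
  move=> [y r] /= [xy /andP[r0 rd]] t ty.
  have h1 : `|z y - z x| < e / 2 by apply: hd; rewrite distrC; apply: lt_trans xy _; lra.
  have h2 : `|z t - z x| < e / 2.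
    have yx : `|y - x| < d / 2 by rewrite distrC.
    by apply: hd; apply: le_lt_trans (ler_distD y t x) _; lra.
  by have := ler_distD (z x) (z t) (z y); rewrite (distrC (z x)); lra.
move=> d /= d0 hd; exists (d / 2) => [|x y xab]; first lra.
by apply: (hd (d / 2)); rewrite /= ?sub0r ?normrN ?gtr0_norm ?in_itv//=; lra.
Qed.

Section plateaus.
Context (H eta : R -> R) (M : R) (SH : smooth_class H) (Se : smooth_class eta)
  (H0 : forall x, x <= 0 -> H x = 0) (H1 : forall x, 1 <= x -> H x = 1)
  (H01 : forall x, 0 <= H x <= 1).

(** Consecutive plateaus of length [r] telescope to one long plateau, hence form a partition of
    unity on its flat part; the sum averages samples of [z] taken within [2 r] of [x]. *)
Definition plateau_sum z (s r : R) (m : nat) (x : R) : R :=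
  \sum_(k < m) z (s + k%:R * r) * plateau H (s + k%:R * r) (s + k%:R * r + r) r x.

Lemma plateau_sum_Sm z s r m : smooth_class (plateau_sum z s r m).
Proof.
elim: m => [|m IH].
  by rewrite (_ : plateau_sum _ _ _ _ = fun=> 0); [exact: smooth_cst|apply/funext => x; exact: big_ord0].
have h := smooth_add IH (smooth_mul (smooth_cst (z (s + m%:R * r)))
  (plateau_Sm SH (s + m%:R * r) (s + m%:R * r + r) r)).
by congr smooth_class : h; apply/funext => x; rewrite /plateau_sum big_ord_recr.
Qed.

Lemma plateau_telescope s r m x :
  \sum_(k < m) plateau H (s + k%:R * r) (s + k%:R * r + r) r x = plateau H s (s + m%:R * r) r x.
Proof.
elim: m => [|m IH]; first by rewrite big_ord0 mul0r addr0 /plateau subrr.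
rewrite big_ord_recr/= IH /plateau -natr1.
by rewrite (_ : s + (m%:R + 1) * r = s + m%:R * r + r); ring.
Qed.

Lemma plateau_ge0 s r x : 0 < r -> 0 <= plateau H s (s + r) r x.
Proof.
move=> r0; rewrite /plateau; have /andP[h1 h2] : 0 <= step_at H s r x <= 1 by exact: H01.
have /andP[h3 h4] : 0 <= step_at H (s + r) r x <= 1 by exact: H01.
have [xs|xs] := leP x (s + r); first by rewrite (step_at0 H0 r0 xs) subr0 h1.
by rewrite (step_at1 H1 r0 (ltW xs)) subr_ge0 h4.
Qed.

Lemma plateau_sum_near z s r m x e d : 0 < r -> 2 * r < d ->
  (forall x y, s <= x <= s + m%:R * r -> `|y - x| < d -> `|z y - z x| <= e) ->
  `|plateau_sum z s r m x - z x * plateau H s (s + m%:R * r) r x| <=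
  e * plateau H s (s + m%:R * r) r x.
Proof.
move=> r0 rd hz; rewrite -plateau_telescope !mulr_sumr -sumrB.
apply: le_trans (ler_norm_sum _ _ _) _; apply: ler_sum => k _.
rewrite -mulrBl normrM (ger0_norm (plateau_ge0 _ _ r0)).
set c := s + k%:R * r; have [ck|ck] := boolP (c <= x <= c + r + r); last first.
  by rewrite (plateau0 H0 H1 r0 (_ : c <= c + r)) ?mulr0// ?lerDl ?(ltW r0)//; exact/negP.
apply: ler_wpM2r; first exact: plateau_ge0.
rewrite distrC; apply: hz; last by move: ck => /andP[? ?]; rewrite ger0_norm; lra.
rewrite /c lerDl mulr_ge0 ?(ltW r0)//= lerD2l ler_wpM2r ?(ltW r0)// ler_nat.
by rewrite ltnW.
Qed.

End plateaus.

Lemma L2_test_dense z e : continuous z -> L2f z -> 0 < e -> exists phi,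
  [/\ test_function setT phi, L2f phi & I (fun x => (phi x - z x) ^+ 2) <= e].
Proof.
move=> cz Lz e0.
have [H [eta [M [SH Se dH [e01 ez] [H0 H1 H01]]]]] := @smooth_step_exists R.
have e4 : 0 < e / 4 by lra.
have /cvgrPdist_le/(_ _ e4)[n _ /(_ n (leqnn n))] :=
  int_lim Lz.2 (fun n => lexx (- n%:R)) (fun n => lexx n%:R).
set J := int (- n%:R) n%:R _ => hJ.
have {hJ} hJ : I (fun x => z x ^+ 2) - J <= e / 4 by exact: ler_normlW.
(* The extra unit accommodates the left ramp, whose length [r] is below 1, so that the long plateau
   equals 1 on all of [[-n, n]]. *)
pose N : R := n%:R + 1; have N1 : 1 <= N by rewrite lerDr.
(* The squared uniform error: the support has length [2 N + 1], so sampling costs [e / 4] in total.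
   The truncated tail costs another [e / 4], and the square of the sum doubles both. *)
pose dl2 := e / (4 * (2 * N + 1)).
have dl20 : 0 < dl2 by rewrite divr_gt0//; lra.
pose dl := Num.sqrt dl2; have dl0 : 0 < dl by rewrite sqrtr_gt0.
have [d d0 hd] := unif_cont_seg (- N) N cz dl0.
(* One choice for two requirements on the spacing [r = 2 N / m]: [r < 1] for the ramps and [2 r < d]
   for the uniform continuity. *)
pose m := (Num.trunc (2 * N * (2 / d + 1))).+1.
have mg : 2 * N * (2 / d + 1) < m%:R by exact: truncnS_gt.
have dd : 0 < 2 / d by rewrite divr_gt0.
have m0 : 0 < m%:R :> R by rewrite ltr0n.
pose r := 2 * N / m%:R; have r0 : 0 < r by rewrite divr_gt0//; lra.
have mr : m%:R * r = 2 * N by rewrite /r; field; rewrite gt_eqF.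
have r1 : r < 1.
  rewrite /r ltr_pdivrMr// mul1r; apply: le_lt_trans mg.
  by rewrite ler_peMr//; lra.
have rd : 2 * r < d.
  rewrite /r mulrA ltr_pdivrMr// -ltr_pdivrMl//; apply: le_lt_trans mg.
  by rewrite (_ : d^-1 * _ = 2 * N * (2 / d)); [apply: ler_wpM2l; lra|ring].
have sE : - N + m%:R * r = N by rewrite mr; ring.
pose phi := plateau_sum H z (- N) r m.
have hn x : `|phi x - z x * plateau H (- N) N r x| <= dl * plateau H (- N) N r x.
  have := @plateau_sum_near H H0 H1 H01 z (- N) r m x dl d r0 rd; rewrite sE; apply.
  exact: hd.
have NN : - N <= N by lra.
have Pz x : ~ (- N <= x <= N + 1) -> plateau H (- N) N r x = 0.
  move=> h; apply: (plateau0 H0 H1) => //; move=> /andP[h1 h2]; apply: h.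
  by rewrite h1/=; lra.
have Pge x : 0 <= plateau H (- N) N r x <= 1.
  have h0 : 0 <= plateau H (- N) N r x.
    by have := plateau_telescope H (- N) r m x; rewrite sE => <-; apply: sumr_ge0 => k _; exact: plateau_ge0.
  have /andP[h1 h2] : 0 <= step_at H (- N) r x <= 1 by exact: H01.
  have /andP[h3 h4] : 0 <= step_at H N r x <= 1 by exact: H01.
  by rewrite h0 /plateau; lra.
have phi0 x : ~ (- N <= x <= N + 1) -> phi x = 0.
  move=> h; have := hn x; rewrite Pz// !mulr0 subr0 => h1.
  by apply/eqP; rewrite -normr_le0.
have Sphi : smooth_class phi by exact: plateau_sum_Sm.
have P1 x : - n%:R <= x <= n%:R -> plateau H (- N) N r x = 1.
  move=> /andP[h1 h2]; rewrite /plateau (step_at1 H1 r0) ?(step_at0 H0 r0) ?subr0//.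
    by apply: le_trans h2 _; rewrite lerDl.
  by rewrite /N; lra.
pose B := fun x => 2 * (\1_(`[- N, N + 1]%classic : set R) x * dl2) +
  2 * (z x ^+ 2 - ((fun x => z x ^+ 2) \_ `[- n%:R, n%:R]) x).
have i1 : itg (fun x => \1_(`[- N, N + 1]%classic : set R) x * dl2).
  rewrite /itg (_ : EFin \o _ = EFin \o (fun x => dl2 * \1_(`[- N, N + 1]%classic : set R) x)); last first.
    by apply/funext => x /=; rewrite mulrC.
  apply: itgZ; apply: integrable_indic_itv.
have i2 : itg ((fun x => z x ^+ 2) \_ `[- n%:R, n%:R]).
  rewrite /itg -restrict_EFin; apply/integrable_restrict => //=; rewrite setTI.
  exact: (@itg_intg R (- n%:R) n%:R (fun x => z x ^+ 2) Lz.2).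
have i3 : itg (fun x => z x ^+ 2 - ((fun x => z x ^+ 2) \_ `[- n%:R, n%:R]) x).
  exact: itgB Lz.2 i2.
have iB : itg B by apply: itgD; exact: itgZ.
have phiB x : `|(phi x - z x) ^+ 2| <= B x.
  rewrite ger0_norm ?sqr_ge0// /B.
  have /andP[p0 p1] := Pge x; have h := hn x.
  set P := plateau _ _ _ _ _ in p0 p1 h *.
  have dE : dl ^+ 2 = dl2 by rewrite sqr_sqrtr// ltW.
  have s1 : (phi x - z x * P) ^+ 2 <= \1_(`[- N, N + 1]%classic : set R) x * dl2.
    rewrite indicE; have [xN|xN] := boolP (x \in _); last first.
      rewrite /P Pz ?phi0 ?mulr0 ?subr0 ?expr0n/= ?mul0r//;
        by move: xN; rewrite notin_setE /= in_itv.
    rewrite mul1r -dE -(real_normK (num_real (phi x - _))) ler_sqr ?nnegrE ?(ltW dl0)//.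
    by apply: le_trans h _; rewrite ler_piMr// ltW.
  have s2 : (z x * P - z x) ^+ 2 <= z x ^+ 2 - ((fun x => z x ^+ 2) \_ `[- n%:R, n%:R]) x.
    rewrite patchE; case: ifPn => [|_].
      by rewrite inE/= in_itv/= => /P1; rewrite -/P => ->; rewrite mulr1 !subrr expr0n.
    rewrite subr0 (_ : (z x * P - z x) ^+ 2 = z x ^+ 2 * (1 - P) ^+ 2); last by ring.
    by rewrite ler_piMr ?sqr_ge0// expr_le1//; lra.
  have := sqr_ge0 ((phi x - z x * P) - (z x * P - z x)); nra.
have mphi : measurable_fun setT phi by apply: continuous_measurable_fun; exact: smooth_cont.
have md : measurable_fun setT (fun x => phi x - z x) by apply: measurable_funB => //; exact: Lz.1.
have id : itg (fun x => (phi x - z x) ^+ 2) by apply: (itg_le _ iB) => //; exact: measurable_funX.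
exists phi; split.
- split; first exact: smooth_Cdiff.
  exists `[- N, N + 1]%classic; split => //; exact: segment_compact.
- rewrite (_ : phi = fun x => (phi x - z x) + z x); first exact: (L2fD (conj md id) Lz).
  by apply/funext => x; rewrite subrK.
apply: le_trans (I_le id iB _) _ => [x|]; first by apply: le_trans (phiB x); exact: ler_norm.
rewrite ID ?IZ ?IB//; [|exact: Lz.2|exact: itgZ..].
have -> : I (fun x => \1_(`[- N, N + 1]%classic : set R) x * dl2) = dl2 * (2 * N + 1).
  rewrite (_ : (fun x => _) = (fun=> dl2) \_ `[- N, N + 1]); last first.
    by apply/funext => x; rewrite patchE indicE; case: ifP => _; rewrite ?mul1r ?mul0r.
  by rewrite /I -Rintegral_mkcond -/(int _ _ _) int_cst; [ring|lra].
have -> : I ((fun x => z x ^+ 2) \_ `[- n%:R, n%:R]) = J by rewrite /I -Rintegral_mkcond.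
have -> : dl2 * (2 * N + 1) = e / 4 by rewrite /dl2; field; rewrite gt_eqF//; lra.
lra.
Qed.
End density.

(** * Left state and shock profile *)
Section autonomous.
Context {R : realType}.
Implicit Types (X S : R -> R).

Lemma der_IVT (f f1 : R -> R) (a b v : R) : a <= b -> (forall x : R, is_derive x 1 f (f1 x)) ->
  f a <= v <= f b -> exists2 c, a <= c <= b & f c = v.
Proof.
move=> ab df /andP[h1 h2].
have [||c hc e] := @IVT R f a b v ab.
- by apply: continuous_subspaceT => x; exact: der_cont (df x).
- by rewrite ge_min h1 le_max h2 orbT.
- by exists c => //; move: hc; rewrite in_itv.
Qed.

(** [d^2 exp(- 2 L x)] is nonincreasing to the right of 0 and [d^2 exp(2 L x)] is nondecreasing to
    its left; both vanish at 0 and are nonnegative. *)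
Lemma gronwall0 (d d1 : R -> R) (L : R) : (forall x : R, is_derive x 1 d (d1 x)) -> d 0 = 0 ->
  forall n : R, (forall x, `|x| <= n -> `|d1 x| <= L * `|d x|) ->
  forall x, `|x| <= n -> d x = 0.
Proof.
move=> dd d0 n hL x xn; apply/eqP; rewrite -sqrf_eq0.
have E c (y : R) : is_derive y 1 (fun y => expR (c * y)) (c * expR (c * y)).
  have dl : is_derive y 1 (fun y => c * y) c.
    by apply: derE (derM (derC c y) (derI y)) _; ring.
  by apply: derE (derComp dl (is_derive_expR (c * y))) _; rewrite mulrC.
have key (c y : R) : is_derive y 1 (fun y => d y ^+ 2 * expR (c * y))
    ((2 * d y * d1 y + c * d y ^+ 2) * expR (c * y)).
  by apply: derE (derM (derX 2 (dd y)) (E c y)) _; rewrite /=; ring.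
have b y : `|y| <= n -> `|2 * d y * d1 y| <= 2 * L * d y ^+ 2.
  move=> /hL h; rewrite -mulrA normrM ger0_norm// -mulrA ler_wpM2l// normrM.
  by rewrite -(real_normK (num_real (d y))) mulrC expr2 mulrA ler_wpM2r.
have [x0|/ltW x0] := leP 0 x.
  have := @der_ge0_nondecreasing R (fun y => - (d y ^+ 2 * expR (- (2 * L) * y)))
    (fun y => - ((2 * d y * d1 y + - (2 * L) * d y ^+ 2) * expR (- (2 * L) * y))) 0 x x0.
  rewrite d0 expr0n/= mul0r oppr0 => h.
  have : 0 <= - (d x ^+ 2 * expR (- (2 * L) * x)).
    apply: (h (fun y _ => derN (key (- (2 * L)) y))) => y /andP[y0 yx].
    rewrite -mulNr mulr_ge0 ?expR_ge0//.
    have yn : `|y| <= n by move: xn; rewrite !ger0_norm ?(le_trans y0)//; exact: le_trans.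
    by have := b _ yn; rewrite ler_norml => /andP[_]; lra.
  rewrite oppr_ge0 => h1; rewrite eq_le sqr_ge0 andbT.
  by rewrite -(pmulr_rle0 _ (expR_gt0 (- (2 * L) * x))) mulrC.
have := @der_ge0_nondecreasing R (fun y => d y ^+ 2 * expR (2 * L * y))
  (fun y => (2 * d y * d1 y + 2 * L * d y ^+ 2) * expR (2 * L * y)) x 0 x0.
rewrite d0 expr0n/= mul0r => h.
have h1 : d x ^+ 2 * expR (2 * L * x) <= 0.
  apply: (h (fun y _ => key (2 * L) y)) => y /andP[xy y0].
  rewrite mulr_ge0 ?expR_ge0//.
  have yn : `|y| <= n by move: xn; rewrite !ler0_norm ?(le_trans xy)// => ?; lra.
  by have := b _ yn; rewrite ler_norml => /andP[+ _]; lra.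
by rewrite eq_le sqr_ge0 andbT -(pmulr_rle0 _ (expR_gt0 (2 * L * x))) mulrC.
Qed.

Lemma autonomous_unique (X X1 S1 S2 : R -> R) : (forall x : R, is_derive x 1 X (X1 x)) -> continuous X1 ->
  (forall x : R, is_derive x 1 S1 (X (S1 x))) -> (forall x : R, is_derive x 1 S2 (X (S2 x))) ->
  S1 0 = S2 0 -> S1 = S2.
Proof.
move=> dX cX1 dS1 dS2 S0; apply/funext => x; apply/eqP; rewrite -subr_eq0; apply/eqP.
have [B1 B10 hB1] := cont_bounded (- `|x|) `|x| (fun y => der_cont (dS1 y)).
have [B2 B20 hB2] := cont_bounded (- `|x|) `|x| (fun y => der_cont (dS2 y)).
have [L L0 hL] := cont_bounded (- (B1 + B2)) (B1 + B2) cX1.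
apply: (@gronwall0 (fun y => S1 y - S2 y) (fun y => X (S1 y) - X (S2 y)) L _ _ `|x|) => //.
  by rewrite S0 subrr.
move=> y /=; rewrite ler_norml => yx.
have /andP[h1 h2] : - B2 <= S2 y <= B2 by rewrite -ler_norml hB2.
have /andP[h3 h4] : - B1 <= S1 y <= B1 by rewrite -ler_norml hB1.
have lip a b : a <= b -> - (B1 + B2) <= a -> b <= B1 + B2 -> `|X b - X a| <= L * `|b - a|.
  move=> ab ha hb; have [c /andP[c1 c2] ->] := mvt_seg ab (fun x _ => dX x).
  by rewrite normrM ler_wpM2r// hL//; apply/andP; split; lra.
have [s|/ltW s] := leP (S2 y) (S1 y); first by apply: lip => //; lra.
by rewrite distrC (distrC (S1 y)); apply: lip => //; lra.
Qed.

(** Solves [P' = 1 / q(P)] globally by quadrature: a primitive of [q] has slope at least [c], hence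
    is a bijection of the line, and [P] is its inverse. *)
Lemma cont_inverse_prim (q : R -> R) (c : R) : continuous q -> 0 < c -> (forall x, c <= q x) ->
  exists P : R -> R, [/\ P 0 = 0, (forall x y, x <= y -> P x <= P y),
    (forall x : R, is_derive x 1 P (q (P x))^-1), (forall M, exists N, forall x, N <= x -> M <= P x) &
    (forall M, exists N, forall x, x <= N -> P x <= M)].
Proof.
move=> cq c0 qc; have [Q0 dQ0 _] := primitive_exists cq.
pose Q x := Q0 x - Q0 0.
have dQ (x : R) : is_derive x 1 Q (q x) by apply: derE (derB (dQ0 x) (derC (Q0 0) x)) _; rewrite subr0.
have Q00 : Q 0 = 0 by rewrite /Q subrr.
have up x y : x <= y -> c * (y - x) <= Q y - Q x.
  move=> xy; have [z _ ->] := mvt_seg xy (fun z _ => dQ z).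
  by rewrite ler_wpM2r ?subr_ge0.
have inc x y : x < y -> Q x < Q y.
  by move=> xy; rewrite -subr_gt0; apply: lt_le_trans (up _ _ (ltW xy)); rewrite mulr_gt0// subr_gt0.
have onto v : exists x, Q x = v.
  pose b := `|v| / c; have b0 : 0 <= b by rewrite divr_ge0// ltW.
  have := @der_IVT Q q (- b) b v _ dQ.
  have cb : c * b = `|v| by rewrite /b; field; rewrite gt_eqF.
  have h1 : `|v| <= Q b by have := up 0 b b0; rewrite Q00 !subr0 cb.
  have h2 : Q (- b) <= - `|v|.
    have := up (- b) 0 _; rewrite Q00 sub0r opprK cb oppr_le0 => /(_ b0).
    by move=> h; lra.
  case; [lra| |by move=> x _ <-; exists x].
  by have := ler_norm v; have := ler_norm (- v); rewrite normrN; lra.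
have [P hP] := choice onto.
have PQ x : P (Q x) = x.
  by apply/eqP; rewrite eq_le !leNgt; apply/andP; split; apply/negP => /inc; rewrite hP ltxx.
have mono x y : x <= y -> P x <= P y.
  by move=> xy; rewrite leNgt; apply/negP => /inc; rewrite !hP ltNge xy.
exists P; split => //.
- by rewrite -Q00 PQ.
- move=> x; have qx : q (P x) != 0 by rewrite gt_eqF// (lt_le_trans c0).
  have := @is_derive_inverse R Q P (q (P x)) (P x); rewrite hP; apply => //.
  + by apply: (@filterE _ (nbhs (P x))) => y; exact: PQ.
  + by apply: (@filterE _ (nbhs (P x))) => y; exact: der_cont (dQ y).
- by move=> M; exists (Q M) => x /mono; rewrite PQ.
- by move=> M; exists (Q M) => x /mono; rewrite PQ.
Qed.

Definition heteroclinic X (a b : R) S := [/\ (forall x : R, is_derive x 1 S (X (S x))),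
  S x @[x --> -oo] --> a, S x @[x --> +oo] --> b & S 0 = (a + b) / 2].

(* The logistic substitution y makes the quadrature of dy / X(y) regular on the whole
   line: its density q is continuous and bounded away from 0. *)
Lemma heteroclinic_exists X (a b L : R) : a < b -> continuous X ->
  (forall y, a < y < b -> 0 < X y) -> (forall y, a < y < b -> X y <= L * (y - a)) ->
  (forall y, a < y < b -> X y <= L * (b - y)) ->
  exists2 S, heteroclinic X a b S & forall x, a < S x < b.
Proof.
move=> ab cX X0 Xa Xb.
pose s (z : R) := (expR z + 1)^-1.
have E0 z : 0 < expR z + 1 :> R by have := expR_gt0 z; lra.
have s0 z : 0 < s z by rewrite invr_gt0.
have s1 z : s z < 1 by rewrite invf_lt1//; have := expR_gt0 z; lra.
pose y z := b - (b - a) * s z.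
have yin z : a < y z < b.
  rewrite /y; have := s0 z; have := s1 z; move: (s z) => t t1 t0.
  by apply/andP; split; nra.
have ds (z : R) : is_derive z 1 s (- (s z * (1 - s z))).
  have h := @derV R (fun t => expR t + 1) z _ (lt0r_neq0 (E0 z)) (derD (is_derive_expR z) (derC 1 z)).
  by apply: derE h _; rewrite /s addr0; field; rewrite gt_eqF.
have dy (z : R) : is_derive z 1 y ((b - a) * (s z * (1 - s z))).
  by apply: derE (derB (derC b z) (derM (derC (b - a) z) (ds z))) _; ring.
have cs : continuous s by move=> z; exact: der_cont (ds z).
have cy : continuous y by move=> z; exact: der_cont (dy z).
pose q z := (b - a) * (s z * (1 - s z)) / X (y z).
have p0 z : 0 < (b - a) * (s z * (1 - s z)).
  by rewrite mulr_gt0 ?subr_gt0// mulr_gt0 ?subr_gt0.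
have L0 : 0 < L.
  have m : a < (a + b) / 2 < b by apply/andP; split; lra.
  have := lt_le_trans (X0 _ m) (Xa _ m); rewrite pmulr_lgt0//; lra.
(* The linear bounds at both ends give [X (y z) <= L (b - a) min(s, 1 - s)], and
   [min(s, 1 - s) <= 2 s (1 - s)]. *)
have qL z : (2 * L)^-1 <= q z.
  rewrite /q ler_pdivlMr ?X0// ler_pdivrMl ?mulr_gt0//.
  have h1 := Xa _ (yin z); have h2 := Xb _ (yin z).
  have e1 : y z - a = (b - a) * (1 - s z) by rewrite /y; ring.
  have e2 : b - y z = (b - a) * s z by rewrite /y; ring.
  rewrite e1 in h1; rewrite e2 in h2; move: h1 h2.
  have := s0 z; have := s1 z; move: (s z) (X (y z)) => t v t1 t0 h1 h2.
  have u0 : 0 < L * (b - a) by rewrite mulr_gt0// subr_gt0.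
  have [tt|tt] := leP t (1/2).
    apply: le_trans h2 _; rewrite (_ : L * ((b - a) * t) = L * (b - a) * t); last ring.
    rewrite (_ : 2 * L * _ = L * (b - a) * (2 * t * (1 - t))); last ring.
    by rewrite ler_pM2l//; nra.
  apply: le_trans h1 _; rewrite (_ : L * ((b - a) * (1 - t)) = L * (b - a) * (1 - t)); last ring.
  rewrite (_ : 2 * L * _ = L * (b - a) * (2 * t * (1 - t))); last ring.
  by rewrite ler_pM2l//; nra.
have cq : continuous q.
  move=> z; apply: cvgM.
    by apply: cvgM; [exact: cvg_cst|apply: cvgM; [exact: cs|apply: cvgB; [exact: cvg_cst|exact: cs]]].
  apply: cvgV; first by rewrite gt_eqF// X0.
  by apply: (@continuous_comp _ _ _ y X); [exact: cy|exact: cX].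
have L20 : 0 < (2 * L)^-1 by rewrite invr_gt0 mulr_gt0.
have [P [P0 Pm dP Pp Pn]] := cont_inverse_prim cq L20 qL.
exists (fun x => y (P x)) => [|x]; last exact: yin.
have lim_s e : 0 < e -> (exists N, forall z, N <= z -> s z <= e) /\
    (exists N, forall z, z <= N -> 1 - s z <= e).
  move=> e0; have E1 (z : R) : z <= expR z by have := expR_ge1Dx z; lra.
  split.
    exists e^-1 => z ze; rewrite /s -(invrK e) lef_pV2 ?posrE ?invr_gt0//.
    by have := E1 z; lra.
  exists (- e^-1) => z ze.
  have -> : 1 - s z = s (- z).
    rewrite /s expRN; field; have := expR_gt0 z; have := E0 z => h1 h2.
    by rewrite !gt_eqF//; lra.
  rewrite /s -(invrK e) lef_pV2 ?posrE ?invr_gt0//.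
  by have := E1 (- z); lra.
split.
- move=> x; apply: derE (derComp (dP x) (dy (P x))) _.
  have n1 : X (y (P x)) != 0 by rewrite gt_eqF// X0.
  have := p0 (P x); rewrite /q; move: ((b - a) * _) => t t0.
  by field; rewrite n1 gt_eqF.
- apply/cvgrPdist_le => e e0.
  have [|_ [N hN]] := lim_s (e / (b - a)); first by rewrite divr_gt0// subr_gt0.
  have [K hK] := Pn N; exists K; split; first exact: num_real.
  move=> x /ltW/hK/hN h; rewrite distrC ger0_norm; last by have /andP[] := yin (P x); lra.
  by move: h; rewrite ler_pdivlMr ?subr_gt0// /y; lra.
- apply/cvgrPdist_le => e e0.
  have [|[N hN] _] := lim_s (e / (b - a)); first by rewrite divr_gt0// subr_gt0.
  have [K hK] := Pp N; exists K; split; first exact: num_real.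
  move=> x /ltW/hK/hN h; rewrite ger0_norm; last by have /andP[] := yin (P x); lra.
  by move: h; rewrite ler_pdivlMr ?subr_gt0// /y; lra.
- by rewrite P0 /y /s expR0; field.
Qed.

End autonomous.

Section profile.
Context {R : realType}.
Context (um e : R) (f f1 f2 : R -> R).
Hypotheses (um0 : 0 < um) (e0 : 0 <= e) (e1 : 1000 * e <= 1).
Hypotheses (df : forall x : R, is_derive x 1 f (f1 x))
  (df1 : forall x : R, is_derive x 1 f1 (f2 x))
  (hq : forall y : R, `|f2 y - 6 * y| <= e * (um + `|y|)).
Local Notation X := (excess um f f1).

(** On this range the cubic flux gives the slope [3 c^2 - 3 um^2 >= 15/4 um^2], while the
    perturbation changes it by at most [um^2]. *)
Lemma excess_lt x y : - (5 * um / 2) <= x -> x < y -> y <= - (3 * um / 2) -> X x < X y.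
Proof.
move=> x0 xy y0; have [c /andP[xc cy] E] := mvt_seg (ltW xy) (fun z _ => excess_der um df z).
rewrite -subr_gt0 E pmulr_lgt0 ?subr_gt0//.
have um0' := um0; have e0' := e0; have e1' := e1.
have := excess1_near um0 e0 df1 hq (_ : - (3 * um) <= c <= um).
have -> : (- (3 * um) <= c <= um)%R by apply/andP; split; lra.
move=> /(_ isT); rewrite (ler0_norm (_ : c - um <= 0)); last by lra.
rewrite ler_norml => /andP[h _].
have h2 : 6 * e * um * - (c - um) <= um ^+ 2.
  have : 6 * e * um * - (c - um) <= 6 * e * um * (7/2 * um).
    by apply: ler_wpM2l; [rewrite !mulr_ge0// ltW|lra].
  move=> /le_trans; apply; rewrite (_ : _ * _ = 21 * e * um ^+ 2); last by field.
  by rewrite ler_piMl ?sqr_ge0//; lra.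
have h3 : (3 * um / 2) ^+ 2 <= c ^+ 2.
  by rewrite -(sqrrN c) ler_sqr ?nnegrE; lra.
have u2 : 0 < um ^+ 2 by rewrite exprn_gt0.
by move: h h2 h3; rewrite (_ : (3 * um / 2) ^+ 2 = 9/4 * um ^+ 2); [lra|field].
Qed.

Let near S : - (3 * um) <= S -> S <= um ->
  (S - um) ^+ 2 * (S + 2 * um - um / 100) <= X S <= (S - um) ^+ 2 * (S + 2 * um + um / 100).
Proof.
move=> S1 S2; have := excess_near um0 e0 df df1 hq (_ : - (3 * um) <= S <= um).
rewrite S1 S2 => /(_ isT).
have h : 6 * e * um * (S - um) ^+ 2 <= um / 100 * (S - um) ^+ 2.
  by apply: ler_wpM2r; [exact: sqr_ge0|]; move: e1 um0; nra.
by rewrite ler_norml => /andP[h1 h2]; apply/andP; split; lra.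
Qed.

Definition left_root ul := [/\ - (2 + 1/100) * um <= ul, ul <= - (2 - 1/100) * um & X ul = 0].

Lemma left_rootP ul : - (5 * um / 2) < ul -> ul < - (3 * um / 2) -> X ul = 0 -> left_root ul.
Proof.
move=> h1 h2 E; have um0' := um0; have := @near ul ltac:(lra) ltac:(lra).
rewrite E => /andP[h3 h4].
have s0 : 0 < (ul - um) ^+ 2 by rewrite exprn_even_gt0//=; lra.
move: h3 h4; rewrite pmulr_rle0// pmulr_rge0// => h3 h4.
by split => //; lra.
Qed.

Lemma left_root_exists : exists ul, left_root ul.
Proof.
have um0' := um0.
(* The endpoints are moved inwards because the intermediate value theorem gives weak bounds, whereas
   [left_rootP] asks for strict ones. *)
have [||c /andP[c1 c2] E] := @der_IVT R X (fun x => f1 x - f1 um) (- (5 * um / 2) + um / 100)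
  (- (3 * um / 2) - um/100) 0 _ (excess_der um df); first lra.
  apply/andP; split.
    have /andP[_ h] := @near (- (5 * um / 2) + um / 100) ltac:(lra) ltac:(lra).
    apply: le_trans h _; rewrite mulr_ge0_le0 ?sqr_ge0//; lra.
  have /andP[h _] := @near (- (3 * um / 2) - um / 100) ltac:(lra) ltac:(lra).
  apply: le_trans h; rewrite mulr_ge0 ?sqr_ge0//; lra.
by exists c; apply: left_rootP => //; lra.
Qed.

Lemma left_root_unique ul ul' : left_root ul -> left_root ul' -> ul = ul'.
Proof.
move=> [a1 a2 a3] [b1 b2 b3]; have um0' := um0; have [h|h|//] := ltgtP ul ul'.
  by have := @excess_lt ul ul' ltac:(lra) h ltac:(lra); rewrite a3 b3 ltxx.
by have := @excess_lt ul' ul ltac:(lra) h ltac:(lra); rewrite a3 b3 ltxx.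
Qed.

Lemma excess_gt0 ul S : left_root ul -> ul < S < um -> 0 < X S.
Proof.
move=> [a1 a2 a3] /andP[h1 h2]; have um0' := um0.
have [h|h] := leP S (- (3 * um / 2)).
  by have := @excess_lt ul S ltac:(lra) h1 ltac:(lra); rewrite a3.
have /andP[h3 _] := @near S ltac:(lra) ltac:(lra).
by apply: lt_le_trans h3; rewrite mulr_gt0//; [rewrite exprn_even_gt0//=|]; lra.
Qed.

Lemma shock_speedE ul : ul < um -> shock_speed um f ul = f1 um <-> X ul = 0.
Proof.
move=> h; have d0 : um - ul != 0 by rewrite subr_eq0 gt_eqF.
rewrite /shock_speed /excess; split => [<-|E]; first by field.
apply: (mulIf d0); rewrite divfK//; lra.
Qed.

Lemma left_stateP ul : left_state um f ul <-> left_root ul.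
Proof.
have um0' := um0; rewrite /left_state (der_val (df um)); split.
  by move=> [h1 h2 /shock_speedE h3]; apply: left_rootP => //; apply: h3; lra.
move=> [a1 a2 a3]; split; [lra|lra|]; apply/shock_speedE => //; lra.
Qed.

Lemma left_state_unique_exists : exists! ul, left_state um f ul.
Proof.
have [ul h] := left_root_exists; exists ul; split; first exact/left_stateP.
by move=> ul' /left_stateP; exact: left_root_unique.
Qed.

Context (ul : R) (hul : left_root ul).
Let ulum : ul < um. Proof. by case: hul => h1 h2 _; move: um0; lra. Qed.
Let cX : continuous X. Proof. by move=> x; exact: der_cont (excess_der um df x). Qed.
Let Xum : X um = 0. Proof. by rewrite /excess; ring. Qed.
Let cX1 : continuous (fun x => f1 x - f1 um).
Proof. by move=> x; apply: cvgB; [exact: der_cont (df1 x)|exact: cvg_cst]. Qed.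

Lemma excess_heteroclinic : exists2 S, heteroclinic X ul um S & forall x, ul < S x < um.
Proof.
have [_ _ Xul] := hul.
have [L L0 hL] := cont_bounded ul um cX1.
apply: (@heteroclinic_exists R X ul um L) => // y yin; have /andP[y1 y2] := yin.
- exact: excess_gt0 yin.
- have [c /andP[c1 c2]] := mvt_seg (ltW y1) (fun z _ => excess_der um df z).
  rewrite Xul subr0 => ->; apply: ler_wpM2r; first by rewrite subr_ge0 ltW.
  by apply: le_trans (ler_norm _) (hL _ _); rewrite c1 (le_trans c2)// ltW.
- have [c /andP[c1 c2]] := mvt_seg (ltW y2) (fun z _ => excess_der um df z).
  rewrite Xum sub0r => /eqP; rewrite eqr_oppLR => /eqP ->; rewrite -mulNr.
  apply: ler_wpM2r; first by rewrite subr_ge0 ltW.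
  by apply: le_trans (ler_norm _) _; rewrite normrN hL// (le_trans (ltW y1) c1).
Qed.

Lemma heteroclinic_unique (S T : R -> R) : heteroclinic X ul um S -> heteroclinic X ul um T -> S = T.
Proof.
move=> [dS _ _ S0] [dT _ _ T0].
apply: (autonomous_unique (excess_der um df) cX1 dS dT); by rewrite S0.
Qed.

(** The bounds are known for the orbit built by quadrature and are transferred by uniqueness. *)
Lemma heteroclinic_between S : heteroclinic X ul um S -> forall x, ul < S x < um.
Proof.
by move=> hS; have [T hT] := excess_heteroclinic; rewrite (heteroclinic_unique hS hT).
Qed.

Lemma cvg_derivative0 (g g1 : R -> R) (l c : R) : (forall x : R, is_derive x 1 g (g1 x)) ->
  g x @[x --> +oo] --> l -> g1 x @[x --> +oo] --> c -> c = 0.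
Proof.
move=> dg gl gc; apply/eqP; rewrite -normr_le0; apply/ler_addgt0Pr => ep ep0; rewrite add0r.
have ep3 : 0 < ep / 3 by lra.
move/cvgrPdist_le : gl => /(_ _ ep3)[M1 [_ h1]]; move/cvgrPdist_le : gc => /(_ _ ep3)[M2 [_ h2]].
pose a := Num.max M1 M2 + 1; have aa : a <= a + 1 by rewrite lerDl.
have m1 : M1 <= Num.max M1 M2 by rewrite le_max lexx.
have m2 : M2 <= Num.max M1 M2 by rewrite le_max lexx orbT.
have am : M1 < a /\ M2 < a by split; rewrite /a; lra.
have [z /andP[az za] E] := mvt_seg aa (fun x _ => dg x).
have := h1 a am.1; have /h1 := lt_le_trans am.1 aa; have /h2 := lt_le_trans am.2 az.
rewrite /= !ler_norml => /andP[? ?] /andP[? ?] /andP[? ?]; move: E.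
rewrite (_ : a + 1 - a = 1); last by ring.
by rewrite mulr1 => E; apply/andP; split; lra.
Qed.

Lemma viscous_profileP S : viscous_profile um f ul S <-> heteroclinic X ul um S.
Proof.
have sg : shock_speed um f ul = f1 um by apply/shock_speedE => //; case: hul.
rewrite /viscous_profile /= sg; split=> [[[dS cS] eq l1 l2 S0]|[dS l1 l2 S0]].
  split => //.
  have d0 (x : R) : is_derive x 1 S (derive1 S x) by apply: derivable_der; exact: (dS 0%N).
  have d1 (x : R) : is_derive x 1 (derive1 S) (derive1n 2 S x).
    by apply: derivable_der; exact: (dS 1%N).
  pose c := derive1 S 0 - X (S 0).
  have E x : derive1 S x = X (S x) + c.
    have h0 (y : R) : is_derive y 1 (fun y => derive1 S y - X (S y)) 0.
      have h := derB (d1 y) (derComp (d0 y) (excess_der um df (S y))).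
      have E2 : - f1 um * derive1 S y + derive1 (f \o S) y = derive1n 2 S y := eq y.
      by apply: derE h _; rewrite -E2 (der_val (derComp (d0 y) (df (S y)))); ring.
    by rewrite /c (der0_cst 0 x h0); ring.
  have cX0 : X (S x) @[x --> +oo] --> X um by apply: continuous_cvg => //; exact: cX.
  have c0 : c = 0.
    apply: (cvg_derivative0 d0 l2); rewrite (_ : derive1 S = fun x => X (S x) + c); last exact/funext.
    rewrite -[X in _ --> X]add0r -{1}Xum; apply: cvgD => //; exact: cvg_cst.
  by move=> x; apply: derE (d0 x) _; rewrite E c0 addr0.
have E1 : derive1 S = (fun x => X (S x)) by apply/funext => x; exact: der_val.
have d1 (x : R) : is_derive x 1 (derive1 S) ((f1 (S x) - f1 um) * X (S x)).
  by rewrite E1; exact: derComp (dS x) (excess_der um df (S x)).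
have E2 : derive1n 2 S = (fun x => (f1 (S x) - f1 um) * X (S x)).
  by apply/funext => x; exact: (der_val (d1 x)).
have cS : continuous S by move=> x; exact: der_cont (dS x).
split => //.
- split; last first.
    rewrite E2 => x; apply: cvgM.
      by apply: (@continuous_comp _ _ _ S (fun x => f1 x - f1 um)); [exact: cS|exact: cX1].
    by apply: (@continuous_comp _ _ _ S X); [exact: cS|exact: cX].
  by move=> [|[|//]] _ x; [have [] := dS x|have [] := d1 x].
move=> x; rewrite (der_val (d1 x)) (der_val (derComp (dS x) (df (S x)))) (der_val (dS x)); ring.
Qed.

Lemma viscous_profile_unique_exists : exists! S, viscous_profile um f ul S.
Proof.
have [S hS _] := excess_heteroclinic; exists S; split; first exact/viscous_profileP.
by move=> T /viscous_profileP; exact: heteroclinic_unique.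
Qed.
End profile.

Section flux_bound.
Context {R : realType}.
Implicit Types f : R -> R.

Lemma flux_eps_bound (um eps : R) f : 0 < um -> Cdiff 3 f -> (flux_eps um f <= eps%:E)%E ->
  [/\ (forall x : R, is_derive x 1 f (derive1 f x)),
      (forall x : R, is_derive x 1 (derive1 f) (derive1n 2 f x)) &
      forall y : R, `|derive1n 2 f y - 6 * y| <= eps * (um + `|y|)].
Proof.
move=> um0 [df _] he.
have d0 (x : R) : is_derive x 1 f (derive1 f x) by apply: derivable_der; exact: (df 0%N).
have d1 (x : R) : is_derive x 1 (derive1 f) (derive1n 2 f x).
  by apply: derivable_der; exact: (df 1%N).
split => // y.
have p1 : derive1 (perturbation f) = fun x => derive1 f x - 3 * x ^+ 2.
  apply/funext => x; apply: der_val; apply: derE (derB (d0 x) (derX 3 (derI x))) _.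
  by rewrite /= mulr1.
have p2 : derive1n 2 (perturbation f) y = derive1n 2 f y - 6 * y.
  rewrite (_ : derive1n 2 (perturbation f) = derive1 (derive1 (perturbation f)))// p1.
  apply: der_val; apply: derE (derB (d1 y) (derM (derC 3 y) (derX 2 (derI y)))) _.
  by rewrite /=; ring.
have y0 : 0 < um + `|y| by rewrite ltr_wpDr.
rewrite -p2 -ler_pdivrMr// -lee_fin; apply: le_trans he; rewrite /flux_eps /=.
apply: le_trans (_ : _ <= ereal_sup (range (fun y => (`|derive1n 2 (perturbation f) y| / (um + `|y|))%:E)))%E _.
  by apply: ereal_sup_ubound; exists y.
by rewrite leeDl// Lnorm_ge0.
Qed.
End flux_bound.

Section bounded_integrals.
Context {R : realType}.
Local Notation mu := (@lebesgue_measure R).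

Lemma itg_of_bounded_int (f : R -> R) B : continuous f -> (forall x, 0 <= f x) ->
  (forall n : nat, int (- n%:R) n%:R f <= B) -> itg f.
Proof.
move=> cf f0 hB.
have mf : measurable_fun setT f by exact: continuous_measurable_fun.
apply/integrableP; split; first exact: measE.
rewrite [X in (X < _)%E](_ : _ = \int[mu]_x (EFin \o f) x)%E; last first.
  by apply: eq_integral => x _ /=; rewrite ger0_norm.
pose T n : set R := `[- n%:R, n%:R]%classic.
have TT : \bigcup_n T n = setT.
  apply/seteqP; split => // x _; exists (Num.trunc `|x|).+1 => //=.
  by rewrite /T /= in_itv /= -ler_norml ltW//; exact: truncnS_gt.
have nd : nondecreasing_seq T.
  by move=> m n mn; apply/subsetPset; apply: subset_itv; rewrite bnd_simp ?lerN2 ler_nat.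
have mT n : measurable (T n) by exact: measurable_itv.
have := @ge0_nondecreasing_set_cvg_integral _ (measurableTypeR R) R T (EFin \o f) mu nd mT.
rewrite TT => h; have {}h := h (fun n => measurable_funS measurableT (@subsetT _ _) (measE mf))
  (fun n x _ => f0 x : (0 <= (f x)%:E)%E).
have <- := cvg_lim (@ereal_hausdorff R) h.
apply: (@le_lt_trans _ _ B%:E); last exact: ltry.
apply: lime_le; first by apply/cvg_ex; eexists; exact: h.
apply: nearW => n; have := hB n; rewrite -lee_fin /int /Rintegral fineK//.
by apply: integrable_fin_num => //; exact: intg_cont.
Qed.
End bounded_integrals.

(** * Translates of the profile *)

Section waves.
Context {R : realType}.
Local Notation mu := (@lebesgue_measure R).
Context (X X1 : R -> R) (ul um : R) (ulum : ul < um).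
Hypotheses (dX : forall x : R, is_derive x 1 X (X1 x)) (cX1 : continuous X1)
  (X0 : forall y, ul < y < um -> 0 < X y).
Implicit Types (S : R -> R).

Definition wave S := [/\ (forall x : R, is_derive x 1 S (X (S x))), S x @[x --> -oo] --> ul,
  S x @[x --> +oo] --> um & forall x, ul < S x < um].

Definition shift_by S (Z x : R) := S (x + Z).

Let cX : continuous X. Proof. by move=> x; exact: der_cont (dX x). Qed.

Lemma cvg_pinfty_lim S (l : R) : S x @[x --> +oo] --> l <->
  forall e, 0 < e -> exists N, forall x, N <= x -> `|S x - l| <= e.
Proof.
split=> [/cvgrPdist_le h e e0|h].
  have [N [_ hN]] := h _ e0; exists (N + 1) => x Nx.
  by rewrite distrC; apply: hN; apply: lt_le_trans Nx; rewrite ltrDl.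
apply/cvgrPdist_le => e e0; have [N hN] := h _ e0.
by exists N; split => [|x /ltW]; rewrite ?num_real// distrC; exact: hN.
Qed.

Lemma cvg_ninfty_lim S (l : R) : S x @[x --> -oo] --> l <->
  forall e, 0 < e -> exists N, forall x, x <= N -> `|S x - l| <= e.
Proof.
split=> [/cvgrPdist_le h e e0|h].
  have [N [_ hN]] := h _ e0; exists (N - 1) => x Nx.
  by rewrite distrC; apply: hN; apply: le_lt_trans Nx _; rewrite gtrDl oppr_lt0.
apply/cvgrPdist_le => e e0; have [N hN] := h _ e0.
by exists N; split => [|x /ltW]; rewrite ?num_real// distrC; exact: hN.
Qed.

Lemma wave_shift S Z : wave S -> wave (shift_by S Z).
Proof.
move=> [dS /cvg_ninfty_lim l1 /cvg_pinfty_lim l2 hS]; split.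
- move=> x; have da : is_derive x 1 (fun x => x + Z) 1.
    by apply: derE (derD (derI x) (derC Z x)) _; rewrite addr0.
  by apply: derE (derComp da (dS (x + Z))) _; rewrite mulr1.
- apply/cvg_ninfty_lim => e e0; have [N hN] := l1 _ e0.
  by exists (N - Z) => x h; apply: hN; lra.
- apply/cvg_pinfty_lim => e e0; have [N hN] := l2 _ e0.
  by exists (N - Z) => x h; apply: hN; lra.
- by move=> x; exact: hS.
Qed.

Lemma shift_byD S Z h x : shift_by (shift_by S Z) h x = shift_by S (Z + h) x.
Proof. by rewrite /shift_by -addrA (addrC h). Qed.

Lemma X_bounded : exists2 M, 0 <= M & forall S, wave S -> forall x, X (S x) <= M.
Proof.
have [M M0 hM] := cont_bounded ul um cX; exists M => // S [_ _ _ hS] x.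
by apply: le_trans (ler_norm _) (hM _ _); have /andP[h1 h2] := hS x; rewrite !ltW.
Qed.

Lemma wave_cont S : wave S -> continuous S.
Proof. by move=> [dS _ _ _] x; exact: der_cont (dS x). Qed.

Lemma wave_speed_cont S : wave S -> continuous (fun x => X (S x)).
Proof.
by move=> hS x; apply: (@continuous_comp _ _ _ S X); [exact: wave_cont|exact: cX].
Qed.

Lemma wave_speed_gt0 S x : wave S -> 0 < X (S x).
Proof. by move=> [_ _ _ hS]; exact: X0. Qed.

Lemma wave_speed_itg S : wave S -> itg (fun x => X (S x)).
Proof.
move=> hS; have [dS _ _ bS] := hS; have cF := wave_speed_cont hS.
apply: (@itg_of_bounded_int _ _ (um - ul)) => // [x|n]; first exact/ltW/wave_speed_gt0.
have nn : - n%:R <= n%:R :> R by rewrite ge0_cp.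
rewrite (ftc_int cF dS nn); have /andP[? ?] := bS n%:R; have /andP[? ?] := bS (- n%:R); lra.
Qed.

(** [F = X(S)] satisfies the linear equation [F' = X1(S) F] with bounded coefficient; the
    exponential factor is Gronwall's. The constant depends on the vector field only, hence serves
    all translates. *)
Lemma wave_growth : exists2 C, 0 <= C & forall S, wave S -> forall x t,
  X (S (x + t)) <= expR (C * `|t|) * X (S x) /\ `|X1 (S (x + t))| <= C.
Proof.
have [C C0 hC] := cont_bounded ul um cX1; exists C => // S hS x t.
have [dS _ _ bS] := hS; have bX y : `|X1 (S y)| <= C.
  by apply: hC; have /andP[h1 h2] := bS y; rewrite !ltW.
split => //.
have E c (y : R) : is_derive y 1 (fun y => expR (c * y)) (c * expR (c * y)).
  have dl : is_derive y 1 (fun y => c * y) c.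
    by apply: derE (derM (derC c y) (derI y)) _; ring.
  by apply: derE (derComp dl (is_derive_expR (c * y))) _; rewrite mulrC.
have dF (y : R) : is_derive y 1 (fun y => X (S y)) (X1 (S y) * X (S y)).
  by exact: derComp (dS y) (dX (S y)).
have key c (y : R) : is_derive y 1 (fun y => X (S y) * expR (c * y))
    ((X1 (S y) + c) * (X (S y) * expR (c * y))).
  by apply: derE (derM (dF y) (E c y)) _; ring.
have pos c y : 0 <= X (S y) * expR (c * y).
  by rewrite mulr_ge0 ?expR_ge0// ltW// wave_speed_gt0.
have [t0|/ltW t0] := leP 0 t.
  have xt : x <= x + t by rewrite lerDl.
  have := der_ge0_nondecreasing xt (fun y _ => derN (key (- C) y)) _.
  have h y : x <= y <= x + t -> 0 <= - ((X1 (S y) + - C) * (X (S y) * expR (- C * y))).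
    move=> _; rewrite -mulNr mulr_ge0//.
    by have := bX y; rewrite ler_norml => /andP[? ?]; lra.
  move=> /(_ h); rewrite lerN2 -ler_pdivlMr ?expR_gt0// => /le_trans; apply.
  by rewrite -mulrA -expRN -expRD mulrC ger0_norm// le_eqVlt; apply/orP; left; apply/eqP;
    congr (expR _ * _); ring.
have xt : x + t <= x by rewrite gerDl.
have := der_ge0_nondecreasing xt (fun y _ => key C y) _.
have h y : x + t <= y <= x -> 0 <= (X1 (S y) + C) * (X (S y) * expR (C * y)).
  move=> _; rewrite mulr_ge0//.
  by have := bX y; rewrite ler_norml => /andP[? ?]; lra.
move=> /(_ h); rewrite -ler_pdivlMr ?expR_gt0// => /le_trans; apply.
by rewrite -mulrA -expRN -expRD mulrC ler0_norm// le_eqVlt; apply/orP; left; apply/eqP;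
  congr (expR _ * _); ring.
Qed.

(** The bounds are by multiples of [X (S x)] and not by constants, which makes the increments
    integrable over the line. *)
Lemma wave_increment Z : exists2 C, 0 <= C & forall S, wave S -> forall x h, `|h| <= Z ->
  `|S (x + h) - S x| <= C * `|h| * X (S x) /\
  `|S (x + h) - S x - h * X (S x)| <= C * h ^+ 2 * X (S x).
Proof.
have [C C0 hC] := wave_growth.
pose G := expR (C * Z); have G1 : 0 < G by exact: expR_gt0.
exists (G + C * G); first by rewrite addr_ge0 ?mulr_ge0// ltW.
move=> S hS x h hZ; have [dS _ _ bS] := hS.
have F0 y : 0 <= X (S y) by exact/ltW/wave_speed_gt0.
have gr t : `|t| <= Z -> X (S (x + t)) <= G * X (S x).
  move=> tZ; apply: le_trans (hC S hS x t).1 _; apply: ler_wpM2r => //.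
  by rewrite ler_expR ler_wpM2l.
have [c c1] := mvt x (x + h) dS; rewrite (_ : x + h - x = h) in c1 *; last ring.
move=> E; have hc : c = x + (c - x) by ring.
have c2 : X (S c) <= G * X (S x) by rewrite hc gr// (le_trans c1).
have hG : G <= G + C * G by rewrite lerDl mulr_ge0// ltW.
split.
  rewrite E normrM (ger0_norm (F0 c)) [leRHS]mulrAC.
  apply: ler_wpM2r => //; apply: le_trans c2 _; exact: ler_wpM2r.
have [d d1] := @mvt R (fun y => X (S y)) (fun y => X1 (S y) * X (S y)) x c
  (fun y => derComp (dS y) (dX (S y))).
move=> E2; rewrite E (_ : X (S c) * h - h * X (S x) = h * (X (S c) - X (S x))); last ring.
have hd : d = x + (d - x) by ring.
have d2 : X (S d) <= G * X (S x) by rewrite hd gr// (le_trans d1)// (le_trans c1).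
have d3 : `|X1 (S d)| <= C by rewrite hd; exact: (hC S hS x (d - x)).2.
rewrite E2 !normrM -(real_normK (num_real h)) (ger0_norm (F0 d)).
apply: le_trans (_ : `|h| * (C * (G * X (S x)) * `|h|) <= _).
  by apply: ler_wpM2l => //; apply: ler_pM => //; [exact: mulr_ge0|exact: ler_pM].
have := mulr_ge0 (ltW G1) (mulr_ge0 (F0 x) (sqr_ge0 `|h|)); lra.
Qed.

Lemma wave_shift_L2 S Z : wave S -> L2f (fun x => shift_by S Z x - S x).
Proof.
move=> hS; have [C C0 hC] := wave_increment `|Z|.
have [M M0 hM] := X_bounded.
have F0 y : 0 <= X (S y) by exact/ltW/wave_speed_gt0.
have md : measurable_fun setT (fun x => shift_by S Z x - S x).
  by apply: measurable_funB; apply: continuous_measurable_fun; apply: wave_cont => //; exact: wave_shift.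
split => //; apply: (itg_le _ (itgZ ((C * `|Z|) ^+ 2 * M) (wave_speed_itg hS))).
  exact: measurable_funX.
move=> x; rewrite normrX; have [h _] := hC S hS x Z (lexx _).
apply: le_trans (_ : (C * `|Z| * X (S x)) ^+ 2 <= _).
  by rewrite ler_sqr ?nnegrE// !mulr_ge0.
rewrite exprMn -[leRHS]mulrA ler_wpM2l ?sqr_ge0// expr2 ler_wpM2r//; exact: hM.
Qed.

(** Coercivity in the shift: on a segment of length [|Z| - 2 N] the two translates are close to
    opposite end states, so they differ by at least half of [um - ul]. *)
Lemma wave_far S : wave S -> exists2 N, 0 <= N & forall Z, 2 * N <= `|Z| ->
  ((um - ul) / 2) ^+ 2 * (`|Z| - 2 * N) <= I (fun x => (shift_by S Z x - S x) ^+ 2).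
Proof.
move=> hS; have [_ /cvg_ninfty_lim l1 /cvg_pinfty_lim l2 _] := hS.
have e0 : 0 < (um - ul) / 4 by have := ulum; lra.
have [N1 h1] := l1 _ e0; have [N2 h2] := l2 _ e0.
pose N := `|N1| + `|N2|; have N0 : 0 <= N by rewrite addr_ge0.
have hl x : x <= - N -> S x <= ul + (um - ul) / 4.
  move=> xN; have h0 : x <= N1.
    by have := ler_norm (- N1); rewrite normrN; have := normr_ge0 N2; move: xN; rewrite /N; lra.
  by have := le_trans (ler_norm _) (h1 x h0); lra.
have hr x : N <= x -> um - (um - ul) / 4 <= S x.
  move=> xN; have h0 : N2 <= x.
    by have := ler_norm N2; have := normr_ge0 N1; move: xN; rewrite /N; lra.
  by have := h2 x h0; rewrite distrC => /(le_trans (ler_norm _)); lra.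
exists N => // Z ZN.
have Ld := wave_shift_L2 Z hS.
have gen a b : b - a = `|Z| - 2 * N -> (forall x, a <= x <= b -> (um - ul) / 2 <= `|shift_by S Z x - S x|) ->
    ((um - ul) / 2) ^+ 2 * (`|Z| - 2 * N) <= I (fun x => (shift_by S Z x - S x) ^+ 2).
  move=> ab h; apply: le_trans (int_le_I a b Ld.2 (fun x => sqr_ge0 _)).
  rewrite -ab -int_cst; last by rewrite -subr_ge0 ab subr_ge0.
  apply: le_int => [||x /h hx]; first by apply: intg_cont => ?; exact: cvg_cst.
    by apply: itg_intg; exact: Ld.2.
  rewrite -[leRHS](real_normK (num_real _)) ler_sqr ?nnegrE//.
  by have := ulum; lra.
have [Z0|/ltW Z0] := leP 0 Z.
  rewrite ger0_norm// in ZN gen *; apply: (gen (N - Z) (- N)); first by ring.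
  move=> x /andP[x1 x2]; have a1 := hl x x2; have a2 := hr (x + Z) ltac:(lra).
  by rewrite /shift_by; apply: le_trans (ler_norm _); lra.
rewrite ler0_norm// in ZN gen *; apply: (gen N (- Z - N)); first by ring.
move=> x /andP[x1 x2]; have a1 := hr x x1; have a2 := hl (x + Z) ltac:(lra).
by rewrite /shift_by distrC; apply: le_trans (ler_norm _); lra.
Qed.

Lemma wave_value S y : wave S -> ul < y < um -> exists x, S x = y.
Proof.
move=> hS /andP[y1 y2]; have [dS /cvg_ninfty_lim l1 /cvg_pinfty_lim l2 _] := hS.
have [|N1 h1] := l1 (y - ul); first lra.
have [|N2 h2] := l2 (um - y); first lra.
have m1 : Num.min N1 N2 <= N1 by rewrite ge_min lexx.
have m2 : N2 <= Num.max N1 N2 by rewrite le_max lexx orbT.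
have mm : Num.min N1 N2 <= Num.max N1 N2.
  by apply: le_trans m1 _; rewrite le_max lexx.
have [|x _ E] := der_IVT mm dS (_ : S (Num.min N1 N2) <= y <= S (Num.max N1 N2)).
  have := h1 _ m1; have := h2 _ m2; rewrite !ler_norml => /andP[? ?] /andP[? ?].
  by apply/andP; split; lra.
by exists x.
Qed.
End waves.

Lemma norm_le_1D_sqr (R : realType) (w : R) : `|w| <= 1 + w ^+ 2.
Proof.
rewrite -(real_normK (num_real w)); have := normr_ge0 w; move: `|w| => y y0.
have := sqr_ge0 (y - 1); nra.
Qed.

(** Here [d] is the increment of the profile under the shift [h]. The remainder is [h^2] times a
    combination of [w^2] and [F], both integrable; the linear terms in [w] are absorbed through
    [|w| <= 1 + w^2]. *)
Lemma expansion_pointwise (R : realType) (um C M F a w d h : R) : 0 < um -> 0 <= C ->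
  0 <= F -> F <= M -> 4 * um <= a -> a <= 8 * um -> `|h| <= 1 ->
  `|d| <= C * `|h| * F -> `|d - h * F| <= C * h ^+ 2 * F ->
  `|(a - d) * (w - d) ^+ 2 - a * w ^+ 2 + 2 * h * (F * (w ^+ 2 / 2 + a * w))| <=
  h ^+ 2 * ((C * M * (1 + 16 * um) + 2 * C ^+ 2 * M ^+ 2) * w ^+ 2 +
    (16 * um * C + C ^+ 2 * M * (8 * um + 2) + C ^+ 3 * M ^+ 2) * F).
Proof.
move=> u0 C0 F1 F2 a1 a2 h1 d1 d2.
have M0 := le_trans F1 F2.
have -> : (a - d) * (w - d) ^+ 2 - a * w ^+ 2 + 2 * h * (F * (w ^+ 2 / 2 + a * w)) =
  - (d - h * F) * (w ^+ 2 + 2 * a * w) + d ^+ 2 * (a + 2 * w) - d ^+ 3 by field.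
have H0 : 0 <= h ^+ 2 by exact: sqr_ge0.
have H1 : h ^+ 2 <= 1 by rewrite -(real_normK (num_real h)) expr_le1.
have Hn := normr_ge0 h.
have w0 := sqr_ge0 w; have w1 := norm_le_1D_sqr w.
have t1 : `|- (d - h * F) * (w ^+ 2 + 2 * a * w)| <=
    C * h ^+ 2 * F * (w ^+ 2 + 16 * um * (1 + w ^+ 2)).
  rewrite normrM normrN; apply: ler_pM => //; apply: le_trans (ler_normD _ _) _.
  rewrite ger0_norm// lerD2l normrM ger0_norm; last by lra.
  by apply: ler_pM => //; lra.
have dd : d ^+ 2 <= (C * `|h| * F) ^+ 2.
  by rewrite -(real_normK (num_real d)) ler_sqr ?nnegrE// !mulr_ge0.
have dd' : d ^+ 2 <= C ^+ 2 * h ^+ 2 * F ^+ 2.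
  by apply: le_trans dd _; rewrite !exprMn real_normK ?num_real.
have t2 : `|d ^+ 2 * (a + 2 * w)| <= C ^+ 2 * h ^+ 2 * F ^+ 2 * (8 * um + 2 * (1 + w ^+ 2)).
  rewrite normrM; apply: ler_pM => //; first by rewrite ger0_norm ?sqr_ge0.
  have q1 : `|a| <= 8 * um by rewrite ger0_norm; lra.
  have q2 : `|2 * w| = 2 * `|w| by rewrite normrM ger0_norm.
  by apply: le_trans (ler_normD _ _) _; rewrite q2; lra.
have t3 : `|d ^+ 3| <= C ^+ 2 * h ^+ 2 * F ^+ 2 * (C * F).
  rewrite exprSr normrM; apply: ler_pM => //; first by rewrite ger0_norm ?sqr_ge0.
  apply: le_trans d1 _; rewrite mulrAC ler_piMr// ?mulr_ge0//.
apply: le_trans (ler_normB _ _) _; apply: le_trans (lerD (ler_normD _ _) (lexx _)) _.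
apply: le_trans (lerD (lerD t1 t2) t3) _.
have FF : F ^+ 2 <= M * F by rewrite expr2 ler_wpM2r.
have FF2 : F ^+ 2 <= M ^+ 2 by rewrite ler_sqr ?nnegrE.
have FF3 : F ^+ 2 * F <= M ^+ 2 * F by rewrite ler_wpM2r.
have e1 : F * w ^+ 2 <= M * w ^+ 2 by rewrite ler_wpM2r.
have e2 : F ^+ 2 * w ^+ 2 <= M ^+ 2 * w ^+ 2 by rewrite ler_wpM2r.
have C2 : 0 <= C ^+ 2 by exact: sqr_ge0.
have p1 : C * (F * w ^+ 2) * (1 + 16 * um) <= C * (M * w ^+ 2) * (1 + 16 * um).
  by apply: ler_wpM2r; [lra|exact: ler_wpM2l].
have p2 : C ^+ 2 * (F ^+ 2 * w ^+ 2) <= C ^+ 2 * (M ^+ 2 * w ^+ 2) by exact: ler_wpM2l.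
have p3 : C ^+ 2 * F ^+ 2 * (8 * um + 2) <= C ^+ 2 * (M * F) * (8 * um + 2).
  by apply: ler_wpM2r; [lra|exact: ler_wpM2l].
have p4 : C ^+ 3 * (F ^+ 2 * F) <= C ^+ 3 * (M ^+ 2 * F).
  by apply: ler_wpM2l => //; exact: exprn_ge0.
have -> : C * h ^+ 2 * F * (w ^+ 2 + 16 * um * (1 + w ^+ 2)) +
    C ^+ 2 * h ^+ 2 * F ^+ 2 * (8 * um + 2 * (1 + w ^+ 2)) + C ^+ 2 * h ^+ 2 * F ^+ 2 * (C * F) =
  h ^+ 2 * (C * (F * w ^+ 2) * (1 + 16 * um) + 16 * um * C * F + (C ^+ 2 * F ^+ 2 * (8 * um + 2) +
    2 * (C ^+ 2 * (F ^+ 2 * w ^+ 2))) + C ^+ 3 * (F ^+ 2 * F)) by ring.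
apply: ler_wpM2l => //.
have -> : (C * M * (1 + 16 * um) + 2 * C ^+ 2 * M ^+ 2) * w ^+ 2 +
    (16 * um * C + C ^+ 2 * M * (8 * um + 2) + C ^+ 3 * M ^+ 2) * F = C * (M * w ^+ 2) * (1 + 16 * um) + 16 * um * C * F +
  (C ^+ 2 * (M * F) * (8 * um + 2) + 2 * (C ^+ 2 * (M ^+ 2 * w ^+ 2))) + C ^+ 3 * (M ^+ 2 * F).
  by ring.
lra.
Qed.

(** * Energy of a translate and its minimisers *)
Section energy.
Context {R : realType}.
Local Notation mu := (@lebesgue_measure R).
Context (X X1 : R -> R) (ul um : R) (ulum : ul < um).
Hypotheses (dX : forall x : R, is_derive x 1 X (X1 x)) (cX1 : continuous X1)
  (X0 : forall y, ul < y < um -> 0 < X y) (um0 : 0 < um) (ul3 : - (3 * um) <= ul).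
Implicit Types (S u : R -> R).
Local Notation wave := (wave X ul um).

Definition en u S := I (fun x => (5 * um - S x) * (u x - S x) ^+ 2) / 2.
Definition crit u S :=
  I (fun x => X (S x) * ((u x - S x) ^+ 2 / 2 + (5 * um - S x) * (u x - S x))).

Lemma weight_bound S x : wave S -> 4 * um <= 5 * um - S x <= 8 * um.
Proof.
by move=> [_ _ _ h]; have /andP[h1 h2] := h x; move: um0 ul3 h1 h2; lra.
Qed.

Lemma L2f_shift u S Z : wave S -> L2f (fun x => u x - S x) ->
  L2f (fun x => u x - shift_by S Z x).
Proof.
move=> hS hu; have := L2fB hu (wave_shift_L2 dX cX1 X0 Z hS).
by congr L2f; apply/funext => x; ring.
Qed.

Lemma meas_wave S : wave S -> measurable_fun setT S.
Proof. by move=> hS; apply: continuous_measurable_fun; exact: (wave_cont hS). Qed.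

Lemma meas_weight S : wave S -> measurable_fun setT (fun x => 5 * um - S x).
Proof. by move=> hS; apply: measurable_funB => //; exact: meas_wave. Qed.

Lemma L2f_weight S w : wave S -> L2f w -> L2f (fun x => (5 * um - S x) * w x).
Proof.
move=> hS; apply: (@L2f_bounded _ (8 * um)); first exact: meas_weight.
by move=> x; have /andP[h1 h2] := weight_bound x hS; rewrite ger0_norm//; move: um0; lra.
Qed.

Lemma en_itg u S : wave S -> L2f (fun x => u x - S x) ->
  itg (fun x => (5 * um - S x) * (u x - S x) ^+ 2).
Proof.
move=> hS hu; have := L2f_mul (L2f_weight hS hu) hu.
by congr itg; apply/funext => x; rewrite expr2 mulrA.
Qed.

Lemma en_bounds u S : wave S -> L2f (fun x => u x - S x) ->
  2 * um * I (fun x => (u x - S x) ^+ 2) <= en u S <= 4 * um * I (fun x => (u x - S x) ^+ 2).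
Proof.
move=> hS hu; have h1 : I (fun x => 4 * um * (u x - S x) ^+ 2) <=
    I (fun x => (5 * um - S x) * (u x - S x) ^+ 2).
  apply: I_le => [||x]; [by apply: itgZ; exact: hu.2|exact: en_itg|].
  by rewrite ler_wpM2r ?sqr_ge0//; have /andP[] := weight_bound x hS.
have h2 : I (fun x => (5 * um - S x) * (u x - S x) ^+ 2) <=
    I (fun x => 8 * um * (u x - S x) ^+ 2).
  apply: I_le => [||x]; [exact: en_itg|by apply: itgZ; exact: hu.2|].
  by rewrite ler_wpM2r ?sqr_ge0//; have /andP[] := weight_bound x hS.
move: h1 h2; rewrite !IZ; [|exact: hu.2..]; rewrite /en => h1 h2.
by apply/andP; split; lra.
Qed.

Lemma crit_itg u S : wave S -> L2f (fun x => u x - S x) ->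
  itg (fun x => X (S x) * ((u x - S x) ^+ 2 / 2 + (5 * um - S x) * (u x - S x))).
Proof.
move=> hS hu; have [M M0 hM] := X_bounded ul um dX.
have iF := wave_speed_itg dX X0 hS.
have F0 x : 0 <= X (S x) by exact: ltW (wave_speed_gt0 X0 x hS).
have mF := itg_meas iF.
have iB := itgD (itgZ (M * (1/2 + 8 * um)) hu.2) (itgZ (8 * um) iF).
apply: (itg_le _ iB).
  apply: measurable_funM => //; apply: measurable_funD.
    by apply: measurable_funM => //; apply: measurable_funX; exact: hu.1.
  by apply: measurable_funM; [exact: meas_weight|exact: hu.1].
move=> x; set w := u x - S x; rewrite normrM (ger0_norm (F0 x)).
have /andP[a1 a2] := weight_bound x hS.
have w1 := norm_le_1D_sqr w.
have h : `|w ^+ 2 / 2 + (5 * um - S x) * w| <= (1/2 + 8 * um) * w ^+ 2 + 8 * um.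
  have q1 : `|w ^+ 2 / 2| = w ^+ 2 / 2 by rewrite ger0_norm// divr_ge0 ?sqr_ge0.
  have q2 : `|(5 * um - S x) * w| = (5 * um - S x) * `|w|.
    by rewrite normrM ger0_norm//; move: um0; lra.
  apply: le_trans (ler_normD _ _) _; rewrite q1 q2.
  have : (5 * um - S x) * `|w| <= 8 * um * (1 + w ^+ 2) by apply: ler_pM => //; move: um0; lra.
  by lra.
apply: le_trans (ler_wpM2l (F0 x) h) _; have := hM S hS x; have := F0 x; have := sqr_ge0 w.
move: um0; move: (X (S x)) (w ^+ 2) => F v u0 v0 F1 F2.
have : F * ((1/2 + 8 * um) * v) <= M * ((1/2 + 8 * um) * v).
  by apply: ler_wpM2r => //; rewrite mulr_ge0//; lra.
lra.
Qed.

(** In other words, [- crit] is the derivative of the energy in the shift. *)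
Lemma en_expansion u S : wave S -> L2f (fun x => u x - S x) -> exists2 C, 0 <= C &
  forall h, `|h| <= 1 -> `|en u (shift_by S h) - en u S + h * crit u S| <= C * h ^+ 2.
Proof.
move=> hS hu; have [M M0 hM] := X_bounded ul um dX.
have [C C0 hC] := wave_increment dX cX1 X0 1.
have iF := wave_speed_itg dX X0 hS.
have F0 x : 0 <= X (S x) by exact: ltW (wave_speed_gt0 X0 x hS).
pose A := C * M * (1 + 16 * um) + 2 * C ^+ 2 * M ^+ 2.
pose B := 16 * um * C + C ^+ 2 * M * (8 * um + 2) + C ^+ 3 * M ^+ 2.
have iB := itgD (itgZ A hu.2) (itgZ B iF).
exists (I (fun x => A * (u x - S x) ^+ 2 + B * X (S x)) / 2).
  have um0' := um0; have q1 : 0 <= 1 + 16 * um by lra.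
  have q2 : 0 <= 8 * um + 2 by lra.
  have q3 : 0 <= 16 * um by lra.
  have A0 : 0 <= A by rewrite /A addr_ge0//; apply: mulr_ge0; rewrite ?sqr_ge0 ?mulr_ge0 ?sqr_ge0.
  have B0 : 0 <= B.
    have b1 : 0 <= C ^+ 2 * M * (8 * um + 2) by apply: mulr_ge0 => //; apply: mulr_ge0 => //; exact: sqr_ge0.
    have b2 : 0 <= C ^+ 3 * M ^+ 2 by apply: mulr_ge0; exact: exprn_ge0.
    by rewrite /B; have := mulr_ge0 q3 C0; lra.
  apply: divr_ge0 => //; apply: I_ge0 => x.
  by apply: addr_ge0; apply: mulr_ge0 => //; exact: sqr_ge0.
move=> h h1; have hSh := wave_shift h hS.
have i1 := en_itg hSh (L2f_shift h hS hu); have i2 := en_itg hS hu; have i3 := crit_itg hS hu.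
have E : en u (shift_by S h) - en u S + h * crit u S =
  I (fun x => (5 * um - shift_by S h x) * (u x - shift_by S h x) ^+ 2 -
     (5 * um - S x) * (u x - S x) ^+ 2 + (2 * h) *
     (X (S x) * ((u x - S x) ^+ 2 / 2 + (5 * um - S x) * (u x - S x)))) / 2.
  by rewrite ID ?IB ?IZ//; [rewrite /en /crit; field|exact: itgB|exact: itgZ].
rewrite E normrM (_ : `|2^-1 : R| = 2^-1); last by rewrite ger0_norm.
rewrite mulrAC ler_pM2r//.
have iT := itgD (itgB i1 i2) (itgZ (2 * h) i3).
have iTn : itg (fun x => `|(5 * um - shift_by S h x) * (u x - shift_by S h x) ^+ 2 -
     (5 * um - S x) * (u x - S x) ^+ 2 + (2 * h) *
     (X (S x) * ((u x - S x) ^+ 2 / 2 + (5 * um - S x) * (u x - S x)))|).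
  exact: integrable_norm.
apply: (@le_trans _ _ (I (fun x => `|(5 * um - shift_by S h x) * (u x - shift_by S h x) ^+ 2 -
     (5 * um - S x) * (u x - S x) ^+ 2 + (2 * h) *
     (X (S x) * ((u x - S x) ^+ 2 / 2 + (5 * um - S x) * (u x - S x)))|))).
  exact: le_normr_Rintegral.
rewrite [leRHS]mulrC -IZ//; apply: I_le => //; first exact: itgZ.
move=> x; have [d1 d2] := hC S hS x h h1.
have /andP[a1 a2] := weight_bound x hS; have := hM S hS x; have := F0 x.
have e1 : 5 * um - shift_by S h x = (5 * um - S x) - (S (x + h) - S x) by rewrite /shift_by; ring.
have e2 : u x - shift_by S h x = (u x - S x) - (S (x + h) - S x) by rewrite /shift_by; ring.
rewrite e1 e2 /A /B => F1 F2.
exact: (expansion_pointwise (u x - S x) um0 C0 F1 F2 a1 a2 h1 d1 d2).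
Qed.

(** The energy is continuous in the shift by its expansion and coercive by [wave_far]; shifts [t]
    and [- t] from the minimum then force [|crit| <= C t]. *)
Lemma minimiser_exists u S : wave S -> L2f (fun x => u x - S x) ->
  exists Z, (forall Z', en u (shift_by S Z) <= en u (shift_by S Z')) /\ crit u (shift_by S Z) = 0.
Proof.
move=> hS hu; have um0' := um0.
have expn Z : exists2 C, 0 <= C & forall h, `|h| <= 1 ->
    `|en u (shift_by S (Z + h)) - en u (shift_by S Z) + h * crit u (shift_by S Z)| <= C * h ^+ 2.
  have [C C0 hC] := en_expansion (wave_shift Z hS) (L2f_shift Z hS hu).
  by exists C => // h /hC; rewrite (_ : shift_by (shift_by S Z) h = shift_by S (Z + h))//;
    apply/funext => x; exact: shift_byD.
pose g Z := en u (shift_by S Z).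
have cg : continuous g.
  move=> Z; apply: eps_cont => e e0; have [C C0 hC] := expn Z.
  pose K := C + `|crit u (shift_by S Z)| + 1.
  have K0 : 0 < K by rewrite ltr_wpDl// addr_ge0.
  exists (Num.min 1 (e / K)) => [|y]; first by rewrite lt_min ltr01 divr_gt0.
  rewrite lt_min => /andP[/ltW y1 ye]; have := hC _ y1; rewrite (_ : Z + (y - Z) = y); last ring.
  rewrite -/(g y) -/(g Z); set h := y - Z in y1 ye * => hh.
  have h2 : C * h ^+ 2 <= C * `|h|.
    by rewrite -(real_normK (num_real h)) ler_wpM2l// expr2 ler_piMl.
  have h3 : `|h| * K <= e by rewrite -ler_pdivlMr// ltW.
  have := ler_normB (g y - g Z + h * crit u (shift_by S Z)) (h * crit u (shift_by S Z)).
  rewrite addrK [`|h * _|]normrM; move: h3; rewrite /K.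
  by have := normr_ge0 h; lra.
have [N N0 hN] := wave_far ulum dX cX1 X0 hS.
pose I0 := I (fun x => (u x - S x) ^+ 2).
have I00 : 0 <= I0 by apply: I_ge0 => x; exact: sqr_ge0.
pose D := ((um - ul) / 2) ^+ 2.
have D0 : 0 < D by rewrite exprn_gt0// divr_gt0// subr_gt0.
(* Beyond [B] the distance between the two profiles is so large that, by the triangle inequality
   through [u], the energy is at least [g 0 + 1]. *)
pose B := 2 * N + (2 * (I0 + (g 0 + 1) / (2 * um))) / D.
have g00 : 0 <= g 0.
  have /andP[h _] := en_bounds (wave_shift 0 hS) (L2f_shift 0 hS hu).
  by apply: le_trans h; rewrite mulr_ge0 ?mulr_ge0 ?I_ge0 ?ltW// => x; exact: sqr_ge0.
have B2 : 2 * N <= B.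
  by rewrite /B lerDl divr_ge0 ?(ltW D0)// mulr_ge0// addr_ge0// divr_ge0 ?mulr_ge0 ?addr_ge0// ltW.
have B0 : 0 <= B by apply: le_trans B2; rewrite mulr_ge0.
have far Z : B <= `|Z| -> g 0 < g Z.
  move=> BZ; have hZ := hN Z (le_trans B2 BZ).
  have Lw := L2f_shift Z hS hu; have Ld := wave_shift_L2 dX cX1 X0 Z hS.
  have /andP[h _] := en_bounds (wave_shift Z hS) Lw.
  have tri : I (fun x => (shift_by S Z x - S x) ^+ 2) <=
      2 * I (fun x => (u x - S x) ^+ 2) + 2 * I (fun x => (u x - shift_by S Z x) ^+ 2).
    rewrite -!IZ; [|exact: Lw.2|exact: hu.2].
    rewrite -ID; [|by apply: itgZ; exact: hu.2|by apply: itgZ; exact: Lw.2].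
    apply: I_le => [||x]; first exact: Ld.2.
      by apply: itgD; apply: itgZ; [exact: hu.2|exact: Lw.2].
    by have := sqr_ge0 ((u x - S x) + (u x - shift_by S Z x)); lra.
  have : D * (`|Z| - 2 * N) >= 2 * (I0 + (g 0 + 1) / (2 * um)).
    by rewrite [leRHS]mulrC -ler_pdivrMr//; move: BZ; rewrite /B; lra.
  rewrite -/D in hZ => h4.
  have h5 : (g 0 + 1) / (2 * um) <= I (fun x => (u x - shift_by S Z x) ^+ 2).
    by move: tri; rewrite -/I0; lra.
  apply: lt_le_trans h; rewrite mulrC; move: h5; rewrite ler_pdivrMr ?mulr_gt0//.
  by lra.
have BB : - B <= B by lra.
have [Z ZB minZ] := EVT_min BB (continuous_subspaceT cg).
have glob Z' : g Z <= g Z'.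
  have [zb|zb] := leP B `|Z'|.
    apply: le_trans (ltW (far _ zb)); apply: minZ.
    by rewrite in_itv/=; apply/andP; split; lra.
  by apply: minZ; rewrite in_itv/=; rewrite -ler_norml ltW.
exists Z; split; first exact: glob.
have [C C0 hC] := expn Z; set c := crit _ _ in hC *.
apply/eqP; rewrite -normr_le0; apply/ler_addgt0Pr => e e0; rewrite add0r.
pose t := Num.min 1 (e / (C + 1)).
have t0 : 0 < t by rewrite lt_min ltr01 divr_gt0//; lra.
have t1 : t <= 1 by rewrite ge_min lexx.
have te : C * t <= e.
  have : t <= e / (C + 1) by rewrite ge_min lexx orbT.
  by rewrite ler_pdivlMr; lra.
have key h : `|h| <= 1 -> h * c <= C * h ^+ 2.
  by move=> /hC /(le_trans (ler_norm _)); have := glob (Z + h); rewrite /g; lra.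
have k1 : t * c <= C * t ^+ 2 by apply: key; rewrite ger0_norm// ltW.
have k2 : - t * c <= C * t ^+ 2.
  by rewrite -(sqrrN t); apply: key; rewrite normrN ger0_norm// ltW.
have a1 : c <= C * t by rewrite -(ler_pM2l t0); move: k1; lra.
have a2 : - c <= C * t by rewrite -(ler_pM2l t0); move: k2; lra.
by rewrite ler_norml; apply/andP; split; lra.
Qed.
End energy.

(** * Bochner spaces *)
Section sobolev_bridge.
Context {R : realType}.
Local Notation mu := (@lebesgue_measure R).
Implicit Types (f g h : R -> R) (v w : R -> R -> R).

Lemma L2_L2f g : L2 g -> L2f g.
Proof.
move=> h; split; last exact: Lfun2_integrable_sqr.
by move: h; rewrite /L2 inE => /andP[]; rewrite inE.
Qed.

Lemma sobolev_L2f k g : sobolev k g -> L2f g.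
Proof. by case: k => [|k] [h _]; exact: L2_L2f. Qed.

Lemma Lnorm_sqr g : L2f g -> ('N[mu]_2%:E[EFin \o g] ^+ 2 = (I (fun x => g x ^+ 2))%:E)%E.
Proof.
move=> hg; have h : ('N[mu]_2%:E[EFin \o g] `^ 2 = (I (fun x => g x ^+ 2))%:E)%E.
  rewrite poweR_Lnorm// EFin_I; last exact: hg.2.
  apply: eq_integral => x _ /=.
  by rewrite powR_mulrn// real_normK ?num_real.
have := Lnorm_ge0 mu 2%:E (EFin \o g); move: h; case: ('N[mu]_2%:E[EFin \o g])%E => [r| |].
- by rewrite lee_fin poweR_EFin => + r0; rewrite powR_mulrn// => <-.
- by rewrite poweRyr.
- by [].
Qed.

Lemma sobolev_norm_ge k g : L2f g -> ((I (fun x => g x ^+ 2))%:E <= sobolev_norm k g ^+ 2)%E.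
Proof.
move=> hg; have nn j : (0 <= 'N[mu]_2%:E[EFin \o iter j weak_derivative g] ^+ 2)%E.
  by rewrite expe_ge0// Lnorm_ge0.
rewrite /sobolev_norm sqr_sqrte; last by apply: sume_ge0.
rewrite big_ord_recl -Lnorm_sqr//; apply: leeDl; exact: sume_ge0.
Qed.

Lemma sobolev_norm0 g : L2f g -> (sobolev_norm 0 g ^+ 2 = (I (fun x => g x ^+ 2))%:E)%E.
Proof.
move=> hg; rewrite /sobolev_norm big_ord1 sqr_sqrte; first exact: Lnorm_sqr.
exact: sqre_ge0.
Qed.

Lemma sobolev_norm_small k g e : 0 <= e -> L2f g -> (sobolev_norm k g < e%:E)%E ->
  I (fun x => g x ^+ 2) <= e ^+ 2.
Proof.
move=> e0 hg h; rewrite -lee_fin; apply: le_trans (sobolev_norm_ge k hg) _.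
by rewrite EFin_expe lee_sqr ?sqrte_ge0 ?lee_fin// ltW.
Qed.

Lemma near_ereal0 (T : Type) (F : set_system T) (FF : Filter F) (X : T -> \bar R) (e : R) :
  0 < e -> X @ F --> 0%E -> \forall t \near F, (X t < e%:E)%E.
Proof.
move=> e0 h; apply: (h [set y | (y < e%:E)%E]).
by apply: open_nbhs_nbhs; split; [exact: open_ereal_lt_ereal|rewrite /= lte_fin].
Qed.

Lemma continuous_in_sobolev_L2 k T v : continuous_in_sobolev k T v ->
  (forall t, 0 <= t <= T -> L2f (v t)) /\
  forall t0 e, 0 <= t0 <= T -> 0 < e -> exists2 d, 0 < d & forall t, 0 <= t <= T ->
    `|t - t0| < d -> I (fun x => (v t x - v t0 x) ^+ 2) <= e.
Proof.
move=> [h1 h2]; have L t : 0 <= t <= T -> L2f (v t) by move=> /h1; exact: sobolev_L2f.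
split => // t0 e t0T e0.
have se : 0 < Num.sqrt e by rewrite sqrtr_gt0.
have := near_ereal0 _ se (h2 t0 t0T); rewrite near_withinE => -[d /= d0 hd].
exists d => // t tT td; rewrite -(sqr_sqrtr (ltW e0)).
apply: (@sobolev_norm_small k (fun x => v t x - v t0 x)); [exact: ltW|exact: L2fB (L _ tT) (L _ t0T)|].
by apply: hd; rewrite /= ?in_itv// distrC.
Qed.

Lemma I_sq_diff f g : L2f f -> L2f g -> forall t, 0 < t ->
  `|I (fun x => f x ^+ 2) - I (fun x => g x ^+ 2)| <=
  t * I (fun x => g x ^+ 2) + (1 + t^-1) * I (fun x => (g x - f x) ^+ 2).
Proof.
move=> hf hg t t0; have hd := L2fB hg hf.
have -> : I (fun x => f x ^+ 2) - I (fun x => g x ^+ 2) =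
    I (fun x => (g x - f x) ^+ 2) - 2 * I (fun x => g x * (g x - f x)).
  rewrite -IZ; last exact: L2f_mul.
  rewrite -!IB; [|exact: hd.2|by apply: itgZ; exact: L2f_mul|exact: hf.2|exact: hg.2].
  by apply: I_ext => x; ring.
apply: le_trans (ler_normB _ _) _.
rewrite ger0_norm; last by apply: I_ge0 => x; exact: sqr_ge0.
have := young_I t0 hg hd; rewrite normrM (ger0_norm (ler0n _ 2)) invfM.
by move: (`|_|) => a; lra.
Qed.

(* No measurability of g: the integral of g is a supremum over simple functions
   below it. *)
Lemma ge0_integral_mono (D : set R) (f g : R -> \bar R) : (forall x, 0 <= f x)%E ->
  (forall x, D x -> 0 <= g x)%E -> (forall x, D x -> f x <= g x)%E -> (forall x, ~ D x -> f x = 0%E) ->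
  (\int[mu]_x f x <= \int[mu]_(x in D) g x)%E.
Proof.
move=> f0 g0 fg fD; rewrite ge0_integralTE// ge0_integralE//.
apply: le_ereal_sup => _ [h /= hf <-]; exists h => // x.
apply: le_trans (hf x) _; rewrite patchE; case: ifPn => [/set_mem/fg//|/negP xD].
by rewrite fD// => /mem_set.
Qed.

Lemma itg_sum n (F : 'I_n -> R -> R) : (forall i, itg (F i)) ->
  itg (fun x => \sum_(i < n) F i x) /\ I (fun x => \sum_(i < n) F i x) = \sum_(i < n) I (F i).
Proof.
elim: n F => [|n IH] F hF.
  rewrite (_ : (fun x => _) = fun=> 0); last by apply/funext => x; rewrite big_ord0.
  rewrite big_ord0; split; first exact: integrable0.
  by rewrite /I Rintegral_cst// mul0r.
have [h1 h2] := IH (fun i => F (widen_ord (leqnSn n) i)) (fun i => hF _).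
rewrite (_ : (fun x => _) = fun x => \sum_(i < n) F (widen_ord (leqnSn n) i) x + F ord_max x); last first.
  by apply/funext => x; rewrite big_ord_recr.
by split; [exact: itgD|rewrite ID// h2 big_ord_recr].
Qed.

(** Expanding the square turns the energy into a finite sum of indicators in [t] with constant
    coefficients. *)
Lemma simple_energy_measurable (s : R -> R -> R) : simple_valued 0 s ->
  measurable_fun setT (fun t => I (fun x => s t x ^+ 2)) /\ forall t, L2f (s t).
Proof.
move=> [N [A [g [mA hg hs]]]].
have Lg i : L2f (g i) by exact: sobolev_L2f (hg i).
have E t : (fun x => s t x ^+ 2) =
    fun x => \sum_(i < N) \sum_(j < N) (\1_(A i) t * \1_(A j) t) * (g i x * g j x).
  apply/funext => x; rewrite hs expr2 big_distrlr/=.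
  by apply: eq_bigr => i _; apply: eq_bigr => j _; ring.
have i1 t i j : itg (fun x => (\1_(A i) t * \1_(A j) t) * (g i x * g j x)).
  by apply: itgZ; exact: L2f_mul.
have i2 t i := itg_sum (i1 t i).
have i3 t := itg_sum (fun i => (i2 t i).1).
split=> [|t].
  rewrite (_ : (fun t => _) = fun t => \sum_(i < N) \sum_(j < N)
    (\1_(A i) t * \1_(A j) t) * I (fun x => g i x * g j x)); last first.
    apply/funext => t; rewrite E (i3 t).2; apply: eq_bigr => i _; rewrite (i2 t i).2.
    by apply: eq_bigr => j _; rewrite IZ//; exact: L2f_mul.
  apply: measurable_sum => i; apply: measurable_sum => j; apply: measurable_funM => //.
  by apply: measurable_funM; apply: measurable_indic.
split; last by rewrite /itg; have := (i3 t).1; rewrite -E.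
rewrite (_ : s t = fun x => \sum_(i < N) \1_(A i) t * g i x); last exact/funext/hs.
by apply: measurable_sum => i; apply: measurable_funM => //; exact: (Lg i).1.
Qed.

(** The energy of [ut] is measurable as a limit of energies of simple functions, but only off a null
    set; [N] is its restriction to the good set and 0 elsewhere. *)
Lemma bochner_L2_energy (T : R) (ut : R -> R -> R) : bochner_L2 0 T ut -> exists N : R -> R,
  [/\ (forall t, 0 <= N t), intg 0 T N &
      {ae mu, forall t, 0 < t < T -> L2f (ut t) /\ I (fun x => ut t x ^+ 2) <= N t}].
Proof.
move=> [aeS0 [s_ [ss [B [mB B0 hB]]]] fin].
have [B' [mB' B'0 hB']] := aeS0.
pose D : set R := `]0, T[%classic `\` (B `|` B').
have mD : measurable D by apply: measurableD => //; exact: measurableU.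
have hD t : D t -> [/\ 0 < t < T, L2f (ut t) &
    sobolev_norm 0 (ut t \- s_ n t) @[n --> \oo] --> 0%E].
  move=> [/=]; rewrite in_itv/= => tT nB; split => //.
    apply: (@sobolev_L2f 0); apply: contrapT => h; apply: nB; right; apply: hB'.
    by move=> h'; apply: h; exact: h'.
  by apply: contrapT => h; apply: nB; left; apply: hB => h'; apply: h; exact: h'.
pose q t := I (fun x => ut t x ^+ 2).
pose N := q \_ D.
have N0 t : 0 <= N t.
  by rewrite /N patchE; case: ifP => // _; apply: I_ge0 => x; exact: sqr_ge0.
have cv t : D t -> I (fun x => s_ n t x ^+ 2) @[n --> \oo] --> q t.
  move=> /hD[_ Lu c]; apply/cvgrPdist_le => e e0.
  have q0 : 0 <= q t by apply: I_ge0 => x; exact: sqr_ge0.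
  (* With this weight in [I_sq_diff] the term with the fixed energy costs at most [e / 2]; [d] below
     then makes the distance term cost the other half. *)
  pose t1 := e / (2 * (q t + 1)).
  have t10 : 0 < t1 by rewrite divr_gt0//; lra.
  pose d := e / (2 * (1 + t1^-1)).
  have ti : 0 < t1^-1 by rewrite invr_gt0.
  have d0 : 0 < d by rewrite divr_gt0//; lra.
  have sd : 0 < Num.sqrt d by rewrite sqrtr_gt0.
  apply: filterS (near_ereal0 _ sd c) => n hn.
  have Ls := (simple_energy_measurable (ss n)).2 t.
  have := @sobolev_norm_small 0 (fun x => ut t x - s_ n t x) _ (ltW sd) (L2fB Lu Ls) hn.
  rewrite sqr_sqrtr ?(ltW d0)// => h; rewrite distrC.
  apply: le_trans (I_sq_diff Ls Lu t10) _; rewrite -/(q t).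
  have a1 : t1 * q t <= e / 2.
    rewrite /t1 mulrAC ler_pdivrMr; last by lra.
    by rewrite (_ : e / 2 * _ = e * (q t + 1)); [apply: ler_wpM2l; lra|field].
  have a2 : (1 + t1^-1) * I (fun x => (ut t x - s_ n t x) ^+ 2) <= e / 2.
    apply: (@le_trans _ _ ((1 + t1^-1) * d)); first by apply: ler_wpM2l => //; lra.
    have n1 : 1 + t1^-1 != 0 by rewrite gt_eqF//; lra.
    rewrite /d le_eqVlt; apply/orP; left; apply/eqP.
    by move: n1; move: (1 + t1^-1) => z n1; field.
  lra.
have mN : measurable_fun setT N.
  apply: (@measurable_fun_cvg _ _ _ _ (fun n => (fun t => I (fun x => s_ n t x ^+ 2)) \_ D)) => [n|t _].
    apply/(measurable_restrictT _ _).1 => //.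
    by apply: measurable_funS (simple_energy_measurable (ss n)).1.
  have [Dt|Dt] := pselect (D t).
    have -> : N t = q t by rewrite /N patchE mem_set.
    apply: (cvg_trans _ (cv t Dt)); apply: near_eq_cvg; apply: nearW => n /=.
    by rewrite patchE mem_set.
  have -> : N t = 0 by rewrite /N patchE memNset.
  by apply: cvg_near_cst; apply: nearW => n /=; rewrite patchE memNset.
exists N; split => //.
- apply: itg_intg; apply/integrableP; split; first exact: measE.
  apply: le_lt_trans fin.
  apply: ge0_integral_mono => [t|t _|t|t].
  + by [].
  + by rewrite sqre_ge0.
  + move=> _; rewrite [X in (X <= _)%E](_ : _ = (N t)%:E); last by rewrite /= ger0_norm.
    rewrite /N patchE; case: ifPn => [/set_mem/hD[_ Lu _]|_]; last exact: sqre_ge0.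
    by rewrite sobolev_norm0.
  + move=> h; rewrite /= /N patchE; case: ifPn => [/set_mem[]//|_].
    by rewrite normr0.
have nBB : {ae mu, forall t, ~ (B `|` B') t}.
  exists (B `|` B'); split; first exact: measurableU.
    by apply: null_set_setU.
  by move=> t /=; exact: contrapT.
apply: aeS nBB => t h tT; have Dt : D t by split; rewrite //= in_itv.
have [_ Lu _] := hD t Dt; split => //.
by rewrite /N patchE mem_set.
Qed.
End sobolev_bridge.

Section ae_transfer.
Context {R : realType}.
Local Notation mu := (@lebesgue_measure R).
Implicit Types (f g : R -> R).

Lemma int_ae a b f g : {ae mu, forall x, f x = g x} -> intg a b f -> intg a b g ->
  int a b f = int a b g.
Proof.
move=> fg ifi ig; rewrite /int /Rintegral; congr fine.
have mf : measurable_fun `[a, b] (EFin \o f) := measurable_int mu ifi.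
have mg : measurable_fun `[a, b] (EFin \o g) := measurable_int mu ig.
have H : ae_eq mu `[a, b]%classic (EFin \o f) (EFin \o g).
  by apply: aeS fg => x fgx _ /=; rewrite fgx.
have mab : measurable `[a, b]%classic by exact: measurable_itv.
exact: (@ae_eq_integral _ _ _ mu _ (EFin \o g) (EFin \o f) mab mf mg H).
Qed.

Lemma itg_ae f g : measurable_fun setT g -> {ae mu, forall x, f x = g x} -> itg f -> itg g.
Proof.
move=> mg fg /integrableP[mf fin]; apply/integrableP; split; first exact: measE.
have mfa : measurable_fun setT (abse \o (EFin \o f)) by exact: measurableT_comp.
have mga : measurable_fun setT (abse \o (EFin \o g)).
  by apply: measurableT_comp => //; exact: measE.
have H : ae_eq mu setT (abse \o (EFin \o f)) (abse \o (EFin \o g)).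
  by apply: aeS fg => x fgx _ /=; rewrite fgx.
by have <- := @ae_eq_integral _ _ _ mu setT _ _ measurableT mfa mga H.
Qed.

Lemma L2f_ae f g : measurable_fun setT g -> {ae mu, forall x, f x = g x} -> L2f f -> L2f g.
Proof.
move=> mg fg [mf hf]; split => //; apply: (itg_ae _ _ hf); first exact: measurable_funX.
by apply: aeS fg => x ->.
Qed.

Lemma L2f_intg a b f : L2f f -> intg a b f.
Proof.
move=> [mf hf]; have i1 : intg a b (fun x => 1 + f x ^+ 2).
  by apply: intgD; [apply: intg_cont => ?; exact: cvg_cst|exact: itg_intg].
apply: (le_integrable _ _ _ i1) => //; first exact: measurable_funS (measE mf).
move=> x _; rewrite /= lee_fin [leRHS]ger0_norm ?addr_ge0 ?sqr_ge0//.
exact: norm_le_1D_sqr.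
Qed.

Lemma cont_locint f : continuous f -> locally_integrable setT f.
Proof.
move=> cf; split; [exact: continuous_measurable_fun|exact: openT|move=> K _ cK].
have /integrableP[_ h] : mu.-integrable K (EFin \o f).
  by apply: continuous_compact_integrable => //; exact: continuous_subspaceT.
exact: h.
Qed.

Lemma increments_der f g : continuous g -> (forall a b, a <= b -> f b - f a = int a b g) ->
  forall x : R, is_derive x 1 f (g x).
Proof.
move=> cg h x; have [P dP hP] := primitive_exists cg.
have E : f = fun y => P y + (f 0 - P 0).
  apply/funext => y; have [y0|/ltW y0] := leP 0 y.
    by have := h _ _ y0; rewrite hP//; lra.
  by have := h _ _ y0; rewrite hP//; lra.
by rewrite E; apply: derE (derD (dP x) (derC (f 0 - P 0) x)) _; rewrite addr0.
Qed.
End ae_transfer.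

Section at_time.
Context {R : realType}.
Local Notation mu := (@lebesgue_measure R).
Context (um e k : R) (f f1 f2 : R -> R).
Hypotheses (um0 : 0 < um) (e0 : 0 <= e) (ek : 100 * e <= k) (k1 : 500 * (500 * k) <= 1).
Hypotheses (df : forall x : R, is_derive x 1 f (f1 x))
  (df1 : forall x : R, is_derive x 1 f1 (f2 x))
  (hq : forall y : R, `|f2 y - 6 * y| <= e * (um + `|y|)).
Local Notation X := (excess um f f1).
Context (ul : R) (hul : left_root um f f1 ul).
Let e1 : 1000 * e <= 1. Proof. by move: e0 ek k1; lra. Qed.
Let dX := excess_der um df.
Let cX1 : continuous (fun x => f1 x - f1 um).
Proof. by move=> x; apply: cvgB; [exact: der_cont (df1 x)|exact: cvg_cst]. Qed.
Let X0 y : ul < y < um -> 0 < X y.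
Proof. exact: (excess_gt0 um0 e0 e1 df df1 hq hul). Qed.
Let cf : continuous f. Proof. by move=> x; exact: der_cont (df x). Qed.

Lemma wave_speed_L2 S : wave X ul um S -> L2f (fun x => X (S x)).
Proof.
move=> hS; have [M M0 hM] := X_bounded ul um dX; have iF := wave_speed_itg dX X0 hS.
split; first exact: itg_meas iF.
apply: (itg_le _ (itgZ M iF)); first by apply: measurable_funX; exact: itg_meas iF.
move=> x; have F0 := ltW (wave_speed_gt0 X0 x hS).
by rewrite ger0_norm ?sqr_ge0// expr2 ler_wpM2r//; exact: hM.
Qed.

Lemma spatial_wave S U U1 ut : wave X ul um S ->
  (forall x : R, is_derive x 1 U (U1 x)) -> continuous U1 ->
  (forall a b, a <= b -> U1 b - f (U b) - (U1 a - f (U a)) = int a b ut) -> L2f ut ->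
  L2f (fun x => U x - S x) -> L2f (fun x => U1 x - X (S x)) ->
  I (fun x => (5 * um - S x) * (U x - S x) * ut x) <=
  32 / um * crit X um U S ^+ 2 - f1 um * crit X um U S.
Proof.
move=> hS dU cU1 hut Lut Lw Lw1; have [dS l1 l2 bS] := hS; have [u1 u2 u3] := hul.
have [M M0 hM] := X_bounded ul um dX.
have [Fp dFp _] := primitive_exists cf.
have [x0 Sx0] : exists x, S x = - um.
  by apply: (wave_value hS); have := um0; move=> um0'; apply/andP; split; lra.
apply: (@spatial_ineq R um e k f f1 f2 Fp S U U1 ut um0 e0 ek k1 df df1 hq ul M
  dS _ _ _ u1 u2 u3 l2 l1 (hM S hS) (wave_speed_itg dX X0 hS) dU cU1 _ hut Lut Lw Lw1 x0 Sx0 dFp).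
- by move=> x; exact: (wave_speed_gt0 X0 x hS).
- by move=> x; have /andP[/ltW] := bS x.
- by move=> x; have /andP[_] := bS x.
- by move=> a b; exact: L2f_intg.
Qed.

(** All weak derivatives are replaced by continuous representatives: [U] of [u] is then continuously
    differentiable with derivative [U1], and the equation becomes an identity for the increments of
    [U1 - f U]. The square integrability of [U1 - X (T x)] comes from the Sobolev hypothesis
    relative to [uS], since [X (uS x) - X (T x)] is square integrable. *)
Lemma spatial_at_time uS u ut fx ux uxx Z : wave X ul um uS -> sobolev 1 (u \- uS) ->
  is_weak_derivative setT (f \o u) fx -> is_weak_derivative setT u ux ->
  is_weak_derivative setT ux uxx -> L2 ut -> {ae mu, forall x, ut x + fx x = uxx x} ->
  I (fun x => (5 * um - shift_by uS Z x) * (u x - shift_by uS Z x) * ut x) <=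
  32 / um * crit X um u (shift_by uS Z) ^+ 2 - f1 um * crit X um u (shift_by uS Z).
Proof.
move=> hS [Lv [h wh /= [Lh _]]] wf wu wux /L2_L2f Lut eqn.
move: Lv Lh => /L2_L2f Lv /L2_L2f Lh.
have hT := wave_shift Z hS; set T := shift_by uS Z in hT *.
have [U [cU uU incU]] := ac_rep wu; have [U1 [cU1 uU1 incU1]] := ac_rep wux.
have [G [cG fG incG]] := ac_rep wf; have [V [cV vV incV]] := ac_rep wh.
have cS := wave_cont hS; have cT := wave_cont hT.
have ia (a b : R) g g' : is_weak_derivative setT g g' -> intg a b g /\ intg a b g'.
  by move=> [l1 l2 _]; split; exact: locint_intgT.
have incU' (a b : R) : a <= b -> U b - U a = int a b U1.
  by move=> ab; rewrite incU// (int_ae uU1 (ia a b _ _ wu).2 (intg_cont a b cU1)).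
have dU := increments_der cU1 incU'.
(* Two continuous functions equal almost everywhere coincide, so the increments of [f \o U] are
   integrals of [fx] and no weak chain rule is called for. *)
have EG : G = f \o U.
  apply: ae_eq_continuous => //.
    by move=> x; apply: (@continuous_comp _ _ _ U f); [exact: cU|exact: cf].
  by apply: aeS (aeI fG uU) => x [<- /= ->].
have hut (a b : R) : a <= b -> U1 b - f (U b) - (U1 a - f (U a)) = int a b ut.
  move=> ab; have := incG _ _ ab; rewrite EG /= => h1; have h2 := incU1 _ _ ab.
  have -> : U1 b - f (U b) - (U1 a - f (U a)) = int a b uxx - int a b fx by rewrite -h1 -h2; ring.
  rewrite -intB; [|exact: (ia a b _ _ wux).2|exact: (ia a b _ _ wf).2].
  apply: int_ae; [|by apply: intgB; [exact: (ia a b _ _ wux).2|exact: (ia a b _ _ wf).2]|exact: L2f_intg].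
  by apply: aeS eqn => x <-; ring.
have Lw : L2f (fun x => U x - T x).
  have Lu : L2f (fun x => u x - T x) by exact: (L2f_shift dX cX1 X0 Z hS Lv).
  apply: (L2f_ae _ _ Lu); last by apply: aeS uU => x ->.
  by apply: measurable_funB; apply: continuous_measurable_fun.
have EV : V = fun x => U x - uS x.
  apply: ae_eq_continuous => //; first by move=> x; apply: cvgB; [exact: cU|exact: cS].
  by apply: aeS (aeI vV uU) => x [<- <-].
have cF := wave_speed_cont dX hS.
have cUF : continuous (fun x => U1 x - X (uS x)).
  by move=> x; apply: cvgB; [exact: cU1|exact: cF].
have hUF : {ae mu, forall x, h x - (U1 x - X (uS x)) = 0}.
  apply: ae0_int0 => [|a b ab].
    by apply: locintB; [have [] := wh|exact: cont_locint].
  rewrite intB; [|exact: (ia a b _ _ wh).2|exact: intg_cont].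
  have [dS _ _ _] := hS.
  rewrite (ftc_int cUF (fun x => derB (dU x) (dS x)) ab) -incV// EV; ring.
have LUF : L2f (fun x => U1 x - X (uS x)).
  apply: (L2f_ae _ _ Lh); first exact: continuous_measurable_fun.
  by apply: aeS hUF => x /eqP; rewrite subr_eq0 => /eqP.
have Lw1 : L2f (fun x => U1 x - X (T x)).
  rewrite (_ : (fun x => _) = fun x => U1 x - X (uS x) + (X (uS x) - X (T x))).
    by apply: L2fD => //; apply: L2fB; exact: wave_speed_L2.
  by apply/funext => x; ring.
have Lu : L2f (fun x => u x - T x) by exact: (L2f_shift dX cX1 X0 Z hS Lv).
have ul3 : - (3 * um) <= ul by have [u1 _ _] := hul; have := um0; lra.
have := spatial_wave hT dU cU1 hut Lut Lw Lw1.
have -> : crit X um U T = crit X um u T.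
  rewrite /crit; apply: I_ae.
  - by apply: aeS uU => x ->.
  - exact: (crit_itg dX X0 um0 ul3 hT Lw).
  - exact: (crit_itg dX X0 um0 ul3 hT Lu).
congr (_ <= _); apply: I_ae.
- by apply: aeS uU => x ->.
- exact: (L2f_mul (L2f_weight um0 ul3 hT Lw) Lut).
- exact: (L2f_mul (L2f_weight um0 ul3 hT Lu) Lut).
Qed.
End at_time.

(** * Evolution of the minimal energy *)
Section chaining.
Context {R : realType}.

(** Compactness of the segment in the form of real induction: the supremum of the points reachable
    from [a] is itself reached and can be passed unless it is [b]. *)
Lemma chain_local (P : R -> R -> Prop) (a b : R) : a <= b ->
  (forall x y z, a <= x -> x <= y -> y <= z -> z <= b -> P x y -> P y z -> P x z) ->
  (forall t, a <= t <= b -> exists2 d, 0 < d & forall x y, a <= x -> x <= y -> y <= b ->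
     `|x - t| < d -> `|y - t| < d -> P x y) -> P a b.
Proof.
move=> ab tr loc; pose A : set R := [set t | a <= t <= b /\ P a t].
have Aa : A a.
  have aab : a <= a <= b by rewrite lexx.
  split => //; have [d d0] := loc a aab.
  by apply; rewrite ?lexx ?subrr ?normr0.
have Ab : has_sup A by split; [exists a|exists b => t [/andP[]]].
pose c := sup A.
have cb : c <= b by apply: ge_sup; [exists a|move=> t [/andP[]]].
have ac : a <= c by apply: ub_le_sup => //; exact: Ab.2.
have [|d d0 hd] := loc c; first by rewrite ac.
have [x [/andP[ax xb] Px] xc] := sup_adherent d0 Ab.
have xc' : x <= c by apply: ub_le_sup => //; [exact: Ab.2|split; rewrite ?ax].
pose y := Num.min b (c + d / 2).
have cy : c <= y by rewrite le_min cb lerDl divr_ge0// ltW.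
have yb : y <= b by rewrite ge_min lexx.
have yd : y <= c + d / 2 by rewrite ge_min lexx orbT.
have Py : P a y.
  apply: (tr a x y) => //; first exact: le_trans cy.
  apply: hd => //; first exact: le_trans cy.
    by rewrite ler0_norm ?subr_le0//; move: xc; rewrite -/c; lra.
  by rewrite ger0_norm ?subr_ge0//; lra.
have : y <= c by apply: ub_le_sup; [exact: Ab.2|split; rewrite ?yb ?(le_trans ac)].
move=> yc; have yE : y = c by apply/eqP; rewrite eq_le yc.
suff -> : b = y by [].
by move: yE; rewrite /y; case: leP => // h E; move: d0; lra.
Qed.

End chaining.

Section time_integrals.
Context {R : realType}.
Local Notation mu := (@lebesgue_measure R).
Implicit Types (f g phi uS : R -> R) (u ut : R -> R -> R).

(** The minimum of the two functions equals [f] almost everywhere and is below [g] everywhere. *)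
Lemma int_le_ae a b f g : intg a b f -> intg a b g ->
  {ae mu, forall x, a <= x <= b -> f x <= g x} -> int a b f <= int a b g.
Proof.
move=> hf hg fg; pose h x := Num.min (f x) (g x).
have mab : measurable `[a, b]%classic by exact: measurable_itv.
have mf : measurable_fun `[a, b] f by apply/measurable_EFinP; exact: measurable_int hf.
have mg : measurable_fun `[a, b] g by apply/measurable_EFinP; exact: measurable_int hg.
have mh : measurable_fun `[a, b] h by exact: measurable_minr.
have ih : intg a b h.
  apply: (le_integrable _ _ _ (intgD (intgN hf) (intgN hg))) => //.
    exact/measurable_EFinP.
  move=> x _; rewrite /= lee_fin [leRHS]ger0_norm ?addr_ge0// /h.
  by have [_|_] := leP (f x) (g x); [rewrite lerDl|rewrite lerDr]; exact: normr_ge0.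
have -> : int a b f = int a b h.
  rewrite /int /Rintegral; congr fine.
  have mf' : measurable_fun `[a, b] (EFin \o f) := measurable_int mu hf.
  have mh' : measurable_fun `[a, b] (EFin \o h) := measurable_int mu ih.
  have H : ae_eq mu `[a, b]%classic (EFin \o f) (EFin \o h).
    by apply: aeS fg => x fgx; rewrite /= in_itv/= => /fgx /min_idPl <-.
  exact: (@ae_eq_integral _ _ _ mu _ (EFin \o h) (EFin \o f) mab mf' mh' H).
by apply: le_int => // x _; rewrite /h ge_min lexx orbT.
Qed.

Lemma test_itg f phi : continuous f -> test_function setT phi -> itg (fun x => f x * phi x).
Proof.
move=> cf [sp [K [cK _ K0]]].
have cp : continuous phi := (sp 0%N).2.
have [n hn] : exists n : R, K `<=` `[- n, n]%classic.
  have [n [_ hn]] := compact_bounded cK.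
  exists (n + 1) => x Kx; rewrite /= in_itv/= -ler_norml; apply: (hn (n + 1)) => //.
  by rewrite ltrDl.
rewrite (_ : (fun x => _) = (fun x => f x * phi x) \_ `[- n, n]); last first.
  apply/funext => x; rewrite patchE; case: ifPn => // xn; rewrite K0 ?mulr0// => /hn xn'.
  by move: xn; rewrite mem_set.
rewrite /itg -restrict_EFin; apply/integrable_restrict => //=; rewrite setTI.
by apply: (@intg_cont R (- n) n) => x; apply: cvgM; [exact: cf|exact: cp].
Qed.

(** The pairing with [phi] is continuous in time, so every interior time is a right Lebesgue point
    and the weak derivative integrates between any two of them. [u] itself need not be square
    integrable; its pairing is split into those of [u - uS] and of [uS], the latter finite by
    compact support. *)
Lemma time_increment (T : R) u ut uS phi (s t : R) : 0 < s -> s < t -> t < T ->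
  is_time_derivative T u ut -> test_function setT phi -> L2f phi -> continuous uS ->
  (forall r, 0 <= r <= T -> L2f (fun x => u r x - uS x)) ->
  (forall r e, 0 <= r <= T -> 0 < e -> exists2 d, 0 < d & forall r', 0 <= r' <= T ->
    `|r' - r| < d -> I (fun x => (u r' x - u r x) ^+ 2) <= e) ->
  intg s t (fun r => I (fun x => ut r x * phi x)) /\
  I (fun x => (u t x - u s x) * phi x) = int s t (fun r => I (fun x => ut r x * phi x)).
Proof.
move=> s0 st tT td tp Lp cS Lv cv; have w := td _ tp; have [lg lh _] := w.
have sub a b : 0 < a -> b < T -> `[a, b]%classic `<=` `]0, T[%classic.
  by move=> a0 bT; apply: subset_itv; rewrite bnd_simp.
have iup r : 0 <= r <= T -> itg (fun x => u r x * phi x).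
  move=> rT; have := itgD (L2f_mul (Lv r rT) Lp) (test_itg cS tp).
  by congr itg; apply/funext => x; ring.
have sT r : s <= r -> r <= t -> 0 <= r <= T by move=> h1 h2; apply/andP; split; lra.
have gd r r' : 0 <= r <= T -> 0 <= r' <= T ->
    I (fun x => u r x * phi x) - I (fun x => u r' x * phi x) = I (fun x => (u r x - u r' x) * phi x).
  move=> h1 h2; rewrite -IB; [|exact: iup..].
  by apply: I_ext => x; ring.
have Ld r r' : 0 <= r <= T -> 0 <= r' <= T -> L2f (fun x => u r x - u r' x).
  move=> h1 h2; have := L2fB (Lv r h1) (Lv r' h2).
  by congr L2f; apply/funext => x; ring.
have cg r : 0 < r -> r < T -> {for r, continuous (fun r => I (fun x => u r x * phi x))}.
  move=> r0 rT; apply: eps_cont => e e0.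
  have rr : 0 <= r <= T by rewrite !ltW.
  pose P := I (fun x => phi x ^+ 2) + 1.
  have P1 : 1 <= P by rewrite lerDr; apply: I_ge0 => x; exact: sqr_ge0.
  have t0 : 0 < P / e by rewrite divr_gt0//; lra.
  have e1 : 0 < e ^+ 2 / P by rewrite divr_gt0 ?exprn_gt0//; lra.
  have [d d0 hd] := cv r _ rr e1.
  exists (Num.min d (Num.min r (T - r))).
    by rewrite !lt_min d0 r0 subr_gt0.
  move=> y; rewrite !lt_min => /andP[y1 /andP[]]; rewrite !ltr_norml => /andP[y2 y3] /andP[y4 y5].
  have yT : 0 <= y <= T by apply/andP; split; lra.
  rewrite gd//; apply: le_trans (young_I t0 (Ld y r yT rr) Lp) _.
  have h1 : P / e / 2 * I (fun x => (u y x - u r x) ^+ 2) <= e / 2.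
    apply: le_trans (_ : P / e / 2 * (e ^+ 2 / P) <= _).
      by apply: ler_wpM2l; [rewrite divr_ge0// ltW|exact: hd].
    by rewrite le_eqVlt; apply/orP; left; apply/eqP; field; rewrite !gt_eqF//; lra.
  have h2 : (2 * (P / e))^-1 * I (fun x => phi x ^+ 2) <= e / 2.
    apply: le_trans (_ : (2 * (P / e))^-1 * P <= _).
      by apply: ler_wpM2l; [rewrite invr_ge0 mulr_ge0// ltW|rewrite /P; lra].
    by rewrite le_eqVlt; apply/orP; left; apply/eqP; field; rewrite !gt_eqF//; lra.
  lra.
pose b := (t + T) / 2.
have tb : t < b by rewrite /b; lra.
have bT : b < T by rewrite /b; lra.
have ig c d : 0 < c -> d < T -> intg c d (fun r => I (fun x => u r x * phi x)).
  by move=> c0 dT; exact: locint_intg lg (sub _ _ c0 dT).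
split; first exact: locint_intg lh (sub _ _ s0 tT).
have p1 : right_pt (fun r => I (fun x => u r x * phi x)) s.
  by apply: (continuous_right_pt st); [exact: ig|apply: cg => //; lra].
have p2 : right_pt (fun r => I (fun x => u r x * phi x)) t.
  by apply: (continuous_right_pt tb); [apply: ig => //; lra|apply: cg => //; lra].
have h1 : 0 <= t <= T by apply: sT => //; exact: ltW.
have h2 : 0 <= s <= T by apply: sT => //; exact: ltW.
rewrite -(gd t s h1 h2).
exact: (weak_increment w (sub _ _ s0 bT) st tb p1 p2).
Qed.

End time_integrals.

Section energy_increment.
Context {R : realType}.
Local Notation mu := (@lebesgue_measure R).
Context (X X1 : R -> R) (ul um : R) (ulum : ul < um).
Hypotheses (dX : forall x : R, is_derive x 1 X (X1 x)) (cX1 : continuous X1)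
  (X0 : forall y, ul < y < um -> 0 < X y) (um0 : 0 < um) (ul3 : - (3 * um) <= ul).
Implicit Types (S u : R -> R).
Local Notation wave := (wave X ul um).

Lemma sqr_I_ge0 (g : R -> R) : 0 <= I (fun x => g x ^+ 2).
Proof. by apply: I_ge0 => x; exact: sqr_ge0. Qed.

Lemma I_sqrD (g h : R -> R) : L2f g -> L2f h -> I (fun x => (g x + h x) ^+ 2) <=
  2 * I (fun x => g x ^+ 2) + 2 * I (fun x => h x ^+ 2).
Proof.
move=> hg hh; rewrite -!IZ; [|exact: hh.2|exact: hg.2].
rewrite -ID; [|by apply: itgZ; exact: hg.2|by apply: itgZ; exact: hh.2].
apply: I_le => [||x]; first exact: (L2fD hg hh).2.
  by apply: itgD; apply: itgZ; [exact: hg.2|exact: hh.2].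
by have := sqr_ge0 (g x - h x); lra.
Qed.

Lemma I_weight_sqr S w : wave S -> L2f w ->
  I (fun x => ((5 * um - S x) * w x) ^+ 2) <= 64 * um ^+ 2 * I (fun x => w x ^+ 2).
Proof.
move=> hS hw; rewrite -IZ; last exact: hw.2.
apply: I_le => [||x]; first exact: (L2f_weight um0 ul3 hS hw).2.
  by apply: itgZ; exact: hw.2.
rewrite exprMn ler_wpM2r ?sqr_ge0//.
have /andP[a1 a2] := weight_bound um0 ul3 x hS.
rewrite (_ : 64 * um ^+ 2 = (8 * um) ^+ 2); last by ring.
by rewrite ler_sqr ?nnegrE//; have := um0; lra.
Qed.

Lemma wave_speed_I S : wave S -> I (fun x => X (S x)) <= um - ul.
Proof.
move=> hS; have iF := wave_speed_itg dX X0 hS; have [dS _ _ bS] := hS.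
have h := int_lim iF (fun n => lexx (- n%:R)) (fun n => lexx n%:R).
rewrite -(cvg_lim (@Rhausdorff R) h); apply: limr_le; first by apply/cvg_ex; eexists; exact: h.
apply: nearW => n; have nn : - n%:R <= n%:R :> R by rewrite ge0_cp.
rewrite (ftc_int (wave_speed_cont dX hS) dS nn).
by have /andP[? ?] := bS n%:R; have /andP[? ?] := bS (- n%:R); lra.
Qed.

(** Difference of squares: with the average of the two perturbations in place of either, no
    remainder quadratic in [u - u'] appears. *)
Lemma en_diff S u u' : wave S -> L2f (fun x => u x - S x) -> L2f (fun x => u' x - S x) ->
  en um u S - en um u' S = I (fun x => (u x - u' x) *
    ((5 * um - S x) * (2^-1 * ((u x - S x) + (u' x - S x))))).
Proof.
move=> hS h h'; have i1 := en_itg um0 ul3 hS h; have i2 := en_itg um0 ul3 hS h'.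
rewrite /en -mulrBl -IB// mulrC -IZ; last exact: itgB.
by apply: I_ext => x; field.
Qed.

(** Same factorisation for the first variation. The factor of [u - u'] is square integrable because
    its part without decay, the weight, is multiplied by the integrable [X (S x)]. *)
Lemma crit_diff M S u u' (th : R) : (forall x, X (S x) <= M) -> 0 < th ->
  wave S -> L2f (fun x => u x - S x) -> L2f (fun x => u' x - S x) ->
  `|crit X um u S - crit X um u' S| <= th / 2 * I (fun x => (u x - u' x) ^+ 2) +
   (2 * th)^-1 * (128 * um ^+ 2 * M * (um - ul) +
     M ^+ 2 * (I (fun x => (u x - S x) ^+ 2) + I (fun x => (u' x - S x) ^+ 2))).
Proof.
move=> hM th0 hS h h'; have iF := wave_speed_itg dX X0 hS.
have F0 x : 0 <= X (S x) by exact: ltW (wave_speed_gt0 X0 x hS).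
have M0 : 0 <= M by exact: le_trans (F0 0) (hM 0).
pose G x := X (S x) * (2^-1 * ((u x - S x) + (u' x - S x)) + (5 * um - S x)).
have iB := itgD (itgZ (128 * um ^+ 2 * M) iF) (itgZ (M ^+ 2) (itgD h.2 h'.2)).
have mG : measurable_fun setT G.
  apply: measurable_funM; first exact: itg_meas iF.
  apply: measurable_funD; last exact: (meas_weight hS).
  apply: measurable_funM => //; apply: measurable_funD; [exact: h.1|exact: h'.1].
have GB x : G x ^+ 2 <= 128 * um ^+ 2 * M * X (S x) +
    M ^+ 2 * ((u x - S x) ^+ 2 + (u' x - S x) ^+ 2).
  rewrite /G exprMn; have := F0 x; have := hM x.
  have /andP[] := weight_bound um0 ul3 x hS.
  move: (X (S x)) (5 * um - S x) (u x - S x) (u' x - S x) => F a w w' a1 a2 F1 F2.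
  have FM : F ^+ 2 <= M * F by rewrite expr2 ler_wpM2r.
  have FM2 : F ^+ 2 <= M ^+ 2 by rewrite ler_sqr ?nnegrE.
  have aa : a ^+ 2 <= 64 * um ^+ 2.
    rewrite (_ : 64 * um ^+ 2 = (8 * um) ^+ 2); last by ring.
    by rewrite ler_sqr ?nnegrE//; have := um0; lra.
  have s1 : (2^-1 * (w + w') + a) ^+ 2 <= (w ^+ 2 + w' ^+ 2) + 2 * (64 * um ^+ 2).
    have := sqr_ge0 (2^-1 * (w + w') - a); have := sqr_ge0 (w - w'); lra.
  apply: le_trans (ler_wpM2l (sqr_ge0 F) s1) _; rewrite mulrDr addrC.
  apply: lerD; last by rewrite ler_wpM2r ?addr_ge0 ?sqr_ge0.
  rewrite (_ : 128 * um ^+ 2 * M * F = M * F * (2 * (64 * um ^+ 2))); last by ring.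
  apply: ler_wpM2r => //; apply: mulr_ge0 => //; apply: mulr_ge0 => //; exact: sqr_ge0.
have LG : L2f G.
  split => //; apply: (itg_le _ iB); first exact: measurable_funX.
  by move=> x; rewrite ger0_norm ?sqr_ge0.
have Ld : L2f (fun x => u x - u' x).
  by have := L2fB h h'; congr L2f; apply/funext => x; ring.
have -> : crit X um u S - crit X um u' S = I (fun x => (u x - u' x) * G x).
  rewrite /crit -IB; [|exact: (crit_itg dX X0 um0 ul3 hS)..].
  by apply: I_ext => x; rewrite /G; field.
apply: le_trans (young_I th0 Ld LG) _; rewrite lerD2l.
apply: ler_wpM2l; first by rewrite invr_ge0 mulr_ge0// ltW.
apply: le_trans (I_le LG.2 iB GB) _.
rewrite ID; [|exact: itgZ|by apply: itgZ; apply: itgD; [exact: h.2|exact: h'.2]].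
rewrite !IZ//; last by apply: itgD; [exact: h.2|exact: h'.2].
rewrite ID; [|exact: h.2|exact: h'.2]; rewrite lerD2r.
apply: ler_wpM2l; last exact: wave_speed_I.
by apply: mulr_ge0 => //; apply: mulr_ge0 => //; exact: sqr_ge0.
Qed.

Section rate.
Context (S : R -> R) (hS : wave S) (sg M : R) (hM : forall x, X (S x) <= M).
Context (us ut ur udot phi : R -> R).
Hypotheses (Ls : L2f (fun x => us x - S x)) (Lt : L2f (fun x => ut x - S x))
  (Lr : L2f (fun x => ur x - S x)) (Lud : L2f udot) (Lphi : L2f phi).

(** The constant of [crit_diff] for perturbations of squared size [4 B + 2] and [2 B], which
    explains [6 B + 2]. *)
Definition crit_const (B : R) : R :=
  (1 + (128 * um ^+ 2 * M * (um - ul) + M ^+ 2 * (6 * B + 2))) / 2.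

Definition rate_const (B : R) : R :=
  1 + 161 * um ^+ 2 + 32 / um * crit_const B ^+ 2 + `|sg| * crit_const B.

Lemma rate_const_ge0 B : 0 <= B -> 0 <= M -> 0 <= rate_const B.
Proof.
move=> B0 M0; rewrite /rate_const.
have ul0 : 0 <= um - ul by have := ulum; lra.
have u2 := sqr_ge0 um; have M2 := sqr_ge0 M.
have Q0 : 0 <= crit_const B.
  have h1 : 0 <= 128 * um ^+ 2 * M * (um - ul) by do 3 (apply: mulr_ge0 => //).
  have h2 : 0 <= M ^+ 2 * (6 * B + 2) by apply: mulr_ge0 => //; lra.
  by rewrite /crit_const; lra.
move: Q0; move: (crit_const B) => Q Q0.
have h3 : 0 <= 32 / um * Q ^+ 2 by rewrite mulr_ge0 ?sqr_ge0// divr_ge0// ltW.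
have h4 : 0 <= `|sg| * Q by rewrite mulr_ge0.
lra.
Qed.

Lemma rate_bound (B eta n : R) : 0 < eta -> eta <= 1 ->
  I (fun x => (us x - S x) ^+ 2) <= 2 * B -> crit X um us S = 0 ->
  I (fun x => (ut x - us x) ^+ 2) <= eta ^+ 4 -> I (fun x => (ur x - us x) ^+ 2) <= eta ^+ 4 ->
  I (fun x => udot x ^+ 2) <= n ->
  I (fun x => (phi x - (5 * um - S x) * (2^-1 * ((ut x - S x) + (us x - S x)))) ^+ 2) <= eta ^+ 4 ->
  I (fun x => (5 * um - S x) * (ur x - S x) * udot x) <= 32 / um * crit X um ur S ^+ 2 - sg * crit X um ur S ->
  I (fun x => udot x * phi x) <= eta * (n + rate_const B).
Proof.
move=> eta0 eta1 hB c0 h1 h2 hn hphi sp.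
have B0 : 0 <= B by have := sqr_I_ge0 (fun x => us x - S x); lra.
have e2 : 0 <= eta ^+ 2 by exact: sqr_ge0.
have e21 : eta ^+ 2 <= 1 by rewrite expr_le1// ltW.
have e2e : eta ^+ 2 <= eta by rewrite expr2 ler_piMr// ltW.
have e4 : eta ^+ 4 = eta ^+ 2 * eta ^+ 2 by ring.
have e41 : eta ^+ 4 <= 1 by rewrite expr_le1// ltW.
have Lz : L2f (fun x => (5 * um - S x) * (2^-1 * ((ut x - S x) + (us x - S x)))).
  by apply: (L2f_weight um0 ul3 hS); apply: L2fZ; exact: L2fD.
have La := L2f_weight um0 ul3 hS Lr.
have Lg := L2fB Lphi La.
have Lts : L2f (fun x => ut x - us x) by have := L2fB Lt Ls; congr L2f; apply/funext => x; ring.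
have Lrs : L2f (fun x => ur x - us x) by have := L2fB Lr Ls; congr L2f; apply/funext => x; ring.
have E : I (fun x => udot x * phi x) = I (fun x => (5 * um - S x) * (ur x - S x) * udot x) +
    I (fun x => udot x * (phi x - (5 * um - S x) * (ur x - S x))).
  by rewrite -ID; [apply: I_ext => x; ring|exact: L2f_mul|exact: L2f_mul].
have g2 : I (fun x => (phi x - (5 * um - S x) * (ur x - S x)) ^+ 2) <= (2 + 320 * um ^+ 2) * eta ^+ 4.
  have Lh : L2f (fun x => 2^-1 * ((ut x - us x) - 2 * (ur x - us x))).
    by apply: L2fZ; apply: L2fB => //; exact: L2fZ.
  have -> : I (fun x => (phi x - (5 * um - S x) * (ur x - S x)) ^+ 2) =
     I (fun x => ((phi x - (5 * um - S x) * (2^-1 * ((ut x - S x) + (us x - S x)))) +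
        (5 * um - S x) * (2^-1 * ((ut x - us x) - 2 * (ur x - us x)))) ^+ 2).
    by apply: I_ext => x; congr (_ ^+ 2); field.
  apply: le_trans (I_sqrD (L2fB Lphi Lz) (L2f_weight um0 ul3 hS Lh)) _.
  have a1 := I_weight_sqr hS Lh.
  have a2 : I (fun x => (2^-1 * ((ut x - us x) - 2 * (ur x - us x))) ^+ 2) <=
      (5 / 2) * eta ^+ 4.
    have -> : I (fun x => (2^-1 * ((ut x - us x) - 2 * (ur x - us x))) ^+ 2) =
      4^-1 * I (fun x => ((ut x - us x) + - 2 * (ur x - us x)) ^+ 2).
      rewrite -IZ; last exact: (L2fD Lts (L2fZ (- 2) Lrs)).2.
      by apply: I_ext => x; field.
    have := I_sqrD Lts (L2fZ (- 2) Lrs).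
    have -> : I (fun x => (- 2 * (ur x - us x)) ^+ 2) = 4 * I (fun x => (ur x - us x) ^+ 2).
      by rewrite -IZ; [apply: I_ext => x; ring|exact: Lrs.2].
    by move: h1 h2; lra.
  have a3 : 64 * um ^+ 2 * I (fun x => (2^-1 * ((ut x - us x) - 2 * (ur x - us x))) ^+ 2) <=
      64 * um ^+ 2 * ((5 / 2) * eta ^+ 4).
    by apply: ler_wpM2l => //; rewrite mulr_ge0 ?sqr_ge0.
  by move: a1 a3 hphi; lra.
have b1 : I (fun x => udot x * (phi x - (5 * um - S x) * (ur x - S x))) <=
    eta * (n + (1 + 160 * um ^+ 2)).
  apply: le_trans (ler_norm _) _; apply: le_trans (young_I eta0 Lud Lg) _.
  have t1 : eta / 2 * I (fun x => udot x ^+ 2) <= eta * n.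
    have n0 : 0 <= n by apply: le_trans hn; exact: sqr_I_ge0.
    have : eta * I (fun x => udot x ^+ 2) <= eta * n by apply: ler_wpM2l => //; exact: ltW.
    by have := mulr_ge0 (ltW eta0) n0; lra.
  have t2 : (2 * eta)^-1 * I (fun x => (phi x - (5 * um - S x) * (ur x - S x)) ^+ 2) <=
      eta * (1 + 160 * um ^+ 2).
    rewrite ler_pdivrMl ?mulr_gt0//; apply: le_trans g2 _.
    rewrite (_ : 2 * eta * _ = (2 + 320 * um ^+ 2) * eta ^+ 2); last by ring.
    apply: ler_wpM2l; first by have := sqr_ge0 um; lra.
    by rewrite e4 ler_piMr.
  by rewrite mulrDr; lra.
have b2 : 32 / um * crit X um ur S ^+ 2 - sg * crit X um ur S <=
    eta * (rate_const B - (1 + 161 * um ^+ 2)).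
  rewrite /rate_const; set Q := crit_const B.
  have kQ : `|crit X um ur S| <= eta ^+ 2 * Q.
    have t0 : 0 < (eta ^+ 2)^-1 by rewrite invr_gt0 exprn_gt0.
    have := crit_diff hM t0 hS Lr Ls; rewrite c0 subr0 => /le_trans; apply.
    have r1 : I (fun x => (ur x - S x) ^+ 2) <= 4 * B + 2.
      have -> : I (fun x => (ur x - S x) ^+ 2) = I (fun x => ((ur x - us x) + (us x - S x)) ^+ 2).
        by apply: I_ext => x; congr (_ ^+ 2); ring.
      by have := I_sqrD Lrs Ls; move: h2 hB e41; lra.
    have t1 : (eta ^+ 2)^-1 / 2 * I (fun x => (ur x - us x) ^+ 2) <= eta ^+ 2 / 2.
      apply: le_trans (_ : (eta ^+ 2)^-1 / 2 * eta ^+ 4 <= _).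
        by apply: ler_wpM2l => //; rewrite divr_ge0// ltW.
      by rewrite le_eqVlt; apply/orP; left; apply/eqP; field; rewrite gt_eqF.
    have ei : (2 * (eta ^+ 2)^-1)^-1 = eta ^+ 2 / 2 by field; rewrite gt_eqF.
    rewrite ei.
    have t2 : eta ^+ 2 / 2 * (128 * um ^+ 2 * M * (um - ul) + M ^+ 2 *
       (I (fun x => (ur x - S x) ^+ 2) + I (fun x => (us x - S x) ^+ 2))) <=
       eta ^+ 2 / 2 * (128 * um ^+ 2 * M * (um - ul) + M ^+ 2 * (6 * B + 2)).
      apply: ler_wpM2l; first by rewrite divr_ge0.
      by rewrite lerD2l ler_wpM2l ?sqr_ge0//; move: r1 hB; lra.
    by rewrite /Q /crit_const; move: t1 t2; lra.
  have Q0 : 0 <= Q.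
    have : 0 <= eta ^+ 2 * Q by apply: le_trans kQ.
    by rewrite pmulr_rge0// exprn_gt0.
  have kQ2 : crit X um ur S ^+ 2 <= eta * Q ^+ 2.
    rewrite -(real_normK (num_real (crit _ _ _ _))).
    apply: le_trans (_ : (eta ^+ 2 * Q) ^+ 2 <= _); first by (rewrite ler_sqr ?nnegrE//; exact: mulr_ge0).
    rewrite exprMn; apply: ler_wpM2r; first exact: sqr_ge0.
    by apply: le_trans e2e; rewrite expr2 ler_piMr.
  have k1 : 32 / um * crit X um ur S ^+ 2 <= 32 / um * (eta * Q ^+ 2).
    by apply: ler_wpM2l => //; rewrite divr_ge0// ltW.
  have k2 : - sg * crit X um ur S <= `|sg| * (eta * Q).
    apply: le_trans (ler_norm _) _; rewrite normrM normrN; apply: ler_wpM2l => //.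
    by apply: le_trans kQ _; apply: ler_wpM2r.
  by move: k1 k2; lra.
rewrite E; apply: le_trans (lerD sp (lexx _)) _; apply: le_trans (lerD b2 b1) _.
by have := mulr_ge0 (ltW eta0) (sqr_ge0 um); lra.
Qed.
End rate.
End energy_increment.

Section energy_decay.
Context {R : realType}.
Local Notation mu := (@lebesgue_measure R).
Context (X X1 : R -> R) (ul um : R) (ulum : ul < um).
Hypotheses (dX : forall x : R, is_derive x 1 X (X1 x)) (cX1 : continuous X1)
  (X0 : forall y, ul < y < um -> 0 < X y) (um0 : 0 < um) (ul3 : - (3 * um) <= ul).
Local Notation wave := (wave X ul um).
Context (T sg : R) (u udot : R -> R -> R) (uS N : R -> R) (hS : wave uS).
Hypotheses (T0 : 0 <= T) (Lv : forall r, 0 <= r <= T -> L2f (fun x => u r x - uS x))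
  (cv : forall r e, 0 <= r <= T -> 0 < e -> exists2 d, 0 < d & forall r', 0 <= r' <= T ->
    `|r' - r| < d -> I (fun x => (u r' x - u r x) ^+ 2) <= e)
  (rep : forall r, 0 <= r <= T -> exists2 U : R -> R, continuous U & {ae mu, forall x, u r x = U x})
  (td : is_time_derivative T u udot) (iN : intg 0 T N)
  (hN : {ae mu, forall r, 0 < r < T -> L2f (udot r) /\ I (fun x => udot r x ^+ 2) <= N r})
  (sp : {ae mu, forall r, 0 < r < T -> forall Z,
    I (fun x => (5 * um - shift_by uS Z x) * (u r x - shift_by uS Z x) * udot r x) <=
    32 / um * crit X um (u r) (shift_by uS Z) ^+ 2 - sg * crit X um (u r) (shift_by uS Z)}).

Let e r Z := en um (u r) (shift_by uS Z).

Let Ld r r' : 0 <= r <= T -> 0 <= r' <= T -> L2f (fun x => u r x - u r' x).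
Proof.
by move=> h h'; have := L2fB (Lv h) (Lv h'); congr L2f; apply/funext => x; ring.
Qed.

Let LZ r Z : 0 <= r <= T -> L2f (fun x => u r x - shift_by uS Z x).
Proof. by move=> h; exact: (L2f_shift dX cX1 X0 Z hS (Lv h)). Qed.

Let dist2 r r' r'' : 0 <= r <= T -> 0 <= r' <= T -> 0 <= r'' <= T ->
  I (fun x => (u r x - u r'' x) ^+ 2) <=
  2 * I (fun x => (u r x - u r' x) ^+ 2) + 2 * I (fun x => (u r'' x - u r' x) ^+ 2).
Proof.
move=> h1 h2 h3; have := I_sqrD (Ld h1 h2) (Ld h2 h3).
have -> : I (fun x => (u r x - u r' x + (u r' x - u r'' x)) ^+ 2) = I (fun x => (u r x - u r'' x) ^+ 2).
  by apply: I_ext => x; congr (_ ^+ 2); ring.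
have -> // : I (fun x => (u r' x - u r'' x) ^+ 2) = I (fun x => (u r'' x - u r' x) ^+ 2).
by apply: I_ext => x; ring.
Qed.

(** Local boundedness from the continuity in time, propagated by [chain_local]. *)
Lemma energy_bounded : exists2 B, 0 <= B & forall r, 0 <= r <= T ->
  I (fun x => (u r x - uS x) ^+ 2) <= B.
Proof.
have : exists B, forall r, 0 <= r <= T -> I (fun x => (u r x - uS x) ^+ 2) <= B.
  apply: (@chain_local R (fun x y => exists B, forall r, x <= r <= y ->
      I (fun z => (u r z - uS z) ^+ 2) <= B) 0 T T0).
    move=> x y z _ xy yz _ [B1 h1] [B2 h2]; exists (Num.max B1 B2) => r /andP[xr rz].
    rewrite le_max; have [ry|/ltW yr] := leP r y; first by rewrite h1 ?xr.
    by rewrite h2 ?orbT ?yr.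
  move=> t tT; have [d d0 hd] := cv tT ltr01; exists d => // x y x0 xy yT xd yd.
  exists (2 * 1 + 2 * I (fun z => (u t z - uS z) ^+ 2)) => r /andP[xr ry].
  have rT : 0 <= r <= T by rewrite (le_trans x0 xr) (le_trans ry yT).
  have rd : `|r - t| < d.
    by move: xd yd; rewrite !ltr_norml => /andP[? ?] /andP[? ?]; apply/andP; split; lra.
  have := I_sqrD (Ld rT tT) (Lv tT); have := hd r rT rd.
  have -> : I (fun x => (u r x - u t x + (u t x - uS x)) ^+ 2) = I (fun x => (u r x - uS x) ^+ 2).
    by apply: I_ext => z; congr (_ ^+ 2); ring.
  by move=> h1 h2; apply: le_trans h2 _; rewrite lerD2r ler_wpM2l.
move=> [B hB]; exists B => //; apply: le_trans (hB 0 _); first exact: sqr_I_ge0.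
by rewrite lexx.
Qed.

(** The translate is kept fixed during the step, so no regularity of the minimiser in time enters.
    [C] must be independent of [eta], [s], [t] and [Z], which [energy_bounded] ensures. *)
Lemma energy_step : exists2 C, 0 <= C & forall eta s t Z, 0 < eta -> eta <= 1 ->
  0 < s -> s < t -> t < T ->
  (forall r, s <= r <= t -> I (fun x => (u r x - u s x) ^+ 2) <= eta ^+ 4) ->
  (forall Z', e s Z <= e s Z') -> crit X um (u s) (shift_by uS Z) = 0 ->
  e t Z <= e s Z + eta * int s t (fun r => N r + C).
Proof.
have [B B0 hB] := energy_bounded; have [M M0 hM] := X_bounded ul um dX.
pose C1 := rate_const ul um sg M B.
have C10 : 0 <= C1 by exact: (rate_const_ge0 ulum).
exists (C1 + 1); first by rewrite addr_ge0.
move=> eta s t Z eta0 eta1 s0 st tT osc mini c0.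
have sT r : s <= r -> r <= t -> 0 <= r <= T by move=> h1 h2; apply/andP; split; lra.
have hs : 0 <= s <= T by apply: sT => //; exact: ltW.
have ht : 0 <= t <= T by apply: sT => //; exact: ltW.
have hZ := wave_shift Z hS; set S := shift_by uS Z in hZ c0 *.
have Ls := LZ Z hs; have Lt := LZ Z ht.
pose z x := (5 * um - S x) * (2^-1 * ((u t x - S x) + (u s x - S x))).
have Lz : L2f z.
  by apply: (L2f_weight um0 ul3 hZ); apply: L2fZ; exact: L2fD.
have [Ut cUt hUt] := rep ht; have [Us cUs hUs] := rep hs.
(* A continuous version of [z], since the density of test functions is available for continuous
   functions. *)
pose zc x := (5 * um - S x) * (2^-1 * ((Ut x - S x) + (Us x - S x))).
have cS := wave_cont hZ.
have czc : continuous zc.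
  move=> x; apply: cvgM; first by apply: cvgB; [exact: cvg_cst|exact: cS].
  apply: cvgM; first exact: cvg_cst.
  by apply: cvgD; apply: cvgB; [exact: cUt|exact: cS|exact: cUs|exact: cS].
have zzc : {ae mu, forall x, z x = zc x}.
  by apply: aeS (aeI hUt hUs) => x [h1 h2]; rewrite /z /zc h1 h2.
have Lzc : L2f zc by apply: (L2f_ae _ zzc Lz); exact: continuous_measurable_fun.
(* The replacement of [z] by a test function may cost at most [eta (t - s)], so that it adds up like
   the main term; this accounts for [C1 + 1]. *)
pose th := eta * (t - s); have th0 : 0 < th by rewrite mulr_gt0// subr_gt0.
have ep0 : 0 < Num.min (eta ^+ 4) (th ^+ 2) by rewrite lt_min !exprn_gt0.
have [phi [tp Lp hphi]] := L2_test_dense czc Lzc ep0.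
have {}hphi : I (fun x => (phi x - z x) ^+ 2) <= Num.min (eta ^+ 4) (th ^+ 2).
  rewrite (_ : I _ = I (fun x => (phi x - zc x) ^+ 2))//.
  apply: I_ae; [|exact: (L2fB Lp Lz).2|exact: (L2fB Lp Lzc).2].
  by apply: aeS zzc => x ->.
move: hphi; rewrite le_min => /andP[hphi1 hphi2].
have [ih hh] := time_increment s0 st tT td tp Lp (wave_cont hS) Lv cv.
have Ldts := Ld ht hs.
have oscts := osc t; rewrite lexx (ltW st) in oscts; have {}oscts := oscts isT.
have dE : e t Z - e s Z = I (fun x => (u t x - u s x) * phi x) +
    I (fun x => (u t x - u s x) * (z x - phi x)).
  rewrite /e (en_diff um0 ul3 hZ Lt Ls) -ID; [|exact: L2f_mul|by apply: L2f_mul => //; exact: L2fB].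
  by apply: I_ext => x; rewrite /z; ring.
have iNst : intg s t N by apply: intgS iN; apply: ltW.
have ic (c : R) : intg s t (fun=> c) by apply: intg_cont => ?; exact: cvg_cst.
have b1 : I (fun x => (u t x - u s x) * phi x) <= eta * int s t (fun r => N r + C1).
  rewrite hh -intZ; last exact: intgD.
  apply: int_le_ae => //; first by apply: intgZ; exact: intgD.
  apply: aeS (aeI hN sp) => r [h1 h2] /andP[sr rt].
  have rT : 0 < r < T by apply/andP; split; lra.
  have [Lu hu] := h1 rT; have rT' := sT r sr rt.
  apply: (rate_bound dX X0 um0 ul3 hZ (hM S hZ) Ls Lt (LZ Z rT') Lu Lp eta0 eta1 _ c0 oscts _ hu hphi1 (h2 rT Z)).
    (* By minimality the energy at [Z] is at most the one at shift 0, hence at most [4 um B];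
       dividing by the lower constant [2 um] gives the bound [2 B], whatever [Z] is. *)
    have /andP[a1 _] := en_bounds um0 ul3 hZ Ls.
    have /andP[_ a2] := en_bounds um0 ul3 (wave_shift 0 hS) (LZ 0 hs).
    have a3 := mini 0; rewrite /e -/S in a3.
    have a4 := le_trans a1 (le_trans a3 a2).
    have a5 : I (fun x => (u s x - shift_by uS 0 x) ^+ 2) = I (fun x => (u s x - uS x) ^+ 2).
      by apply: I_ext => x; rewrite /shift_by addr0.
    have a6 := hB s hs; rewrite a5 in a4.
    rewrite -(ler_pM2l um0); have := ler_wpM2l (ltW um0) a6; move: a4; lra.
  by apply: osc; rewrite sr rt.
have b2 : I (fun x => (u t x - u s x) * (z x - phi x)) <= th.
  apply: le_trans (ler_norm _) _; apply: le_trans (young_I th0 Ldts (L2fB Lz Lp)) _.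
  have -> : I (fun x => (z x - phi x) ^+ 2) = I (fun x => (phi x - z x) ^+ 2).
    by apply: I_ext => x; ring.
  have q1 : th / 2 * I (fun x => (u t x - u s x) ^+ 2) <= th / 2.
    rewrite ler_piMr//; first by rewrite divr_ge0// ltW.
    by apply: le_trans oscts _; rewrite expr_le1// ltW.
  have q2 : (2 * th)^-1 * I (fun x => (phi x - z x) ^+ 2) <= th / 2.
    have t20 : 0 < 2 * th by rewrite mulr_gt0.
    rewrite (ler_pdivrMl _ _ t20). apply: (le_trans hphi2 _).
    by rewrite le_eqVlt; apply/orP; left; apply/eqP; field.
  lra.
have iE : int s t (fun r => N r + (C1 + 1)) = int s t (fun r => N r + C1) + (t - s).
  have := intD (intgD iNst (ic C1)) (ic 1); rewrite (int_cst _ (ltW st)) mul1r => <-.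
  by apply: eq_int => r _; ring.
by rewrite iE mulrDr -/th; move: dE b1 b2; lra.
Qed.

(** On a short interval one first moves to a minimiser at its left end, which does not increase the
    energy, and then applies [energy_step]. The times stay inside the open interval, where
    [time_increment] is available. *)
Lemma energy_chain s0 T1 Z0 : 0 < s0 -> s0 <= T1 -> T1 < T -> exists Z, e T1 Z <= e s0 Z0.
Proof.
move=> s00 sT1 T1T; have [C C0 hC] := energy_step.
have iNC a b : 0 <= a -> b <= T -> intg a b (fun r => N r + C).
  move=> a0 bT; apply: intgD; first exact: intgS iN.
  by apply: intg_cont => ?; exact: cvg_cst.
have T1T' : 0 <= T1 <= T by apply/andP; split; lra.
(* The witness is the minimiser at the final time, fixed before [eta]: the shifts found along the
   chain depend on [eta], but all are beaten by this one. *)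
have [Z [minZ _]] := minimiser_exists ulum dX cX1 X0 um0 ul3 hS (Lv T1T').
exists Z; apply/ler_addgt0Pr => dl dl0.
pose K := `|int s0 T1 (fun r => N r + C)| + 1.
have K0 : 0 < K by rewrite ltr_wpDl.
pose eta := Num.min 1 (dl / K).
have eta0 : 0 < eta by rewrite lt_min ltr01 divr_gt0.
have eta1 : eta <= 1 by rewrite ge_min lexx.
have etaK : eta * K <= dl by rewrite -ler_pdivlMr// ge_min lexx orbT.
have : forall Z1, exists Z2, e T1 Z2 <= e s0 Z1 + eta * int s0 T1 (fun r => N r + C).
  apply: (@chain_local R (fun x y => forall Z1, exists Z2,
      e y Z2 <= e x Z1 + eta * int x y (fun r => N r + C)) s0 T1 sT1).
    move=> x y z ax xy yz zb h1 h2 Z1; have [Z2 hZ2] := h1 Z1; have [Z3 hZ3] := h2 Z2.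
    exists Z3; rewrite (int_split (iNC x z _ _) xy yz); [|lra..].
    by rewrite mulrDr; lra.
  move=> t /andP[st tT1]; have tT : 0 <= t <= T by apply/andP; split; lra.
  (* A quarter, because comparing two times through [t] by [dist2] costs [2 + 2] times this
     amount. *)
  have ee : 0 < eta ^+ 4 / 4 by rewrite divr_gt0// exprn_gt0.
  have [d d0 hd] := cv tT ee; exists d => // x y sx xy yT1 xd yd Z1.
  move: xy; rewrite le_eqVlt => /predU1P[<-|xy].
    by exists Z1; rewrite int_set1 mulr0 addr0.
  have xT : 0 <= x <= T by apply/andP; split; lra.
  have [Z2 [min2 c2]] := minimiser_exists ulum dX cX1 X0 um0 ul3 hS (Lv xT).
  exists Z2; apply: le_trans (hC eta x y Z2 eta0 eta1 _ xy _ _ min2 c2) _; [lra|lra| |].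
    move=> r /andP[xr ry]; have rT : 0 <= r <= T by apply/andP; split; lra.
    have rd : `|r - t| < d.
      by move: xd yd; rewrite !ltr_norml => /andP[? ?] /andP[? ?]; apply/andP; split; lra.
    by have := dist2 rT tT xT; have := hd r rT rd; have := hd x xT xd; lra.
  by rewrite lerD2r; exact: min2.
move=> /(_ Z0)[Z2 hZ2]; apply: le_trans (minZ Z2) _; apply: le_trans hZ2 _.
rewrite lerD2l; apply: le_trans etaK; apply: ler_wpM2l; first exact: ltW.
by rewrite /K; have := ler_norm (int s0 T1 (fun r => N r + C)); lra.
Qed.

(** The chain starts at a small positive time [s]; continuity of [u] at time 0 makes the energy at
    shift 0 change by at most [dl] between 0 and [s]. *)
Lemma energy_decay T1 : 0 < T1 -> T1 < T -> exists Z, e T1 Z <= e 0 0.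
Proof.
move=> T10 T1T; have T1T' : 0 <= T1 <= T by apply/andP; split; lra.
have [Z [minZ _]] := minimiser_exists ulum dX cX1 X0 um0 ul3 hS (Lv T1T').
exists Z; apply/ler_addgt0Pr => dl dl0.
have z0 : 0 <= (0 : R) <= T by rewrite lexx.
have L0 := LZ 0 z0; have hZ := wave_shift 0 hS; set S := shift_by uS 0 in hZ L0.
have La := L2f_weight um0 ul3 hZ L0.
pose A := I (fun x => ((5 * um - S x) * (u 0 x - S x)) ^+ 2) + 1.
have A1 : 1 <= A by rewrite lerDr; exact: sqr_I_ge0.
pose th := A / dl; have th0 : 0 < th by rewrite divr_gt0//; lra.
(* The coefficient of the squared distance between times 0 and [s]: [th / 2] from Young's inequality
   and [4 um] from the quadratic part of the energy. Together they may use [dl / 2]. *)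
pose k := th / 2 + 4 * um.
have k0 : 0 < k by rewrite /k; have := um0; lra.
have dk : 0 < dl / 2 / k by rewrite !divr_gt0.
have [d d0 hd] := cv z0 dk.
pose s := Num.min (d / 2) T1.
have s0 : 0 < s by rewrite lt_min T10 divr_gt0.
have sT1 : s <= T1 by rewrite ge_min lexx orbT.
have sd : s <= d / 2 by rewrite ge_min lexx.
have sT : 0 <= s <= T by apply/andP; split; lra.
have hds : I (fun x => (u s x - u 0 x) ^+ 2) <= dl / 2 / k.
  by apply: hd => //; rewrite subr0 gtr0_norm//; lra.
have [Z2 hZ2] := energy_chain 0 s0 sT1 T1T.
apply: le_trans (minZ Z2) _; apply: le_trans hZ2 _.
rewrite -lerBlDl /e (en_diff um0 ul3 hZ (LZ 0 sT) L0) -/S.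
have Lds := Ld sT z0.
have -> : I (fun x => (u s x - u 0 x) * ((5 * um - S x) * (2^-1 * (u s x - S x + (u 0 x - S x))))) =
  I (fun x => (u s x - u 0 x) * ((5 * um - S x) * (u 0 x - S x))) +
  2^-1 * I (fun x => (5 * um - S x) * (u s x - u 0 x) * (u s x - u 0 x)).
  rewrite -IZ; last exact: (L2f_mul (L2f_weight um0 ul3 hZ Lds) Lds).
  rewrite -ID; [|exact: L2f_mul|by apply: itgZ; exact: (L2f_mul (L2f_weight um0 ul3 hZ Lds) Lds)].
  by apply: I_ext => x; field.
have b1 : I (fun x => (u s x - u 0 x) * ((5 * um - S x) * (u 0 x - S x))) <=
    th / 2 * (dl / 2 / k) + dl / 2.
  apply: le_trans (ler_norm _) _; apply: le_trans (young_I th0 Lds La) _; apply: lerD.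
    by apply: ler_wpM2l => //; rewrite divr_ge0// ltW.
  apply: le_trans (_ : (2 * th)^-1 * A <= _).
    by apply: ler_wpM2l; [rewrite invr_ge0 mulr_ge0// ltW|rewrite /A lerDl].
  by rewrite /th le_eqVlt; apply/orP; left; apply/eqP; field; rewrite !gt_eqF//; lra.
have b2 : I (fun x => (5 * um - S x) * (u s x - u 0 x) * (u s x - u 0 x)) <= 8 * um * (dl / 2 / k).
  apply: le_trans (_ : I (fun x => 8 * um * (u s x - u 0 x) ^+ 2) <= _).
    apply: I_le => [||x]; first exact: (L2f_mul (L2f_weight um0 ul3 hZ Lds) Lds).
      by apply: itgZ; exact: Lds.2.
    rewrite -mulrA -expr2 ler_wpM2r ?sqr_ge0//.
    by have /andP[] := weight_bound um0 ul3 x hZ.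
  rewrite IZ; last exact: Lds.2.
  by apply: ler_wpM2l => //; have := um0; lra.
have ke : k * (dl / 2 / k) = dl / 2 by field; rewrite gt_eqF.
by move: ke b1 b2; rewrite {1}/k; lra.
Qed.
End energy_decay.

(** * From the real-valued energy back to the theorem *)

Section weighted_energy_value.
Context {R : realType}.

Lemma weighted_energyE (um ul sigma t : R) (Xf S uS : R -> R) (u : R -> R -> R) (Xs : R -> R) :
  0 < um -> - (3 * um) <= ul -> wave Xf ul um S -> L2f (fun x => u t x - S x) ->
  (forall x, uS (x - sigma * t + Xs t) = S x) ->
  weighted_energy um uS sigma Xs u t = (en um (u t) S)%:E.
Proof.
move=> um0 ul3 hS hu E; have i := en_itg um0 ul3 hS hu.
rewrite /weighted_energy /en (mulrC _ 2^-1) EFinM EFin_I//; congr (_ * _)%E.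
by apply: eq_integral => x _; rewrite E.
Qed.
End weighted_energy_value.

Theorem mainTheorem3 (R : realType) (um : R) (um_gt0 : 0 < um) :
  exists eps0 : R, 0 < eps0 /\
  forall f : R -> R, Cdiff 3 f -> (flux_eps um f <= eps0%:E)%E ->
  (exists! ul : R, left_state um f ul) /\
  forall ul : R, left_state um f ul ->
  (exists! uS : R -> R, viscous_profile um f ul uS) /\
  forall uS : R -> R, viscous_profile um f ul uS ->
  forall (u0 : R -> R) (u : R -> R -> R),
  sobolev 1 (u0 \- uS) -> global_strong_solution f uS u0 u ->
  exists X : R -> R, X 0 = 0 /\
    forall t : R, 0 <= t ->
      (weighted_energy um uS (shock_speed um f ul) X u t <=
       weighted_energy um uS (shock_speed um f ul) X u 0)%E.
Proof.
have q0 : 0 < 500 * 500 :> R by lra.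
(* [k] is the largest value that [perturb_margin] admits, and 100 is the constant of [bracket_near];
   neither depends on [um], by homogeneity. *)
pose k : R := (500 * 500)^-1; pose eps : R := k / 100.
have k0 : 0 < k by rewrite invr_gt0.
have ek : 100 * eps <= k by rewrite /eps; lra.
have k1 : 500 * (500 * k) <= 1.
  have : k * (500 * 500) = 1 by exact: mulVf (lt0r_neq0 q0).
  by lra.
have e0 : 0 <= eps by rewrite divr_ge0// ltW.
have e1 : 1000 * eps <= 1 by move: ek k1 e0; lra.
exists eps; split; first by rewrite divr_gt0.
move=> f Cf hf; have [df df1 hq] := flux_eps_bound um_gt0 Cf hf.
split; first exact: (left_state_unique_exists um_gt0 e0 e1 df df1 hq).
move=> ul /(left_stateP um_gt0 e0 e1 df df1 hq) hul.
split; first exact: (viscous_profile_unique_exists um_gt0 e0 e1 df df1 hq hul).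
move=> uS /(viscous_profileP um_gt0 df df1 hul) hS u0 u _ [gs _].
have [dS l1 l2 _] := hS.
have hw : wave (excess um f (derive1 f)) ul um uS.
  by split => //; exact: (heteroclinic_between um_gt0 e0 e1 df df1 hq hul hS).
have dX := excess_der um df.
have cX1 : continuous (fun x => derive1 f x - derive1 f um).
  by move=> x; apply: cvgB; [exact: der_cont (df1 x)|exact: cvg_cst].
have X0 y : ul < y < um -> 0 < excess um f (derive1 f) y.
  exact: (excess_gt0 um_gt0 e0 e1 df df1 hq hul).
have [ul1 ul2 _] := hul.
have ul3 : - (3 * um) <= ul by lra.
have ulum : ul < um by lra.
have decay t : 0 < t -> [/\ L2f (fun x => u t x - uS x), L2f (fun x => u 0 x - uS x) &
    exists Z, en um (u t) (shift_by uS Z) <= en um (u 0) (shift_by uS 0)].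
  move=> t0; have T0 : 0 < t + 1 by lra.
  have [cs _ [ut [b0 td aet]]] := gs _ T0.
  have [Lv cv] := continuous_in_sobolev_L2 cs; have [sob _] := cs.
  have [N [_ iN hN]] := bochner_L2_energy b0.
  have tT : 0 <= t <= t + 1 by apply/andP; split; lra.
  have zT : 0 <= (0 : R) <= t + 1 by rewrite lexx ltW.
  split; [exact: Lv t tT|exact: Lv 0 zT|].
  apply: (@energy_decay R _ _ ul um ulum dX cX1 X0 um_gt0 ul3 (t + 1) (derive1 f um) u ut uS N hw
    (ltW T0) Lv _ _ td iN hN _ t t0); last by lra.
  - move=> r ep rT ep0; have [d d0 hd] := cv r ep rT ep0; exists d => // r' r'T r'd.
    have := hd r' r'T r'd; congr (_ <= _); apply: I_ext => x /=; congr (_ ^+ 2); ring.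
  - move=> r rT; have [_ [h wh _]] := sob r rT; have [V [cV vV _]] := ac_rep wh.
    exists (fun x => V x + uS x).
      by move=> x; apply: cvgD; [exact: cV|exact: (wave_cont hw)].
    by apply: aeS vV => x <- /=; rewrite subrK.
  - apply: aeS aet => r hr rT Z; have [fx [ux [uxx [w1 w2 w3 [Lut _ _] eqn]]]] := hr rT.
    have rT' : 0 <= r <= t + 1 by move: rT => /andP[? ?]; rewrite !ltW.
    exact: (spatial_at_time um_gt0 e0 ek k1 df df1 hq hul Z hw (sob r rT') w1 w2 w3 Lut eqn).
(* The condition on [t] stands under the quantifier so that [choice] yields a function on the whole
   line. *)
have ex t : exists Z, 0 < t -> en um (u t) (shift_by uS Z) <= en um (u 0) (shift_by uS 0).
  have [t0|t0] := ltP 0 t; last by exists 0.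
  by have [_ _ [Z hZ]] := decay t t0; exists Z.
have [Zf hZf] := choice ex.
set sg := shock_speed um f ul.
(* The drift [sg * t] undoes the moving frame, and time 0 is set apart because the chosen shift need
   not vanish there. *)
exists (fun t => if 0 < t then Zf t + sg * t else 0); split; first by rewrite ltxx.
move=> t; rewrite le_eqVlt => /predU1P[<-//|t0].
have [Lt L0 _] := decay t t0.
rewrite (@weighted_energyE R um ul sg t _ (shift_by uS (Zf t)) uS u _ um_gt0 ul3 (wave_shift _ hw)
  (L2f_shift dX cX1 X0 _ hw Lt)); last first.
  by move=> x; rewrite t0 /shift_by; congr uS; ring.
rewrite (@weighted_energyE R um ul sg 0 _ (shift_by uS 0) uS u _ um_gt0 ul3 (wave_shift _ hw)
  (L2f_shift dX cX1 X0 _ hw L0)); last first.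
  by move=> x; rewrite ltxx /shift_by; congr uS; ring.
by rewrite lee_fin; exact: hZf.
Qed.
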